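(* Let $N\ge 2$ be an integer, let $\alpha_N>0$ and $\beta_N>0$, and assume that $\beta_N\ge 2N^2$. Let $D=\{(x_1,\dots,x_N)\in\mathbb{R}^N : x_i\neq x_j \text{ for all } i\neq j\}$. Then for any initial data $\lambda_0\in D$ there exists a unique strong solution $(\lambda_t)_{t\ge 0}=(\lambda_t^1,\dots,\lambda_t^N)_{t\ge 0}$, defined on $[0,+\infty)$ and starting from $\lambda_0$, of the system of stochastic differential equations $$d\lambda_t^i=\frac{\alpha_N}{N^2}\sum_{j\ne i}\frac{1}{\lambda_t^i-\lambda_t^j}\,dt+2\sqrt{\frac{\alpha_N}{\beta_N}}\,dB_t^i,\qquad 1\le i\le N,$$ where $(B^i)_{1\le i\le N}$ is a family of independent standard real Brownian motions, and $T_{\partial D}=+\infty$ almost surely.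
   Context: For a solution $(\lambda_t)$ of the system and $\varepsilon>0$, define the stopping time $$T_\varepsilon=\inf\Big\{t\ge 0:\ \max_{1\le i\le N}|\lambda_t^i|\ge \varepsilon^{-1}\ \text{ or }\ \min_{1\le i\neq j\le N}|\lambda_t^i-\lambda_t^j|\le\varepsilon\Big\},$$ and $T_{\partial D}=\sup_{\varepsilon>0}T_\varepsilon$. (The system is the one written in the form $d\lambda_t^i=-\frac{\alpha_N}{2N^2}\sum_{j\neq i}W'(\lambda_t^i-\lambda_t^j)\,dt+2\sqrt{\alpha_N/\beta_N}\,dB_t^i$ with $W(x)=-\log(|x|^2)$, i.e. $-W'(x)=2/x$.) Thus $T_{\partial D}=+\infty$ means that there is neither collision nor explosion in finite time. *)

(* Defs.v *)
From HB Require Import structures.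
From mathcomp Require Import all_boot all_order all_algebra.
From mathcomp Require Import all_classical all_reals all_analysis.
Set Implicit Arguments.
Unset Strict Implicit.
Unset Printing Implicit Defensive.
Import Order.TTheory GRing.Theory Num.Theory.
Import numFieldNormedType.Exports.
Local Open Scope classical_set_scope.
Local Open Scope ring_scope.

(** Time is indexed by [R], but only the instants [t >= 0] are ever constrained.
    Almost-sure properties are stated with [{ae P, _}]: the property holds
    outside a set contained in a measurable [P]-null set. *)

Section Processes.
Context {R : realType} {d : measure_display} {T : measurableType d}.
Implicit Types (P : probability T R) (W : R -> T -> R).

Definition sigma_of {I : Type} (J : set I) (X : I -> T -> R) : set (set T) :=
  <<s \bigcup_(i in J) preimage_set_system setT (X i)
        (@measurable _ (measurableTypeR R)) >>.

Definition independent2 P (F G : set (set T)) : Prop :=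
  forall A C, F A -> G C -> P (A `&` C) = (P A * P C)%E.

(** Mutual independence of finitely many sigma-algebras.  Each [G i] contains
    the whole space, so the product rule over all of ['I_N] contains the product
    rule over every subfamily. *)
Definition mutually_independent P (N : nat) (G : 'I_N -> set (set T)) : Prop :=
  forall A : 'I_N -> set T, (forall i, G i (A i)) ->
    P (\bigcap_(i in [set: 'I_N]) A i) = (\prod_(i < N) P (A i))%E.

(** The second parameter of [normal_prob] is the standard deviation. *)
Definition standard_brownian_motion P W : Prop :=
  [/\ forall t, 0 <= t -> measurable_fun setT (W t),
      {ae P, forall w, W 0 w = 0},
      forall s t, 0 <= s -> s < t ->
        independent2 P (sigma_of `[0, s] W)
          (sigma_of [set: unit] (fun _ w => W t w - W s w)),
      forall s t, 0 <= s -> s < t ->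
        forall A : set (measurableTypeR R), measurable A ->
          P ((fun w => W t w - W s w) @^-1` A)
          = normal_prob 0 (Num.sqrt (t - s)) A
    & {ae P, forall w, {within `[0, +oo[, continuous (fun t => W t w)}}].

Definition independent_brownian_motions P (N : nat)
    (B : 'I_N -> R -> T -> R) : Prop :=
  (forall i, standard_brownian_motion P (B i)) /\
  mutually_independent P (fun i => sigma_of `[0, +oo[ (B i)).

(** [sigma(B^i_s : i, s <= t)] enlarged by the [P]-null events. *)
Definition augmented_filtration P (N : nat) (B : 'I_N -> R -> T -> R) (t : R) :
    set (set T) :=
  <<s sigma_of [set p : 'I_N * R | 0 <= p.2 <= t] (fun p => B p.1 p.2)
      `|` [set A | measurable A /\ P A = 0%E] >>.

Definition adapted (N : nat) (F : R -> set (set T))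
    (X : R -> T -> 'I_N -> R) : Prop :=
  forall (t : R) (i : 'I_N), 0 <= t ->
    forall A : set (measurableTypeR R), measurable A ->
      F t ((fun w => X t w i) @^-1` A).

Definition indistinguishable P (N : nat) (X Y : R -> T -> 'I_N -> R) : Prop :=
  {ae P, forall w, forall t, 0 <= t -> X t w = Y t w}.

End Processes.

Section System.
Context {R : realType} {N : nat}.
Implicit Types (alpha beta : R) (x : 'I_N -> R) (path : R -> 'I_N -> R).

Definition domainD : set ('I_N -> R) :=
  [set x | forall i j, i != j -> x i != x j].

Definition drift alpha x (i : 'I_N) : R :=
  alpha / N%:R ^+ 2 * \sum_(j < N | j != i) (x i - x j)^-1.

(** The noise is additive, so the system, in integral form, is an equation
    between paths.  The drift is only meaningful on [domainD] (in [R],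
    [0^-1 = 0]), so the path is required to be in [domainD] at Lebesgue-almost
    every time, and the drift to be integrable along it.  This does not exclude
    collisions. *)
Definition solves_system alpha beta x0 path (b : R -> 'I_N -> R) : Prop :=
  [/\ forall i, {within `[0, +oo[, continuous (fun t => path t i)},
      path 0 = x0,
      {ae (@lebesgue_measure R), forall s, 0 <= s -> domainD (path s)},
      forall t i, 0 <= t ->
        (@lebesgue_measure R).-integrable `[0, t]
          (fun s => (drift alpha (path s) i)%:E)
    & forall t i, 0 <= t ->
        path t i = x0 i
          + (\int[@lebesgue_measure R]_(s in `[0, t]) drift alpha (path s) i)
          + 2 * Num.sqrt (alpha / beta) * b t i].

Definition max_abs x : R := \big[Num.max/0]_(i < N) `|x i|.

(** Valued in [\bar R] so that the minimum over an empty family is [+oo]. *)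
Definition min_gap x : \bar R :=
  \big[Order.min/+oo%E]_(p : 'I_N * 'I_N | p.1 != p.2) `|x p.1 - x p.2|%:E.

Definition exit_time path (eps : R) : \bar R :=
  ereal_inf [set t%:E | t in
    [set t : R | 0 <= t /\
      (eps^-1 <= max_abs (path t) \/ (min_gap (path t) <= eps%:E)%E)]].

Definition boundary_time path : \bar R :=
  ereal_sup [set exit_time path eps | eps in [set eps : R | 0 < eps]].

(** Strong solution on [[0, +oo[] for a given Brownian family [B] and a
    deterministic initial condition [x0]. *)
Definition strong_solution {d : measure_display} {T : measurableType d}
    (P : probability T R) (B : 'I_N -> R -> T -> R) alpha beta x0
    (X : R -> T -> 'I_N -> R) : Prop :=
  adapted (augmented_filtration P B) X /\
  {ae P, forall w, solves_system alpha beta x0 (X ^~ w) (fun t i => B i t w)}.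

End System.

(* Main.v *)
Require Import Defs.
From HB Require Import structures.
From mathcomp Require Import all_boot all_order all_algebra.
From mathcomp Require Import all_classical all_reals all_analysis.
From mathcomp Require Import measurable_realfun ring lra.
Set Implicit Arguments.
Unset Strict Implicit.
Unset Printing Implicit Defensive.
Import Order.TTheory GRing.Theory Num.Theory.
Import numFieldNormedType.Exports.
Local Open Scope classical_set_scope.
Local Open Scope ring_scope.

(** The noise is additive: path by path, [X] minus the noise solves an ordinary
    differential equation whose vector field is smooth on [domainD].  Existence
    and uniqueness can therefore fail only through a collision or an explosion,
    and the point is that almost surely there is none.  Put
    [a = alpha / N ^ 2] and [sg = 2 sqrt (alpha / beta)], the strengths of the
    repulsion and of the noise; the hypothesis on [beta] says
    [sg ^ 2 <= 2 a].

    No collision.  Consider the function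
    [V x = sum_(i != j) (- ln |x_i - x_j| + 1 + x_i ^ 2 + x_j ^ 2)].
    It is nonnegative and tends to infinity at the boundary of [domainD] and at
    infinity.  The drift contributes to its mean rate of growth the term
    [- 2 a sum_i (sum_(j != i) 1 / (x_i - x_j)) ^ 2], and the noise contributes
    [sg ^ 2 sum_(i != j) 1 / (x_i - x_j) ^ 2].  The cross terms of the square
    cancel ([sum_sq_repulsion]), so the two sums are equal and the singular
    terms add up to something nonpositive.  What is left is a constant
    ([generator_le]).  Hence the mean of [V] grows at most linearly, and the
    probability of coming [eps]-close to the boundary before a fixed time is at
    most of order [1 / ln (1 / eps)].

    This is made rigorous on the Euler scheme of the system truncated at [eps],
    with time step [h].  A Taylor expansion bounds the change of [V] in one step
    ([pairpot_step], [lyapunov_step]).  Its noise terms have nonpositive mean,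
    because the increments of the motions are independent of the past
    ([enlarged_past_increment]), centred, and of variance at most [h]
    ([normal_moment1], [normal_moment2]).  Its remainder has mean of order
    [h ^ (3/2)], which still tends to [0] after summation over the steps
    ([dead_probability]).  The limit in [h], and then in [eps], gives
    [survival].

    The solution.  Euler polygons, their limits and the solutions of the
    integral equation are all approximate solutions in the sense of
    [approx_solution], and two approximate solutions with the same start stay
    close ([approx_stability]).  So the polygons of the truncated system
    converge to its unique solution, which inherits the survival of the scheme
    ([truncated_solution_safe]).  While a truncated solution is safe, finer
    truncations do not change it ([truncated_solution_stable]); the truncated
    solutions thus glue into a solution for all times ([glued_solution_solves]).
    It is adapted as a limit of polygons.  Any other solution for the same noise
    agrees with it as long as it stays away from the boundary, and by continuity
    it never ceases to do so ([solves_system_unique]). *)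

(** * Approximate solutions of differential equations *)

Lemma exists_fine_step (R : realType) (l h : R) : 0 <= l -> 0 < h ->
  exists n : nat, l / n.+1%:R <= h.
Proof.
move=> l0 h0; exists (Num.truncn (l / h)).
rewrite ler_pdivrMr ?ltr0n// mulrC -ler_pdivrMr//.
exact/ltW/truncnS_gt.
Qed.

(** An estimate proportional to [t - s] is additive, so it suffices to know it on
    the pieces of a subdivision finer than [h]. *)
Lemma chain_bound (R : realType) (u : R -> R) (a c h dl : R) :
  0 < h -> a <= c ->
  (forall s t, a <= s -> s <= t -> t <= c -> t - s <= h ->
    `|u t - u s| <= (t - s) * dl) ->
  `|u c - u a| <= (c - a) * dl.
Proof.
move=> h0 ac H.
have {}ac : 0 <= c - a by rewrite subr_ge0.
have [n] := exists_fine_step ac h0.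
set q := (c - a) / n.+1%:R => hq.
have q0 : 0 <= q by rewrite divr_ge0.
have qn : n.+1%:R * q = c - a by rewrite /q mulrC divfK.
have K k : (k <= n.+1)%N -> `|u (a + k%:R * q) - u a| <= k%:R * q * dl.
  elim: k => [|k IH] kn; first by rewrite !mul0r addr0 subrr normr0.
  have le1 : a <= a + k%:R * q by rewrite lerDl mulr_ge0.
  have le3 : a + k.+1%:R * q <= c.
    by rewrite -lerBrDl -qn ler_wpM2r// ler_nat.
  have e : a + k.+1%:R * q - (a + k%:R * q) = q by rewrite -natr1; ring.
  have le2 : a + k%:R * q <= a + k.+1%:R * q by rewrite -subr_ge0 e.
  have := H _ _ le1 le2 le3; rewrite e => /(_ hq) H1.
  have -> : k.+1%:R * q * dl = q * dl + k%:R * q * dl by rewrite -natr1; ring.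
  apply: le_trans (lerD H1 (IH (ltnW kn))).
  by rewrite -(subrKA (u (a + k%:R * q))); exact: ler_normD.
have := K n.+1 (leqnn _); rewrite qn.
by rewrite (_ : a + (c - a) = c) //; ring.
Qed.

Section ApproximateSolutions.
Context {R : realType} {N : nat}.
Variables (b : ('I_N -> R) -> 'I_N -> R) (C L : R).
Hypothesis L0 : 0 <= L.
Hypothesis b_lip : forall (x y : 'I_N -> R) (e : R), (forall i, `|x i - y i| <= e) ->
  forall i, `|b x i - b y i| <= L * e.
Implicit Types (w x : R -> 'I_N -> R).

(** The equation [x t - x s = int_s^t b (x r) dr + w t - w s] with the integrand
    frozen at time [s], up to an error proportional to [t - s].  The relation
    involves no integral, passes to pointwise limits, and is satisfied by exact
    solutions and by Euler polygons, with [dl] as small as desired. *)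
Definition approx_solution w (T h dl : R) x :=
  forall (s t : R) i, 0 <= s -> s <= t -> t <= T -> t - s <= h ->
    `|x t i - x s i - (w t i - w s i) - (t - s) * b (x s) i| <= (t - s) * dl.

(** Discrete Gronwall argument: on a grid of step [q] finer than [h] and [h'],
    the distance obeys [e_(k+1) <= (1 + L q) e_k + q (dl + dl')]. *)
Lemma approx_stability w (T h h' dl dl' : R) x x' :
  0 < h -> 0 < h' -> 0 <= dl -> 0 <= dl' ->
  approx_solution w T h dl x -> approx_solution w T h' dl' x' ->
  (forall i, x 0 i = x' 0 i) ->
  forall t i, 0 <= t -> t <= T ->
    `|x t i - x' t i| <= (dl + dl') * T * expR (L * T).
Proof.
move=> h0 h'0 d0 d'0 X X' x00 t i t0 tT.
have m0 : 0 < Num.min h h' by rewrite lt_min h0 h'0.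
have [n hn] := exists_fine_step t0 m0.
move: hn; set q := t / n.+1%:R => hq.
have q0 : 0 <= q by rewrite divr_ge0.
have qn : n.+1%:R * q = t by rewrite /q mulrC divfK.
set D := dl + dl'.
have D0 : 0 <= D by rewrite addr_ge0.
have K k : (k <= n.+1)%N -> forall i,
    `|x (k%:R * q) i - x' (k%:R * q) i| <= k%:R * q * D * (1 + L * q) ^+ k.
  elim: k => [|k IH] kn {}i.
    by rewrite !mul0r x00 subrr normr0.
  have {}IH := IH (ltnW kn).
  have le1 : 0 <= k%:R * q by rewrite mulr_ge0.
  have le3 : k.+1%:R * q <= T.
    by rewrite (le_trans _ tT)// -qn ler_wpM2r// ler_nat.
  have e : k.+1%:R * q - k%:R * q = q by rewrite -natr1; ring.
  have le2 : k%:R * q <= k.+1%:R * q by rewrite -subr_ge0 e.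
  have qh : q <= h by rewrite (le_trans hq)// ge_min lexx.
  have qh' : q <= h' by rewrite (le_trans hq)// ge_min lexx orbT.
  have := X _ _ i le1 le2 le3; rewrite e => /(_ qh) H1.
  have := X' _ _ i le1 le2 le3; rewrite e => /(_ qh') H2.
  have H3 := b_lip IH i.
  set E := k%:R * q * D * (1 + L * q) ^+ k in IH H3 *.
  have step : `|x (k.+1%:R * q) i - x' (k.+1%:R * q) i|
      <= (1 + L * q) * E + q * D.
    rewrite /D.
    have := IH i; move: H1 H2 H3.
    rewrite !ler_norml => /andP[A1 A2] /andP[A3 A4] /andP[A5 A6] /andP[A7 A8].
    have := ler_wpM2l q0 A6; have := ler_wpM2l q0 A5.
    move: A1 A2 A3 A4 A7 A8; lra.
  apply: le_trans step _.
  have -> : k.+1%:R * q * D * (1 + L * q) ^+ k.+1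
      = (1 + L * q) * E + q * D * (1 + L * q) ^+ k.+1.
    by rewrite /E exprS -natr1; ring.
  rewrite lerD2l ler_peMr ?mulr_ge0// exprn_ege1// lerDl mulr_ge0//.
have := K n.+1 (leqnn _) i; rewrite qn => /le_trans; apply.
have e1 : (1 + L * q) ^+ n.+1 <= expR (L * T).
  apply: (@le_trans _ _ (expR (L * q) ^+ n.+1)).
    by apply: lerXn2r; rewrite ?nnegrE ?addr_ge0 ?mulr_ge0 ?expR_ge0// expR_ge1Dx.
  rewrite -expRM_natl mulrCA qn ler_expR.
  exact: ler_wpM2l.
apply: ler_pM => //; rewrite ?mulr_ge0 ?exprn_ge0 ?addr_ge0 ?mulr_ge0//.
by rewrite mulrC ler_wpM2l.
Qed.

Hypothesis b_bnd : forall (x : 'I_N -> R) i, `|b x i| <= C.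

Definition path_modulus w (T h om : R) :=
  forall (s t : R) i, 0 <= s -> s <= t -> t <= T -> t - s <= h ->
    `|w t i - w s i| <= om.

Lemma approx_solution_dist w T h dl x : 0 < h ->
  approx_solution w T h dl x -> forall s t i, 0 <= s -> s <= t -> t <= T ->
  `|(x t i - w t i) - (x s i - w s i)| <= (t - s) * (C + dl).
Proof.
move=> h0 X s t i s0 st tT.
apply: (@chain_bound _ (fun r => x r i - w r i) _ _ h) => // s' t' ss' s't' t't hh.
have := X s' t' i (le_trans s0 ss') s't' (le_trans t't tT) hh.
have d0 : 0 <= t' - s' by rewrite subr_ge0.
have := ler_wpM2l d0 (b_bnd (x s') i).
rewrite -[X in X * `|_|]ger0_norm// -normrM.
rewrite !ler_norml => /andP[A1 A2] /andP[A3 A4]; apply/andP; split; lra.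
Qed.

(** Over a span [H], [x] moves by at most [(C + dl) H + om], so freezing the drift
    for the whole span costs [L] times that.  Thanks to this the span can stay
    fixed while the Euler step tends to [0]. *)
Lemma approx_solution_coarsen w T h H dl om x : 0 < h -> 0 <= C + dl ->
  approx_solution w T h dl x -> path_modulus w T H om ->
  approx_solution w T H (dl + L * ((C + dl) * H + om)) x.
Proof.
move=> h0 Cd0 X wom s t i s0 st tT stH.
have D := approx_solution_dist h0 X.
pose u r := x r i - w r i - r * b (x s) i.
have /= := @chain_bound _ u s t h (dl + L * ((C + dl) * H + om)) h0 st.
have -> : u t - u s = x t i - x s i - (w t i - w s i) - (t - s) * b (x s) i.
  by rewrite /u; ring.
apply=> s' t' ss' s't' t't hh.
have t'T := le_trans t't tT; have s't := le_trans s't' t't.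
have s'0 := le_trans s0 ss'.
have near_s j : `|x s' j - x s j| <= (C + dl) * H + om.
  have /(_ j) := D s s' _ s0 ss' (le_trans s't tT).
  have sH : s' - s <= H by rewrite (le_trans _ stH)// lerD2r.
  have := wom s s' j s0 ss' (le_trans s't tT) sH.
  have := ler_wpM2r Cd0 sH.
  rewrite !ler_norml => A0 /andP[A1 A2] /andP[A3 A4]; apply/andP; split; lra.
have := b_lip near_s i.
have := X s' t' i s'0 s't' t'T hh.
have d0 : 0 <= t' - s' by rewrite subr_ge0.
move=> A /(ler_wpM2l d0).
rewrite -[X in X * `|_|]ger0_norm// -normrM; move: A.
rewrite /u !ler_norml => /andP[A1 A2] /andP[A3 A4]; apply/andP; split; lra.
Qed.

Fixpoint euler_node w (x0 : 'I_N -> R) (h : R) k : 'I_N -> R :=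
  if k is k'.+1 then
    fun i => euler_node w x0 h k' i + h * b (euler_node w x0 h k') i
             + (w (k%:R * h) i - w (k'%:R * h) i)
  else x0.

(** Between two nodes only the drift is frozen; the noise is followed exactly. *)
Definition euler_path w (x0 : 'I_N -> R) (h : R) t i : R :=
  let k := Num.truncn (t / h) in
  euler_node w x0 h k i + (t - k%:R * h) * b (euler_node w x0 h k) i
  + (w t i - w (k%:R * h) i).

Lemma euler_path_node w (x0 : 'I_N -> R) h k : 0 < h ->
  euler_path w x0 h (k%:R * h) = euler_node w x0 h k.
Proof.
move=> h0; apply/funext => i; rewrite /euler_path mulfK ?gt_eqF// natrK.
by rewrite !subrr mul0r !addr0.
Qed.

Lemma euler_path_cell w (x0 : 'I_N -> R) h k t i : 0 < h -> k%:R * h <= t <= k.+1%:R * h ->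
  euler_path w x0 h t i = euler_node w x0 h k i
    + (t - k%:R * h) * b (euler_node w x0 h k) i + (w t i - w (k%:R * h) i).
Proof.
move=> h0 /andP[kt]; rewrite le_eqVlt => /predU1P[->|tk].
  by rewrite euler_path_node//= -natr1; ring.
rewrite /euler_path (_ : Num.truncn (t / h) = k)//.
by apply: truncn_def; rewrite ler_pdivlMr// ltr_pdivrMr// kt.
Qed.

(** Two times at distance at most [h] lie in the same cell or in adjacent cells,
    and the drift in use was evaluated at nodes within [C h + om] of [x s]. *)
Lemma euler_path_approx w (x0 : 'I_N -> R) T h om : 0 < h -> path_modulus w T h om ->
  approx_solution w T h (L * (C * h + om)) (euler_path w x0 h).
Proof.
move=> h0 wom s t i s0 st tT sth.
set k := Num.truncn (s / h).
have /andP[ks sk] : k%:R * h <= s < k.+1%:R * h.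
  by rewrite -ler_pdivlMr// -ltr_pdivrMr// truncn_itv// divr_ge0// ltW.
have kk : k.+1%:R * h = k%:R * h + h by rewrite -natr1; ring.
have k0 : 0 <= k%:R * h by rewrite mulr_ge0// ltW.
have C0 : 0 <= C by rewrite (le_trans _ (b_bnd x0 i)).
have ksk : k%:R * h <= s <= k.+1%:R * h by rewrite ks ltW.
have sE j := euler_path_cell w x0 j h0 ksk.
have near_s j : `|euler_node w x0 h k j - euler_path w x0 h s j| <= C * h + om.
  rewrite sE.
  have := wom _ _ j k0 ks (le_trans st tT).
  have d0 : 0 <= s - k%:R * h by rewrite subr_ge0.
  have dh : s - k%:R * h <= h by move: sk; rewrite kk; lra.
  move=> /(_ dh).
  have := ler_pM d0 (normr_ge0 _) dh (b_bnd (euler_node w x0 h k) j).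
  rewrite -[X in X * `|_|]ger0_norm// -normrM.
  rewrite !ler_norml => /andP[A1 A2] /andP[A3 A4]; apply/andP; split; lra.
have B1 := b_lip near_s i.
have [tk|kt] := leP t (k.+1%:R * h).
  rewrite (euler_path_cell _ _ _ h0 (_ : k%:R * h <= t <= k.+1%:R * h)); last first.
    by rewrite tk (le_trans ks st).
  rewrite sE.
  set b1 := b (euler_node w x0 h k) i in B1 *.
  set b2 := b (euler_path w x0 h s) i in B1 *.
  set e := (X in `|X|).
  have -> : e = (t - s) * (b1 - b2) by rewrite /e; ring.
  rewrite normrM ger0_norm ?subr_ge0//.
  by apply: ler_wpM2l => //; rewrite subr_ge0.
have tkk : t <= k.+2%:R * h by move: sth kt sk; rewrite -(natr1 k.+1) mulrDl mul1r; lra.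
rewrite (euler_path_cell _ _ _ h0 (_ : k.+1%:R * h <= t <= k.+2%:R * h)); last first.
  by rewrite tkk ltW.
have near_s' j : `|euler_node w x0 h k.+1 j - euler_path w x0 h s j| <= C * h + om.
  rewrite sE /=.
  have := wom _ _ j s0 (ltW sk) (le_trans (ltW kt) tT).
  have d0 : 0 <= k.+1%:R * h - s by rewrite subr_ge0 ltW.
  have dh : k.+1%:R * h - s <= h by rewrite kk; lra.
  move=> /(_ dh).
  have := ler_pM d0 (normr_ge0 _) dh (b_bnd (euler_node w x0 h k) j).
  rewrite -[X in X * `|_|]ger0_norm// -normrM.
  rewrite kk !ler_norml => /andP[A1 A2] /andP[A3 A4]; apply/andP; split; lra.
have B2 := b_lip near_s' i.
rewrite sE.
set b1 := b (euler_node w x0 h k.+1) i in B2 *.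
set b2 := b (euler_path w x0 h s) i in B1 B2 *.
rewrite /=.
set b3 := b (euler_node w x0 h k) i in B1 *.
set e := (X in `|X|).
have -> : e = (k.+1%:R * h - s) * (b3 - b2) + (t - k.+1%:R * h) * (b1 - b2).
  by rewrite /e kk; ring.
have d1 : 0 <= k.+1%:R * h - s by rewrite subr_ge0 ltW.
have d2 : 0 <= t - k.+1%:R * h by rewrite subr_ge0 ltW.
apply: le_trans (ler_normD _ _) _.
rewrite !normrM (ger0_norm d1) (ger0_norm d2).
have := ler_wpM2l d1 B1; have := ler_wpM2l d2 B2.
lra.
Qed.

Lemma approx_solutionW w T h h' dl dl' x : h' <= h -> dl <= dl' ->
  approx_solution w T h dl x -> approx_solution w T h' dl' x.
Proof.
move=> hh dd X s t i s0 st tT th.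
apply: le_trans (X _ _ i s0 st tT (le_trans th hh)) _.
by apply: ler_wpM2l; rewrite ?subr_ge0.
Qed.

Definition uniformly_continuous_path w (T : R) :=
  forall om : R, 0 < om -> exists2 h, 0 < h & path_modulus w T h om.

(** The span [H] is the same for all small steps [h]: this makes the polygons a
    Cauchy family, and lets their limit inherit the estimate. *)
Lemma euler_path_uniform w (x0 : 'I_N -> R) T : 0 <= C ->
  uniformly_continuous_path w T ->
  forall dl, 0 < dl -> exists2 H, 0 < H &
    forall h, 0 < h -> h <= H -> approx_solution w T H dl (euler_path w x0 h).
Proof.
move=> C0 wT dl dl0.
have K0 : 0 < 4 * L + 2 * L ^+ 2 + 1.
  by rewrite ltr_wpDl// addr_ge0// mulr_ge0// exprn_ge0.
(* small enough for the error of [approx_solution_coarsen] to be at most [dl] *)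
pose om := dl / (4 * L + 2 * L ^+ 2 + 1).
have om0 : 0 < om by rewrite divr_gt0.
have [h1 h10 wh1] := wT _ om0.
have C1 : 0 < C + 1 by rewrite ltr_wpDl.
pose H := Num.min (Num.min h1 (om / (C + 1))) 1.
have H0 : 0 < H by rewrite !lt_min h10 ltr01 divr_gt0.
have Hh1 : H <= h1 by rewrite !ge_min lexx.
have H1 : H <= 1 by rewrite !ge_min lexx orbT.
have HC : C * H <= om.
  have : H <= om / (C + 1) by rewrite !ge_min lexx !orbT.
  rewrite ler_pdivlMr//; move: H0; lra.
exists H => // h h0 hH.
have wH : path_modulus w T H om.
  by move=> s t i s0 st tT th; apply: wh1 => //; exact: le_trans th Hh1.
have wh : path_modulus w T h om.
  by move=> s t i s0 st tT th; apply: wH => //; exact: le_trans th hH.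
pose d1 := L * (C * h + om).
have d10 : 0 <= d1.
  by apply: mulr_ge0 => //; apply: addr_ge0; [apply: mulr_ge0 => //|]; apply: ltW.
have Ch : C * h <= om by rewrite (le_trans _ HC)// ler_wpM2l.
have d1om : d1 <= 2 * L * om.
  have := ler_wpM2l L0 Ch; rewrite /d1; lra.
have X := approx_solution_coarsen h0 (addr_ge0 C0 d10)
  (euler_path_approx x0 h0 wh) wH.
apply: approx_solutionW X => //; rewrite -/d1.
have e : (4 * L + 2 * L ^+ 2 + 1) * om = dl by rewrite /om mulrC divfK ?gt_eqF.
have d1H : d1 * H <= 2 * L * om.
  by apply: le_trans d1om; rewrite ler_piMr.
have := ler_wpM2l L0 d1H; have := ler_wpM2l L0 HC.
move: e d1om om0; lra.
Qed.

(** Solution of [dx = b x dt + dw] on [[0, T]].  By [integral_solution_upto] and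
    [solution_upto_integral] this is the integral equation, in a form to which
    [approx_stability] applies. *)
Definition solution_upto w (x0 : 'I_N -> R) (T : R) x :=
  (forall i, x 0 i = x0 i) /\
  forall dl, 0 < dl -> exists2 h, 0 < h & approx_solution w T h dl x.

Lemma euler_path0 w (x0 : 'I_N -> R) h i : 0 < h -> euler_path w x0 h 0 i = x0 i.
Proof. by move=> h0; have := euler_path_node w x0 0 h0; rewrite mul0r => ->. Qed.

Lemma euler_path_cvg w (x0 : 'I_N -> R) T x : 0 <= C -> 0 <= T ->
  uniformly_continuous_path w T -> solution_upto w x0 T x ->
  forall e, 0 < e -> exists2 H, 0 < H & forall h, 0 < h -> h <= H ->
    forall t i, 0 <= t -> t <= T -> `|euler_path w x0 h t i - x t i| <= e.
Proof.
move=> C0 T0 wT [xx0 X] e e0.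
pose K := 2 * T * expR (L * T) + 1.
have K0 : 0 < K by rewrite ltr_wpDl// !mulr_ge0// expR_ge0.
have d0 : 0 < e / K by rewrite divr_gt0.
have [H H0 EH] := euler_path_uniform x0 C0 wT d0.
have [h' h'0 Xh'] := X _ d0.
exists H => // h h0 hH t i t0 tT.
have st : forall i, euler_path w x0 h 0 i = x 0 i.
  by move=> j; rewrite euler_path0.
apply: le_trans (approx_stability H0 h'0 (ltW d0) (ltW d0) (EH _ h0 hH) Xh' st _ t0 tT) _.
have e1 : e / K * K = e by rewrite divfK ?gt_eqF.
move: e1 d0; set d := e / K; move: d => d e1 d0.
by rewrite -[leRHS]e1 /K; move: d0; lra.
Qed.

Lemma solution_upto_unique w (x0 : 'I_N -> R) T x x' : 0 <= T ->
  solution_upto w x0 T x -> solution_upto w x0 T x' ->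
  forall t i, 0 <= t -> t <= T -> x t i = x' t i.
Proof.
move=> T0 [xx0 X] [xx0' X'] t i t0 tT.
apply/eqP; rewrite -subr_eq0 -normr_le0; apply/ler_addgt0Pr => e e0; rewrite add0r.
pose K := 2 * T * expR (L * T) + 1.
have K0 : 0 < K by rewrite ltr_wpDl// !mulr_ge0// expR_ge0.
have d0 : 0 < e / K by rewrite divr_gt0.
have [h h0 Xh] := X _ d0.
have [h' h'0 Xh'] := X' _ d0.
have st : forall i, x 0 i = x' 0 i by move=> j; rewrite xx0 xx0'.
apply: le_trans (approx_stability h0 h'0 (ltW d0) (ltW d0) Xh Xh' st _ t0 tT) _.
have e1 : e / K * K = e by rewrite divfK ?gt_eqF.
move: e1 d0; set d := e / K; move: d => d e1 d0.
by rewrite -[leRHS]e1 /K; move: d0; lra.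
Qed.

(** The square root of the step, which is the size of a noise increment, is the
    rational number [n.+1%:R^-1]. *)
Definition euler_step (n : nat) : R := n.+1%:R ^- 2.

Lemma euler_step_gt0 n : 0 < euler_step n.
Proof. by rewrite invr_gt0 exprn_gt0. Qed.

Lemma euler_step_small (H : R) : 0 < H -> \forall n \near \oo, euler_step n <= H.
Proof.
move=> H0; exists (Num.truncn H^-1) => // n /= nH.
rewrite /euler_step -[leRHS]invrK lef_pV2 ?posrE ?invr_gt0 ?exprn_gt0//.
apply: (@le_trans _ _ n.+1%:R); last by rewrite expr2 ler_peMr// ler1n.
by rewrite (le_trans (ltW (truncnS_gt _)))// ler_nat.
Qed.

Definition euler_limit w (x0 : 'I_N -> R) (t : R) (i : 'I_N) : R :=
  limn (fun n => euler_path w x0 (euler_step n) t i).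

Lemma euler_limit_cvg w (x0 : 'I_N -> R) T : 0 <= C -> 0 <= T ->
  uniformly_continuous_path w T -> forall t i, 0 <= t -> t <= T ->
  euler_path w x0 (euler_step n) t i @[n --> \oo] --> euler_limit w x0 t i.
Proof.
move=> C0 T0 wT t i t0 tT; apply/cauchy_cvgP/cauchy_exP => e e0.
pose K := 2 * T * expR (L * T) + 1.
have K0 : 0 < K by rewrite ltr_wpDl// !mulr_ge0// expR_ge0.
have d0 : 0 < e / (2 * K) by rewrite divr_gt0// mulr_gt0.
have [H H0 EH] := euler_path_uniform x0 C0 wT d0.
have [n0 _ Hn0] := euler_step_small H0.
exists (euler_path w x0 (euler_step n0) t i).
exists n0 => // n /= n0n; rewrite /ball/=.
have st : forall i, euler_path w x0 (euler_step n0) 0 i = euler_path w x0 (euler_step n) 0 i.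
  by move=> j; rewrite !euler_path0// euler_step_gt0.
have X := EH _ (euler_step_gt0 n0) (Hn0 n0 (leqnn _)).
have X' := EH _ (euler_step_gt0 n) (Hn0 n n0n).
apply: le_lt_trans (approx_stability H0 H0 (ltW d0) (ltW d0) X X' st _ t0 tT) _.
have e1 : e / (2 * K) * K = e / 2 by rewrite invfM mulrA divfK ?gt_eqF.
have : e / 2 < e by lra.
rewrite -e1; apply: le_lt_trans.
move: e1 d0; set d := e / (2 * K); move: d => d e1 d0.
rewrite /K; move: d0; lra.
Qed.

Lemma euler_limit_solution w (x0 : 'I_N -> R) T : 0 <= C -> 0 <= T ->
  uniformly_continuous_path w T -> solution_upto w x0 T (euler_limit w x0).
Proof.
move=> C0 T0 wT; split=> [i|dl dl0].
  rewrite /euler_limit; under eq_fun do rewrite euler_path0 ?euler_step_gt0//.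
  exact: lim_cst.
have d0 : 0 < dl / 2 by rewrite divr_gt0.
have [H H0 EH] := euler_path_uniform x0 C0 wT d0.
exists H => // s t i s0 st tT th.
have cv r j : 0 <= r -> r <= T -> forall e : R, 0 < e -> \forall n \near \oo,
    `|euler_limit w x0 r j - euler_path w x0 (euler_step n) r j| <= e.
  move=> r0 rT e e0.
  have /cvgrPdist_le := @euler_limit_cvg w x0 T C0 T0 wT r j r0 rT.
  exact.
apply/ler_addgt0Pr => e e0.
have sT := le_trans st tT; have t0 := le_trans s0 st.
have L1 : 0 < 1 + (t - s) * L + 1.
  by rewrite ltr_wpDl// addr_ge0// mulr_ge0// subr_ge0.
have e'0 : 0 < e / (1 + (t - s) * L + 1) by rewrite divr_gt0.
have : \forall n \near \oo, forall j : 'I_N,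
    `|euler_limit w x0 s j - euler_path w x0 (euler_step n) s j|
       <= e / (1 + (t - s) * L + 1).
  by apply: filter_forall => j; exact: cv.
move=> cvs.
have [n [H1 [H2 H3]]] : exists n, [/\ euler_step n <= H,
    `|euler_limit w x0 t i - euler_path w x0 (euler_step n) t i|
       <= e / (1 + (t - s) * L + 1) &
    forall j : 'I_N,
    `|euler_limit w x0 s j - euler_path w x0 (euler_step n) s j|
       <= e / (1 + (t - s) * L + 1)].
  near \oo => n; exists n; split; near: n => //.
  - exact: euler_step_small.
  - exact: cv.
have H4 := b_lip H3 i.
have H5 := H3 i.
have H6 := EH _ (euler_step_gt0 n) H1 _ _ i s0 st tT th.
have ts0 : 0 <= t - s by rewrite subr_ge0.
have e1 : e / (1 + (t - s) * L + 1) * (1 + (t - s) * L + 1) = e.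
  by rewrite divfK ?gt_eqF.
rewrite -[X in _ <= _ + X]e1.
move: H2 H4 H5 H6 => {cv cvs H3 e1}.
set e' := _ / _ in e'0 *.
have : 0 <= (t - s) * dl by rewrite mulr_ge0// ltW.
rewrite !ler_norml => d0' /andP[A1 A2] /andP[A3 A4] /andP[A5 A6] /andP[A7 A8].
have := ler_wpM2l ts0 A3; have := ler_wpM2l ts0 A4.
lra.
Unshelve. all: by end_near.
Qed.

End ApproximateSolutions.

(** * Uniform continuity and the integral equation *)

Section Continuity.
Context {R : realType}.
Implicit Types (f : R -> R) (A : set R).

Lemma within_continuousP f A : {within A, continuous f} <->
  forall x, A x -> forall e : R, 0 < e -> exists2 dl : R, 0 < dl &
    forall y, A y -> `|y - x| < dl -> `|f y - f x| <= e.
Proof.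
split=> [/subspace_continuousP cf x Ax e e0|H].
  have /cvgrPdist_le/(_ _ e0) := cf x Ax.
  rewrite /within => /nbhs_ballP[dl /= dl0 H].
  exists dl => // y Ay xy; rewrite distrC; apply: (H y) => //.
  by rewrite /ball/= distrC.
apply/subspace_continuousP => x Ax; apply/cvgrPdist_le => e e0.
have [dl dl0 {}H] := H x Ax e e0.
apply/nbhs_ballP; exists dl => //= y; rewrite /ball/= => xy Ay.
by rewrite distrC; apply: H => //; rewrite distrC.
Qed.

Lemma segment_uniformly_continuous f (T : R) : {within `[0, T], continuous f} ->
  forall e : R, 0 < e -> exists2 h : R, 0 < h &
    forall s t, 0 <= s -> s <= t -> t <= T -> t - s <= h -> `|f t - f s| <= e.
Proof.
move=> /within_continuousP cf e e0.
have /compact_near_coveringP/near_covering_withinP cpt := @segment_compact R 0 T.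
have := @cpt R 0^'+ (fun h s => forall t, s <= t -> t <= T -> t - s <= h ->
  `|f t - f s| <= e) _ _.
case.
  move=> x xT.
  have e20 : 0 < e / 2 by rewrite divr_gt0.
  have [dl dl0 H] := cf x xT _ e20.
  have dl20 : 0 < dl / 2 by rewrite divr_gt0.
  exists ([set s | `|s - x| < dl / 2], [set h | h < dl / 2]) => /=.
    split.
      apply/nbhs_ballP; exists (dl / 2) => //= y.
      by rewrite /ball/= distrC.
    exact: nbhs_right_lt.
  move=> [s h] /= [sx hdl] sT t st tT th.
  have A1 : `|f s - f x| <= e / 2 by apply: H => //; apply: lt_trans sx _; lra.
  have A2 : `|f t - f x| <= e / 2.
    apply: H; first by move: sT; rewrite /= !in_itv/= => /andP[s0 _]; rewrite tT (le_trans s0 st).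
    by move: sx th hdl st; rewrite !ltr_norml => /andP[? ?] ? ? ?; apply/andP; split; lra.
  move: A1 A2; rewrite !ler_norml => /andP[? ?] /andP[? ?]; apply/andP; split; lra.
move=> dl /= dl0 H.
exists (dl / 2); first by rewrite divr_gt0.
move=> s t s0 st tT th.
have dl20 : 0 < dl / 2 by rewrite divr_gt0.
apply: (H (dl / 2)) => //=.
  by rewrite /ball/= sub0r normrN gtr0_norm//; lra.
by rewrite in_itv/= s0 (le_trans st tT).
Qed.

Lemma Rintegral_increment (g : R -> R) (s t c dl : R) : 0 <= s -> s <= t ->
  (@lebesgue_measure R).-integrable `[0, t] (EFin \o g) ->
  (forall u, s <= u -> u <= t -> `|g u - c| <= dl) ->
  `|(\int[@lebesgue_measure R]_(u in `[0, t]) g u)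
    - (\int[@lebesgue_measure R]_(u in `[0, s]) g u) - (t - s) * c|
  <= (t - s) * dl.
Proof.
move=> s0 st gi gc.
rewrite Rintegral_itvB//.
have gis : (@lebesgue_measure R).-integrable `]s, t] (EFin \o g).
  by apply: integrableS gi => //; apply: subset_itvr; rewrite bnd_simp.
have fin : (@lebesgue_measure R `]s, t] < +oo)%E.
  by rewrite /= lebesgue_measure_itv/=; case: ifP => // _; rewrite -EFinB ltry.
have ic r : (@lebesgue_measure R).-integrable `]s, t] (EFin \o cst r).
  apply: measurable_bounded_integrable => //.
  by exists `|r|; split; rewrite ?num_real // => M rM u _ /=; exact: ltW.
have fE : fine (@lebesgue_measure R `]s, t]) = t - s.
  rewrite /= lebesgue_measure_itv/=; case: ifPn => //; rewrite lte_fin -leNgt => ts.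
  by rewrite /=; apply/esym/eqP; rewrite subr_eq0 eq_le ts.
rewrite (_ : (t - s) * c = \int[@lebesgue_measure R]_(u in `]s, t]) cst c u); last first.
  by rewrite Rintegral_cst// fE mulrC.
rewrite -RintegralB//.
apply: le_trans (le_normr_Rintegral _ _) _ => //.
  exact: (integrableB _ gis (ic c)).
rewrite (_ : (t - s) * dl = \int[@lebesgue_measure R]_(u in `]s, t]) cst dl u); last first.
  by rewrite Rintegral_cst// fE mulrC.
apply: le_Rintegral => //.
- exact: (integrable_abse (integrableB _ gis (ic c))).
- by move=> u /=; rewrite in_itv/= => /andP[su ut]; apply: gc => //; exact: ltW.
Qed.

End Continuity.

Section Solutions.
Context {R : realType} {N : nat}.
Variables (b : ('I_N -> R) -> 'I_N -> R) (C L : R).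
Hypothesis L0 : 0 <= L.
Hypothesis C0 : 0 <= C.
Hypothesis b_lip : forall (x y : 'I_N -> R) (e : R),
  (forall i, `|x i - y i| <= e) -> forall i, `|b x i - b y i| <= L * e.
Hypothesis b_bnd : forall (x : 'I_N -> R) i, `|b x i| <= C.
Implicit Types (w x : R -> 'I_N -> R).

Lemma continuous_path_uniform w (T : R) :
  (forall i, {within `[0, T], continuous (fun t => w t i)}) ->
  uniformly_continuous_path w T.
Proof.
move=> cw om om0.
have /choice[h hP] : forall i, exists h : R, 0 < h /\
    forall s t, 0 <= s -> s <= t -> t <= T -> t - s <= h -> `|w t i - w s i| <= om.
  move=> i; have [h h0 H] := segment_uniformly_continuous (cw i) om0.
  by exists h; split.
exists (\big[Num.min/1]_(i < N) h i).
  by apply: lt_bigmin => // i _; case: (hP i).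
move=> s t i s0 st tT th; case: (hP i) => _; apply => //.
by apply: le_trans th _; exact: bigmin_le_cond.
Qed.

Lemma uniform_path_continuous w (T : R) :
  uniformly_continuous_path w T ->
  forall i, {within `[0, T], continuous (fun t => w t i)}.
Proof.
move=> wT i; apply/within_continuousP => x xT e e0.
have [h h0 H] := wT e e0.
exists h => // y; move: xT; rewrite /= !in_itv/= => /andP[x0 xT] /andP[y0 yT].
have [xy|/ltW yx] := leP x y.
  by rewrite ger0_norm ?subr_ge0// => /ltW; exact: H.
by rewrite distrC ger0_norm ?subr_ge0// distrC => /ltW; exact: H.
Qed.

Lemma solution_upto_uniform w (x0 : 'I_N -> R) (T : R) x :
  solution_upto b w x0 T x -> uniformly_continuous_path w T ->
  uniformly_continuous_path x T.
Proof.
move=> [_ X] wT e e0.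
have [h h0 Xh] := X 1 ltr01.
have e20 : 0 < e / 2 by rewrite divr_gt0.
have [h' h'0 H] := wT _ e20.
have C10 : 0 < C + 1 by rewrite ltr_wpDl.
have e3 : 0 < e / 2 / (C + 1) by rewrite divr_gt0.
exists (Num.min h' (e / 2 / (C + 1))); first by rewrite lt_min h'0 e3.
move=> s t i s0 st tT; rewrite le_min => /andP[th th'].
have := approx_solution_dist b_bnd h0 Xh i s0 st tT.
have := H s t i s0 st tT th.
have e1 : e / 2 / (C + 1) * (C + 1) = e / 2 by rewrite divfK ?gt_eqF.
have := ler_wpM2r (ltW C10) th'; rewrite e1.
rewrite !ler_norml => A0 /andP[A1 A2] /andP[A3 A4]; apply/andP; split; lra.
Qed.

Lemma drift_uniform x (T : R) : uniformly_continuous_path x T ->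
  uniformly_continuous_path (fun t => b (x t)) T.
Proof.
move=> xT e e0.
have L10 : 0 < L + 1 by rewrite ltr_wpDl.
have e1 : 0 < e / (L + 1) by rewrite divr_gt0.
have [h h0 H] := xT _ e1.
exists h => // s t i s0 st tT th.
apply: le_trans (b_lip (fun j => H s t j s0 st tT th) i) _.
have e2 : e / (L + 1) * (L + 1) = e by rewrite divfK ?gt_eqF.
by rewrite -[leRHS]e2 mulrDr mulr1 mulrC lerDl ltW.
Qed.

Lemma integral_solution_upto w (x0 : 'I_N -> R) (T : R) x (g : R -> 'I_N -> R) :
  (forall i, x 0 i = x0 i) ->
  (forall i, {within `[0, T], continuous (fun t => x t i)}) ->
  (forall s, 0 <= s -> s <= T -> g s = b (x s)) ->
  (forall t i, 0 <= t -> t <= T -> 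
    (@lebesgue_measure R).-integrable `[0, t] (fun s => (g s i)%:E)) ->
  (forall t i, 0 <= t -> t <= T ->
    x t i = x0 i + (\int[@lebesgue_measure R]_(s in `[0, t]) g s i) + w t i) ->
  solution_upto b w x0 T x.
Proof.
move=> xx0 cx gE gi xE; split=> // dl dl0.
have /drift_uniform/(_ _ dl0)[h h0 H] := continuous_path_uniform cx.
exists h => // s t i s0 st tT th.
rewrite !xE// ?(le_trans s0 st)// ?(le_trans st tT)//.
have := @Rintegral_increment _ (fun s => g s i) s t (b (x s) i) dl s0 st
  (gi t i (le_trans s0 st) tT).
have E u : s <= u -> u <= t -> `|g u i - b (x s) i| <= dl.
  move=> su ut; rewrite gE ?(le_trans s0 su) ?(le_trans ut tT)//.
  apply: H => //; first exact: le_trans ut tT.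
  by apply: le_trans th; rewrite lerD2r.
move=> /(_ E); congr (`|_| <= _); ring.
Qed.

(** On a short interval [[r, s]] the noiseless path and the integral of the drift
    both grow by [(s - r) b (x r)], up to [o (s - r)] uniformly in [r]; their
    difference is constant by [chain_bound]. *)
Lemma solution_upto_integral w (x0 : 'I_N -> R) (T : R) x :
  (forall i, w 0 i = 0) ->
  uniformly_continuous_path w T -> solution_upto b w x0 T x ->
  forall t i, 0 <= t -> t <= T ->
  (@lebesgue_measure R).-integrable `[0, t] (fun s => (b (x s) i)%:E) /\
  x t i = x0 i + (\int[@lebesgue_measure R]_(s in `[0, t]) b (x s) i) + w t i.
Proof.
move=> w0 wT X t i t0 tT.
have bT := drift_uniform (solution_upto_uniform X wT).
have gi r : r <= T ->
    (@lebesgue_measure R).-integrable `[0, r] (fun s => (b (x s) i)%:E).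
  move=> rT; apply: (@continuous_compact_integrable _ (fun s => b (x s) i)).
    exact: segment_compact.
  apply: (@continuous_subspaceW _ _ `[0, r] `[0, T]).
    by apply: subset_itvl; rewrite bnd_simp.
  exact: uniform_path_continuous bT i.
split; first exact: gi.
pose u r := x r i - w r i - \int[@lebesgue_measure R]_(s in `[0, r]) b (x s) i.
suff : u t = u 0.
  rewrite /u set_itv1 Rintegral_set1 w0 (proj1 X) => e.
  have : x t i - w t i - \int[@lebesgue_measure R]_(s in `[0, t]) b (x s) i = x0 i - 0 - 0 by [].
  lra.
apply/eqP; rewrite -subr_eq0 -normr_le0; apply/ler_addgt0Pr => e e0; rewrite add0r.
have K0 : 0 < t + 1 by rewrite ltr_wpDl.
have dl0 : 0 < e / (t + 1) / 2 by rewrite !divr_gt0.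
have [h h0 H] := bT _ dl0.
have [h' h'0 Xh] := (proj2 X) _ dl0.
have hh0 : 0 < Num.min h h' by rewrite lt_min h0 h'0.
suff chain : `|u t - u 0| <= (t - 0) * (e / (t + 1)).
  apply: le_trans chain _.
  have e2 : e / (t + 1) * (t + 1) = e by rewrite divfK ?gt_eqF.
  by rewrite -[leRHS]e2 subr0 mulrC ler_wpM2l ?lerDl// ltW// divr_gt0.
apply: (chain_bound hh0 t0) => r s r0 rs st.
rewrite le_min => /andP[rsh rsh'].
have sT := le_trans st tT.
have := @Rintegral_increment _ (fun s => b (x s) i) r s (b (x r) i) _ r0 rs
  (gi s sT).
move=> /(_ (e / (t + 1) / 2)).
have E v : r <= v -> v <= s -> `|b (x v) i - b (x r) i| <= e / (t + 1) / 2.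
  move=> rv vs; apply: H => //; first exact: le_trans vs sT.
  by apply: le_trans rsh; rewrite lerD2r.
move=> /(_ E); have := Xh r s i r0 rs sT rsh'; rewrite /u.
set d := e / (t + 1) / 2; have -> : e / (t + 1) = d + d by rewrite /d; lra.
rewrite !ler_norml => /andP[? ?] /andP[? ?]; apply/andP; split; lra.
Qed.

End Solutions.

(** * The truncated drift *)

Section TruncatedInverse.
Context {R : realType}.
Implicit Types (eps g : R).

(** A Lipschitz function on the whole line that coincides with the inverse outside
    [(- eps, eps)]. *)
Definition trinv eps g : R := g / Num.max (g ^+ 2) (eps ^+ 2).

Lemma trinv_den_gt0 eps g : 0 < eps -> 0 < Num.max (g ^+ 2) (eps ^+ 2).
Proof. by move=> e0; rewrite lt_max [X in _ || X]exprn_gt0 ?orbT. Qed.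

Lemma trinvE eps g : 0 < eps -> eps <= `|g| -> trinv eps g = g^-1.
Proof.
move=> e0 eg; rewrite /trinv max_l; last first.
  by rewrite -[leRHS]real_normK ?num_real// lerXn2r ?nnegrE// ltW.
have g0 : g != 0 by rewrite -normr_gt0 (lt_le_trans e0).
by rewrite expr2 invfM mulrA divff// mul1r.
Qed.

Lemma trinv_bound eps g : 0 < eps -> `|trinv eps g| <= eps^-1.
Proof.
move=> e0; have M0 := trinv_den_gt0 g e0.
rewrite /trinv normrM [X in _ * X]gtr0_norm ?invr_gt0// ler_pdivrMr//.
rewrite ler_pdivlMl//.
have [ge|eg] := leP `|g| eps.
  apply: (@le_trans _ _ (eps ^+ 2)); last by rewrite le_max lexx orbT.
  by rewrite expr2 ler_wpM2l// ltW.
apply: (@le_trans _ _ (g ^+ 2)); last by rewrite le_max lexx.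
by rewrite -[leRHS]real_normK ?num_real// expr2 ler_wpM2r// ltW.
Qed.

Lemma trinv_lipschitz eps g g' : 0 < eps ->
  `|trinv eps g - trinv eps g'| <= 3 * eps ^- 2 * `|g - g'|.
Proof.
move=> e0.
wlog gg : g g' / `|g'| <= `|g|.
  move=> W; have [|/ltW] := leP `|g'| `|g|; first exact: W.
  by move=> /W; rewrite distrC [in X in _ <= X]distrC.
have M0 := trinv_den_gt0 g e0; have M'0 := trinv_den_gt0 g' e0.
rewrite /trinv.
set M := Num.max (g ^+ 2) _ in M0 *; set M' := Num.max (g' ^+ 2) _ in M'0 *.
have eM' : eps ^+ 2 <= M' by rewrite le_max lexx orbT.
have gM : `|g| ^+ 2 <= M by rewrite real_normK ?num_real// le_max lexx.
have MM : 0 <= M - M' /\ M - M' <= `|g| ^+ 2 - `|g'| ^+ 2.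
  rewrite !real_normK ?num_real//.
  have : g' ^+ 2 <= g ^+ 2.
    by rewrite -[leLHS]real_normK ?num_real// -[leRHS]real_normK ?num_real// lerXn2r ?nnegrE.
  rewrite /M /M' => le; split.
    by rewrite subr_ge0 ge_max le_max le/= le_max lexx orbT.
  rewrite lerBlDr ge_max; apply/andP; split.
    have : g' ^+ 2 <= Num.max (g' ^+ 2) (eps ^+ 2) by rewrite le_max lexx.
    lra.
  have : eps ^+ 2 <= Num.max (g' ^+ 2) (eps ^+ 2) by rewrite le_max lexx orbT.
  lra.
have -> : g / M - g' / M' = ((g - g') * M - g * (M - M')) / (M * M').
  by field; rewrite !gt_eqF.
have MM'0 : 0 < M * M' by rewrite mulr_gt0.
rewrite normrM [X in _ * X]gtr0_norm ?invr_gt0// ler_pdivrMr//.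
have d0 : 0 <= `|g - g'| by [].
have dd : `|g| - `|g'| <= `|g - g'| by exact: lerB_dist.
have g0 : 0 <= `|g| by []. have g'0 : 0 <= `|g'| by [].
have B1 : `|(g - g') * M - g * (M - M')| <= 3 * `|g - g'| * M.
  apply: le_trans (ler_normB _ _) _.
  rewrite !normrM (gtr0_norm M0) (ger0_norm (proj1 MM)).
  have := ler_wpM2l g0 (proj2 MM).
  have -> : `|g| ^+ 2 - `|g'| ^+ 2 = (`|g| - `|g'|) * (`|g| + `|g'|) by ring.
  have s0 : 0 <= `|g| + `|g'| by rewrite addr_ge0.
  have := ler_wpM2l g0 (ler_wpM2r s0 dd).
  have s2 : `|g| * (`|g| + `|g'|) <= 2 * M.
    apply: le_trans (_ : `|g| * (`|g| + `|g|) <= _).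
      by rewrite ler_wpM2l// lerD2l.
    by move: gM; lra.
  have := ler_wpM2l d0 s2; lra.
apply: le_trans B1 _.
have -> : 3 * eps ^- 2 * `|g - g'| * (M * M') = (3 * `|g - g'| * M) * (eps ^- 2 * M') by ring.
rewrite ler_peMr ?mulr_ge0 ?(ltW M0)//.
by rewrite mulrC ler_pdivlMr ?exprn_gt0// mul1r.
Qed.

Lemma measurable_trinv eps : 0 < eps -> measurable_fun setT (trinv eps).
Proof.
move=> e0; apply: continuous_measurable_fun => x.
apply/cvgrPdist_le => e ee0.
have K0 : 0 < 3 * eps ^- 2 by rewrite mulr_gt0// invr_gt0 exprn_gt0.
apply/nbhs_ballP; exists (e / (3 * eps ^- 2)) => /=; first by rewrite divr_gt0.
move=> y; rewrite /ball/= => xy.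
apply: le_trans (trinv_lipschitz _ _ e0) _.
by rewrite mulrC -ler_pdivlMr// ltW.
Qed.

End TruncatedInverse.

Lemma ler_sum_cst (R : realType) (N : nat) (Q : pred 'I_N) (F : 'I_N -> R) c :
  0 <= c -> (forall j, Q j -> F j <= c) -> \sum_(j < N | Q j) F j <= N%:R * c.
Proof.
move=> c0 Fc; rewrite big_mkcond /=.
apply: (@le_trans _ _ (\sum_(j < N) c)); last by rewrite sumr_const card_ord mulr_natl.
by apply: ler_sum => j _; case: ifP => // /Fc.
Qed.

Section TruncatedDrift.
Context {R : realType} {N : nat}.
Implicit Types (a eps : R) (x y : 'I_N -> R).

Definition trdrift a eps x i : R := a * \sum_(j < N | j != i) trinv eps (x i - x j).

Lemma trdrift_bound a eps x i : 0 <= a -> 0 < eps ->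
  `|trdrift a eps x i| <= a * (N%:R * eps^-1).
Proof.
move=> a0 e0; rewrite normrM (ger0_norm a0) ler_wpM2l//.
apply: le_trans (ler_norm_sum _ _ _) _; apply: ler_sum_cst.
  by rewrite invr_ge0 ltW.
by move=> j _; exact: trinv_bound.
Qed.

Lemma trdrift_lipschitz a eps x y (e : R) : 0 <= a -> 0 < eps ->
  (forall i, `|x i - y i| <= e) ->
  forall i, `|trdrift a eps x i - trdrift a eps y i|
    <= a * (N%:R * (6 * eps ^- 2)) * e.
Proof.
move=> a0 e0 xy i; rewrite /trdrift -mulrBr normrM (ger0_norm a0) -mulrA.
rewrite ler_wpM2l// -sumrB.
apply: le_trans (ler_norm_sum _ _ _) _; rewrite -mulrA.
have ee0 : 0 <= e by exact: le_trans (xy i).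
apply: ler_sum_cst => [|j _].
  by rewrite !mulr_ge0// invr_ge0 exprn_ge0// ltW.
apply: le_trans (trinv_lipschitz _ _ e0) _.
have -> : 6 * eps ^- 2 * e = 3 * eps ^- 2 * (2 * e) by ring.
apply: ler_wpM2l; first by rewrite mulr_ge0// invr_ge0 exprn_ge0// ltW.
move: (xy i) (xy j); rewrite !ler_norml => /andP[? ?] /andP[? ?].
apply/andP; split; lra.
Qed.

(** The region, exhausting [domainD] as [eps] tends to [0], where truncation at
    [eps] does not modify the drift. *)
Definition safe eps x : bool :=
  [forall i, `|x i| <= eps^-1] && [forall i, forall j, (j != i) ==> (eps <= `|x i - x j|)].

Lemma safe_gap eps x i j : safe eps x -> j != i -> eps <= `|x i - x j|.
Proof. by move=> /andP[_ /forallP/(_ i)/forallP/(_ j)/implyP]; apply. Qed.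

Lemma safe_bound eps x i : safe eps x -> `|x i| <= eps^-1.
Proof. by move=> /andP[/forallP]. Qed.

Lemma safe_domainD eps x : 0 < eps -> safe eps x -> domainD x.
Proof.
move=> e0 sx i j ij; rewrite -subr_eq0 -normr_gt0 (lt_le_trans e0)//.
by apply: (safe_gap sx); rewrite eq_sym.
Qed.

Lemma safeW eps eps' x : 0 < eps' -> eps' <= eps -> safe eps x -> safe eps' x.
Proof.
move=> e0 ee sx; apply/andP; split.
  apply/forallP => i; apply: le_trans (safe_bound i sx) _.
  by rewrite lef_pV2// posrE// (lt_le_trans e0).
apply/forallP => i; apply/forallP => j; apply/implyP => ij.
by apply: le_trans ee (safe_gap sx ij).
Qed.

Lemma trdriftE a eps x i : 0 < eps -> safe eps x ->
  trdrift a eps x i = a * \sum_(j < N | j != i) (x i - x j)^-1.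
Proof.
move=> e0 sx; congr (a * _); apply: eq_bigr => j ij.
by rewrite trinvE//; apply: safe_gap.
Qed.

Lemma trdrift_drift alpha eps x : 0 < eps -> safe eps x ->
  trdrift (alpha / N%:R ^+ 2) eps x = drift alpha x.
Proof. by move=> e0 sx; apply/funext => i; rewrite trdriftE. Qed.

Lemma domainD_safe x : domainD x -> exists2 eps, 0 < eps & safe eps x.
Proof.
move=> Dx.
pose m1 := \big[Num.min/1]_(p : 'I_N * 'I_N | p.2 != p.1) `|x p.1 - x p.2|.
have m10 : 0 < m1.
  apply: lt_bigmin => // -[i j] /= ij; rewrite normr_gt0 subr_eq0.
  by apply: Dx; rewrite eq_sym.
pose m2 := \big[Num.max/1]_(i < N) `|x i|.
have m20 : 0 < m2 by apply: lt_le_trans ltr01 _; exact: bigmax_ge_id.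
exists (Num.min m1 m2^-1); first by rewrite lt_min m10 invr_gt0.
apply/andP; split.
  apply/forallP => i; apply: (@le_trans _ _ m2).
    by rewrite /m2; exact: le_bigmax.
  rewrite -[leLHS]invrK lef_pV2 ?posrE ?lt_min ?invr_gt0 ?m10 ?m20//.
  by rewrite ge_min lexx orbT.
apply/forallP => i; apply/forallP => j; apply/implyP => ij.
rewrite ge_min; apply/orP; left.
by rewrite /m1; apply: (@bigmin_le_cond _ _ _ _ (i, j) (fun p => p.2 != p.1)).
Qed.

End TruncatedDrift.

(** * Identities and inequalities behind the Lyapunov function *)

Section RepulsionIdentities.
Context {R : realType} {N : nat}.
Implicit Types x : 'I_N -> R.

Lemma sum3_rotate (G : 'I_N -> 'I_N -> 'I_N -> R) :
  \sum_i \sum_j \sum_k G i j k = \sum_i \sum_j \sum_k G j k i.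
Proof.
rewrite [RHS]exchange_big/=; apply: eq_bigr => i _.
by rewrite [RHS]exchange_big.
Qed.

(** For [u = x_i - x_j], [v = x_j - x_k], [w = x_k - x_i], the three rotations of
    a triple contribute [- (1/(u w) + 1/(v u) + 1/(w v)) = - (u + v + w)/(u v w)],
    and [u + v + w = 0]. *)
Lemma sum_cross_terms0 x : domainD x ->
  \sum_i \sum_(j | j != i) \sum_(k | (k != i) && (k != j))
    (x i - x j)^-1 * (x i - x k)^-1 = 0.
Proof.
move=> Dx.
pose G i j k : R := if [&& j != i, k != i & k != j]
  then (x i - x j)^-1 * (x i - x k)^-1 else 0.
transitivity (\sum_i \sum_j \sum_k G i j k).
  apply: eq_bigr => i _; rewrite big_mkcond; apply: eq_bigr => j _.
  have [ji|ji] := ifP; last by rewrite big1// => k _; rewrite /G ji.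
  by rewrite big_mkcond; apply: eq_bigr => k _; rewrite /G ji.
apply/eqP; rewrite -(@mulrI_eq0 _ 3); last by apply/lregP; rewrite pnatr_eq0.
apply/eqP.
have -> : 3 * (\sum_i \sum_j \sum_k G i j k) =
    \sum_i \sum_j \sum_k G i j k + \sum_i \sum_j \sum_k G j k i
    + \sum_i \sum_j \sum_k G k i j.
  have E1 := sum3_rotate G.
  have E2 : _ = \sum_i \sum_j \sum_k G i j k := sum3_rotate (fun i j k => G k i j).
  rewrite E2 -E1; ring.
rewrite -!big_split big1//= => i _; rewrite -!big_split big1//= => j _.
rewrite -!big_split big1//= => k _; rewrite /G.
rewrite (eq_sym i j) (eq_sym i k) (eq_sym j k).
have [->|ji] := eqVneq j i; first by rewrite /= !andbF !addr0.
have [->|ki] := eqVneq k i; first by rewrite /= !andbF !addr0.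
have [->|kj] := eqVneq k j; first by rewrite /= !addr0.
rewrite /=.
have d1 : x i - x j != 0 by rewrite subr_eq0; apply: Dx; rewrite eq_sym.
have d2 : x i - x k != 0 by rewrite subr_eq0; apply: Dx; rewrite eq_sym.
have d3 : x j - x k != 0 by rewrite subr_eq0; apply: Dx; rewrite eq_sym.
rewrite -(opprB (x j) (x k)) -(opprB (x i) (x j)) -(opprB (x i) (x k)).
have e : x i - x k = (x i - x j) + (x j - x k) by ring.
rewrite e in d2 *.
move: (x i - x j) (x j - x k) d1 d2 d3 => u v u0 uv0 v0.
by field; rewrite u0 v0 uv0.
Qed.

(** The left side is what the drift takes away from the logarithmic energy, and the
    right side what the noise brings: they only differ by their coefficients. *)
Lemma sum_sq_repulsion x : domainD x ->
  \sum_i (\sum_(j | j != i) (x i - x j)^-1) ^+ 2 =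
  \sum_i \sum_(j | j != i) (x i - x j)^-1 ^+ 2.
Proof.
move=> Dx; apply/eqP; rewrite -subr_eq0 -sumrB; apply/eqP.
rewrite -[RHS](sum_cross_terms0 Dx); apply: eq_bigr => i _.
rewrite expr2 mulr_suml -sumrB; apply: eq_bigr => j ji.
rewrite mulr_sumr (bigD1 j)//= expr2 addrC addrK.
by apply: eq_bigl => k.
Qed.

Lemma sum_antisym (F : 'I_N -> 'I_N -> R) (h : 'I_N -> R) :
  (forall i j, F j i = - F i j) ->
  \sum_i \sum_(j | j != i) (h i - h j) * F i j
  = 2 * \sum_i h i * \sum_(j | j != i) F i j.
Proof.
move=> FN.
have -> : \sum_i \sum_(j | j != i) (h i - h j) * F i j =
    \sum_i h i * (\sum_(j | j != i) F i j) -
    \sum_i \sum_(j | j != i) h j * F i j.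
  rewrite -sumrB; apply: eq_bigr => i _; rewrite mulr_sumr -sumrB.
  by apply: eq_bigr => j _; rewrite mulrBl.
have -> : \sum_i \sum_(j | j != i) h j * F i j =
    - \sum_i h i * (\sum_(j | j != i) F i j); last by ring.
rewrite (exchange_big_dep xpredT)//= -sumrN; apply: eq_bigr => j _.
rewrite mulr_sumr -sumrN (eq_bigl (fun i => i != j)); last by move=> i; rewrite eq_sym.
by apply: eq_bigr => i _; rewrite FN mulrN.
Qed.

(** Every pair contributes exactly [1], so the repulsion pushes the particles to
    infinity at a bounded rate. *)
Lemma sum_position_repulsion x : domainD x ->
  2 * \sum_i x i * (\sum_(j | j != i) (x i - x j)^-1) <= N%:R ^+ 2.
Proof.
move=> Dx; rewrite -(sum_antisym (F := fun i j => (x i - x j)^-1)); last first.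
  by move=> i j; rewrite -opprB invrN.
rewrite expr2; apply: ler_sum_cst => // i _.
rewrite -[leRHS]mulr1; apply: ler_sum_cst => // j ji.
by rewrite mulfV// subr_eq0; apply: Dx; rewrite eq_sym.
Qed.

End RepulsionIdentities.

Section LogInequality.
Context {R : realType}.

(** Mean value theorem for [ln u - 2 u + u ^ 2 / 2] between [1] and [1 + y]; its
    derivative is [(u - 1) ^ 2 / u]. *)
Lemma ln1D_second_order (y : R) : - 2^-1 <= y ->
  y - y ^+ 2 / 2 - 2 * `|y| ^+ 3 <= ln (1 + y).
Proof.
move=> y2.
pose F (u : R) := ln u - u *+ 2 + u ^+ 2 / 2.
pose dF (u : R) := (u - 1) ^+ 2 / u.
have der (u : R) : 0 < u -> is_derive u 1 F (dF u).
  move=> u0.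
  have H1 : is_derive u 1 (@ln R) u^-1 by exact: is_derive1_ln.
  rewrite /F /dF.
  apply: is_derive_eq.
  rewrite /GRing.scale/=.
  by field; rewrite gt_eqF.
have cont (u v : R) : 0 < u -> {within `[u, v], continuous F}.
  move=> u1; apply: derivable_within_continuous => t.
  rewrite in_itv/= => /andP[ut _].
  by case: (der t (lt_le_trans u1 ut)).
have F1 : F 1 = - (3 / 2) by rewrite /F ln1 expr1n; lra.
suff : - (2 * `|y| ^+ 3) <= F (1 + y) - F 1 by rewrite F1 /F; lra.
have [y0|y0|->] := ltgtP y 0; last first.
- by rewrite addr0 subrr normr0 expr0n/= mulr0 oppr0.
- have y1 : 1 < 1 + y by lra.
  have [|c cy E] := @MVT R F dF 1 (1 + y) y1 _ (cont 1 (1 + y) ltr01).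
    by move=> t; rewrite in_itv/= => /andP[yt _]; apply: der; lra.
  rewrite E.
  move: cy; rewrite in_itv/= => /andP[c0 cy].
  have dF0 : 0 <= dF c by rewrite /dF divr_ge0 ?sqr_ge0//; lra.
  have : 0 <= dF c * (1 + y - 1) by rewrite mulr_ge0//; lra.
  have : 0 <= `|y| ^+ 3 by rewrite exprn_ge0.
  lra.
- have y1 : 1 + y < 1 by lra.
  have y10 : 0 < 1 + y by lra.
  have [|c cy E] := @MVT R F dF (1 + y) 1 y1 _ (cont (1 + y) 1 y10).
    by move=> t; rewrite in_itv/= => /andP[yt _]; apply: der; lra.
  rewrite -opprB E.
  move: cy; rewrite in_itv/= => /andP[yc c0].
  have c10 : 0 < c by lra.
  have dFc : dF c <= 2 * y ^+ 2.
    rewrite /dF ler_pdivrMr//.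
    have : (c - 1) ^+ 2 <= y ^+ 2.
      by rewrite -[leLHS]sqrrN -[leRHS]sqrrN lerXn2r ?nnegrE; lra.
    have y20 : 0 <= y ^+ 2 by exact: sqr_ge0.
    have c2 : 0 <= c * 2 - 1 by lra.
    have := mulr_ge0 y20 c2; lra.
  have ny0 : 0 <= 1 - (1 + y) by lra.
  have := ler_wpM2r ny0 dFc.
  rewrite (ltr0_norm y0) (_ : (- y) ^+ 3 = y ^+ 2 * (- y)); last by ring.
  lra.
Qed.

End LogInequality.

Section Lyapunov.
Context {R : realType}.
Implicit Types (eps g : R).

(** The truncation keeps the potential bounded when a step of the scheme lands on,
    or jumps over, the diagonal. *)
Definition logpot eps g : R := - ln (Num.max `|g| eps).

(** The increment is arbitrary, as Gaussian increments are unbounded: when [dl]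
    exceeds half of the gap it exceeds [eps / 2], and the cubic term dominates
    all the others. *)
Lemma logpot_taylor eps g (dl : R) : 0 < eps -> eps <= `|g| ->
  logpot eps (g + dl) <= logpot eps g - dl / g + (dl / g) ^+ 2 / 2
    + 16 * eps ^- 3 * `|dl| ^+ 3.
Proof.
move=> e0 eg.
have ag0 : 0 < `|g| by exact: lt_le_trans eg.
have g0 : g != 0 by rewrite -normr_gt0.
have M0 r : 0 < Num.max `|r| eps by rewrite lt_max e0 orbT.
have yE : `|dl / g| = `|dl| / `|g| by rewrite normrM normfV.
have ei0 : 0 < eps^-1 by rewrite invr_gt0.
have ye : `|dl / g| <= `|dl| * eps^-1.
  by rewrite yE ler_wpM2l// lef_pV2.
have e3E : eps ^- 3 = eps^-1 ^+ 3 by rewrite exprVn.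
have y3 : `|dl / g| ^+ 3 <= eps ^- 3 * `|dl| ^+ 3.
  rewrite e3E -exprMn [_ * `|dl|]mulrC lerXn2r ?nnegrE//.
  by rewrite mulr_ge0// ltW.
rewrite /logpot (max_l eg).
have [y2|y2] := leP `|dl / g| 2^-1.
  have y1 : 0 < 1 + dl / g by move: y2; rewrite ler_norml => /andP[]; lra.
  have m1 : `|g| * (1 + dl / g) <= Num.max `|g + dl| eps.
    rewrite le_max; apply/orP; left.
    by rewrite -(gtr0_norm y1) -normrM mulrDr mulr1 mulrCA divff// mulr1.
  have : ln (`|g| * (1 + dl / g)) <= ln (Num.max `|g + dl| eps).
    by rewrite ler_ln ?posrE ?mulr_gt0//.
  rewrite lnM ?posrE//.
  have := @ln1D_second_order _ (dl / g) _.
  have -> : - 2^-1 <= dl / g by move: y2; rewrite ler_norml => /andP[].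
  move=> /(_ isT).
  have : 0 <= `|dl / g| ^+ 3 by rewrite exprn_ge0.
  rewrite -[16 * _ * _]mulrA.
  lra.
(* large increments: every term is at most a multiple of the cubic one *)
set z := `|dl| * eps^-1 in ye.
have z2 : 2^-1 < z by exact: lt_le_trans ye.
have dg : `|g| <= 2 * `|dl|.
  by move: y2; rewrite yE ltr_pdivlMr//; lra.
have lg : ln `|g| - ln (Num.max `|g + dl| eps) <= 2 * z.
  have : ln eps <= ln (Num.max `|g + dl| eps).
    by rewrite ler_ln ?posrE// le_max lexx orbT.
  have : ln (`|g| / eps) <= `|g| / eps by rewrite ltW// ln_sublinear// divr_gt0.
  rewrite ln_div ?posrE//.
  have : `|g| / eps <= 2 * z.
    by rewrite /z mulrA ler_wpM2r// ltW.
  lra.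
have := ler_norm (dl / g).
have := sqr_ge0 (dl / g).
have -> : 16 * eps ^- 3 * `|dl| ^+ 3 = 16 * z ^+ 3 by rewrite e3E /z; ring.
have : z <= 4 * z ^+ 3.
  have : 0 <= z * (z - 2^-1) * (z + 2^-1) by rewrite !mulr_ge0//; lra.
  lra.
lra.
Qed.

Lemma cube_le1D4 (u : R) : 0 <= u -> u ^+ 3 <= 1 + u ^+ 4.
Proof.
move=> u0; have [u1|u1] := leP u 1.
  have : u ^+ 3 <= 1 by rewrite exprn_ile1.
  have : 0 <= u ^+ 4 by rewrite exprn_ge0.
  lra.
have : u ^+ 3 <= u ^+ 4 by rewrite ler_weXn2l// ltW.
lra.
Qed.

Lemma pow4_sum3 (u v t : R) :
  (u + v + t) ^+ 4 <= 27 * (u ^+ 4 + v ^+ 4 + t ^+ 4).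
Proof.
have sq (p q r : R) : (p + q + r) ^+ 2 <= 3 * (p ^+ 2 + q ^+ 2 + r ^+ 2).
  have := sqr_ge0 (p - q); have := sqr_ge0 (q - r); have := sqr_ge0 (p - r).
  lra.
rewrite (_ : 4 = 2 * 2)%N // !exprM.
have A := sq u v t.
have B := sq (u ^+ 2) (v ^+ 2) (t ^+ 2).
have : ((u + v + t) ^+ 2) ^+ 2 <= (3 * (u ^+ 2 + v ^+ 2 + t ^+ 2)) ^+ 2.
  by rewrite lerXn2r ?nnegrE ?sqr_ge0// (le_trans _ A)// sqr_ge0.
lra.
Qed.

(** The squares outweigh the logarithm at infinity, which makes the potential
    nonnegative, and large for distant particles. *)
Definition pairpot eps (p q : R) : R := logpot eps (p - q) + 1 + p ^+ 2 + q ^+ 2.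

Lemma pairpot_lower eps (p q : R) : 0 < eps -> eps <= 1 ->
  2^-1 * (p ^+ 2 + q ^+ 2) <= pairpot eps p q.
Proof.
move=> e0 e1; rewrite /pairpot /logpot.
have M0 : 0 < Num.max `|p - q| eps by rewrite lt_max e0 orbT.
have : ln (Num.max `|p - q| eps) <= Num.max `|p - q| eps - 1.
  rewrite -[X in ln X](subrK 1) addrC; apply: le_ln1Dx; lra.
have : Num.max `|p - q| eps <= `|p - q| + 1.
  by rewrite ge_max lerDl ler01/= (le_trans e1)// lerDr.
have := ler_normB p q.
have sq (r : R) : `|r| <= 2^-1 + 2^-1 * r ^+ 2.
  have := sqr_ge0 (`|r| - 1); rewrite sqrrB1 real_normK ?num_real//.
  lra.
have := sq p; have := sq q; lra.
Qed.

Lemma pairpot_ge0 eps (p q : R) : 0 < eps -> eps <= 1 -> 0 <= pairpot eps p q.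
Proof.
move=> e0 e1; apply: le_trans (pairpot_lower p q e0 e1).
by rewrite mulr_ge0// addr_ge0// sqr_ge0.
Qed.

Lemma pairpot_collision eps (p q : R) : 0 < eps -> `|p - q| <= eps ->
  - ln eps <= pairpot eps p q.
Proof.
move=> e0 pq; rewrite /pairpot /logpot (max_r pq).
have := sqr_ge0 p; have := sqr_ge0 q; lra.
Qed.

Lemma pairpot_far eps (p q : R) : 0 < eps -> eps <= 1 -> eps^-1 <= `|p| ->
  - ln eps <= pairpot eps p q.
Proof.
move=> e0 e1 pe; apply: le_trans (pairpot_lower p q e0 e1).
have ei0 : 0 < eps^-1 by rewrite invr_gt0.
rewrite -lnV ?posrE//.
have : ln (eps^-1) <= eps^-1 - 1.
  rewrite -[X in ln X](subrK 1) addrC; apply: le_ln1Dx; lra.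
have : (eps^-1) ^+ 2 <= p ^+ 2.
  by rewrite -[leRHS]real_normK ?num_real// lerXn2r ?nnegrE// ltW.
have := sqr_ge0 (eps^-1 - 1).
have := sqr_ge0 q.
lra.
Qed.

(** Taylor expansion of one Euler step with [h = k ^+ 2]: the generator times [h],
    then the terms that are linear in the noise, centred squares, or mixed, and
    last a remainder of order [h ^ (3/2)].  The constant depends on the
    truncation but not on the step. *)
Lemma pairpot_step eps C sg : 0 < eps -> 0 <= C -> exists2 K, 0 <= K &
  forall (k p q bp bq xp xq f h : R), 0 < k -> k <= 1 ->
  eps <= `|p - q| -> `|bp| <= C -> `|bq| <= C ->
  f = trinv eps (p - q) -> h = k ^+ 2 ->
  pairpot eps (p + h * bp + sg * xp) (q + h * bq + sg * xq) <=
  pairpot eps p q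
  + h * (- (bp - bq) * f + sg ^+ 2 * f ^+ 2 + 2 * p * bp + 2 * q * bq + 2 * sg ^+ 2)
  + ((- f * sg + f ^+ 2 * h * (bp - bq) * sg + 2 * (p + h * bp) * sg) * xp
    + (f * sg - f ^+ 2 * h * (bp - bq) * sg + 2 * (q + h * bq) * sg) * xq
    + (f ^+ 2 * sg ^+ 2 / 2 + sg ^+ 2) * (xp ^+ 2 - h)
    + (f ^+ 2 * sg ^+ 2 / 2 + sg ^+ 2) * (xq ^+ 2 - h)
    - f ^+ 2 * sg ^+ 2 * (xp * xq))
  + K * (k ^+ 3 * (1 + (xp / k) ^+ 4 + (xq / k) ^+ 4)).
Proof.
move=> e0 C0.
pose K1 := 16 * eps ^- 3.
have K10 : 0 <= K1 by rewrite mulr_ge0// invr_ge0 exprn_ge0// ltW.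
pose K2 := 27 * (16 * C ^+ 4 + sg ^+ 4) + 1.
have K20 : 0 <= K2.
  by rewrite addr_ge0// mulr_ge0// addr_ge0 ?exprn_even_ge0// mulr_ge0 ?exprn_even_ge0.
pose K3 := 2 * eps ^- 2 * C ^+ 2 + 2 * C ^+ 2.
have K30 : 0 <= K3.
  by rewrite addr_ge0// !mulr_ge0// ?sqr_ge0// invr_ge0 exprn_ge0// ltW.
exists (K1 * K2 + K3); first by rewrite addr_ge0// mulr_ge0.
move=> k p q bp bq xp xq f h k0 k1 eg bpC bqC fT hE.
have h0 : 0 < h by rewrite hE exprn_gt0.
have fE : f = (p - q)^-1 by rewrite fT trinvE.
have g0 : p - q != 0 by rewrite -normr_gt0 (lt_le_trans e0).
pose be := bp - bq; pose ze := xp - xq.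
pose dl := h * be + sg * ze.
have T := logpot_taylor dl e0 eg.
have T1 : logpot eps (p + h * bp + sg * xp - (q + h * bq + sg * xq)) <=
   logpot eps (p - q) - dl * f + (dl * f) ^+ 2 / 2 + K1 * `|dl| ^+ 3.
  move: T; rewrite -fE; congr (logpot eps _ <= _).
  by rewrite /dl /be /ze; ring.
have beC : `|be| <= 2 * C by have := ler_normB bp bq; rewrite /be; lra.
have be2 : be ^+ 2 <= 4 * C ^+ 2.
  rewrite -[leLHS]real_normK ?num_real// (_ : 4 * C ^+ 2 = (2 * C) ^+ 2); last by ring.
  by rewrite lerXn2r ?nnegrE// mulr_ge0.
have bp2 : bp ^+ 2 <= C ^+ 2.
  by rewrite -[leLHS]real_normK ?num_real// lerXn2r ?nnegrE.
have bq2 : bq ^+ 2 <= C ^+ 2.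
  by rewrite -[leLHS]real_normK ?num_real// lerXn2r ?nnegrE.
have f2 : f ^+ 2 <= eps ^- 2.
  rewrite -[leLHS]real_normK ?num_real// -exprVn lerXn2r ?nnegrE ?invr_ge0 ?(ltW e0)//.
  by rewrite fT; exact: trinv_bound.
pose Q := 1 + (xp / k) ^+ 4 + (xq / k) ^+ 4.
have Q1 : 1 <= Q by rewrite /Q -addrA lerDl addr_ge0// exprn_even_ge0.
have cub : `|dl| ^+ 3 <= k ^+ 3 * (K2 * Q).
  have -> : dl = k * (k * be + sg * (xp / k) + - sg * (xq / k)).
    by rewrite /dl /ze hE; field; rewrite gt_eqF.
  rewrite normrM exprMn (gtr0_norm k0) ler_wpM2l ?exprn_ge0 ?(ltW k0)//.
  apply: le_trans (cube_le1D4 _) _ => //.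
  rewrite [`|_| ^+ 4](_ : _ = (k * be + sg * (xp / k) + - sg * (xq / k)) ^+ 4); last first.
    by rewrite (_ : 4 = 2 * 2)%N// !exprM real_normK ?num_real.
  have := pow4_sum3 (k * be) (sg * (xp / k)) (- sg * (xq / k)).
  rewrite !exprMn (_ : (- sg) ^+ 4 = sg ^+ 4); last by ring.
  have kb4 : k ^+ 4 * be ^+ 4 <= 16 * C ^+ 4.
    have k4 : k ^+ 4 <= 1 by rewrite exprn_ile1// ltW.
    have b4 : be ^+ 4 <= 16 * C ^+ 4.
      rewrite (_ : be ^+ 4 = (be ^+ 2) ^+ 2); last by ring.
      rewrite (_ : 16 * C ^+ 4 = (4 * C ^+ 2) ^+ 2); last by ring.
      by rewrite lerXn2r ?nnegrE ?sqr_ge0// mulr_ge0 ?sqr_ge0.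
    apply: le_trans b4; apply: ler_piMl => //.
    by rewrite (_ : 4 = 2 * 2)%N// exprM sqr_ge0.
  have sg4 : 0 <= sg ^+ 4 by rewrite (_ : 4 = 2 * 2)%N// exprM sqr_ge0.
  have C4 : 0 <= C ^+ 4 by rewrite exprn_ge0.
  have A1 : 0 <= (xp / k) ^+ 4 by rewrite (_ : 4 = 2 * 2)%N// exprM sqr_ge0.
  have A2 : 0 <= (xq / k) ^+ 4 by rewrite (_ : 4 = 2 * 2)%N// exprM sqr_ge0.
  rewrite /K2 /Q.
  have := mulr_ge0 C4 A1; have := mulr_ge0 C4 A2.
  rewrite -!exprMn.
  move: kb4; rewrite !exprMn; lra.
have cub' := ler_wpM2l K10 cub.
have h2 : h ^+ 2 <= k ^+ 3 * Q.
  have : k ^+ 4 <= k ^+ 3 by rewrite ler_wiXn2l// ltW.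
  have k3 : 0 <= k ^+ 3 by rewrite exprn_ge0// ltW.
  have := ler_wpM2l k3 Q1.
  by rewrite hE -exprM; lra.
have f20 := sqr_ge0 f; have be20 := sqr_ge0 be; have h20 := sqr_ge0 h.
have rem : h ^+ 2 * (f ^+ 2 * be ^+ 2 / 2 + bp ^+ 2 + bq ^+ 2) <= k ^+ 3 * Q * K3.
  have s0 : 0 <= f ^+ 2 * be ^+ 2 / 2 + bp ^+ 2 + bq ^+ 2.
    have := mulr_ge0 f20 be20; have := sqr_ge0 bp; have := sqr_ge0 bq; lra.
  apply: ler_pM => //.
  have := ler_pM f20 be20 f2 be2.
  rewrite /K3; lra.
rewrite /pairpot.
rewrite -/Q.
have -> : (K1 * K2 + K3) * (k ^+ 3 * Q) = K1 * (k ^+ 3 * (K2 * Q)) + k ^+ 3 * Q * K3.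
  by ring.
move: T1 cub' rem; rewrite /dl /be /ze; lra.
Qed.

End Lyapunov.

(** * The Lyapunov function along one Euler step *)

Section LyapunovStep.
Context {R : realType} {N : nat}.
Implicit Types (eps a sg h k : R) (x xi : 'I_N -> R).

Lemma trinvN eps (g : R) : trinv eps (- g) = - trinv eps g.
Proof. by rewrite /trinv sqrrN mulNr. Qed.

Definition lyapunov eps x : R :=
  \sum_i \sum_(j | j != i) pairpot eps (x i) (x j).

Lemma lyapunov_ge0 eps x : 0 < eps -> eps <= 1 -> 0 <= lyapunov eps x.
Proof.
by move=> e0 e1; apply: sumr_ge0 => i _; apply: sumr_ge0 => j _; exact: pairpot_ge0.
Qed.

Lemma pairpot_le_lyapunov eps x i j : 0 < eps -> eps <= 1 -> j != i ->
  pairpot eps (x i) (x j) <= lyapunov eps x.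
Proof.
move=> e0 e1 ji; rewrite /lyapunov (bigD1 i)//= (bigD1 j)//= -addrA lerDl.
apply: addr_ge0; first by apply: sumr_ge0 => ? _; exact: pairpot_ge0.
by apply: sumr_ge0 => ? _; apply: sumr_ge0 => ? _; exact: pairpot_ge0.
Qed.

(** The price of leaving the safe region tends to infinity as [eps] tends to [0]. *)
Lemma lyapunov_unsafe eps x : (2 <= N)%N -> 0 < eps -> eps <= 1 ->
  ~~ safe eps x -> - ln eps <= lyapunov eps x.
Proof.
move=> N2 e0 e1; rewrite negb_and => /orP[|] /forallPn[i].
  rewrite -ltNge => xi.
  have [j ji] : exists j : 'I_N, j != i.
    have N0 : (0 < N)%N by exact: ltnW.
    have [i0|i0] := eqVneq (i : nat) 0%N.
      by exists (Ordinal N2); rewrite -val_eqE /= i0.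
    by exists (Ordinal N0); rewrite -val_eqE /= eq_sym.
  by apply: le_trans (pairpot_le_lyapunov x e0 e1 ji); exact: pairpot_far (ltW xi).
move=> /forallPn[j]; rewrite negb_imply -ltNge => /andP[ji xij].
by apply: le_trans (pairpot_le_lyapunov x e0 e1 ji); exact: pairpot_collision (ltW xij).
Qed.

(** The coefficients of the noise in the expansion of [pairpot_step].  With [trinv]
    in place of the inverse they are continuous functions of the configuration,
    hence measurable; they are bounded on the safe region. *)
Definition lin_coef eps a sg h x i j : R :=
  let f := trinv eps (x i - x j) in
  let b := trdrift a eps x in
  - f * sg + f ^+ 2 * h * (b i - b j) * sg + 2 * (x i + h * b i) * sg.

Definition sq_coef eps sg x i j : R :=
  trinv eps (x i - x j) ^+ 2 * sg ^+ 2 / 2 + sg ^+ 2.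

Definition cross_coef eps sg x i j : R := trinv eps (x i - x j) ^+ 2 * sg ^+ 2.

Definition noise_terms eps a sg h x xi : R :=
  \sum_i \sum_(j | j != i)
   (lin_coef eps a sg h x i j * xi i + lin_coef eps a sg h x j i * xi j
    + sq_coef eps sg x i j * (xi i ^+ 2 - h)
    + sq_coef eps sg x i j * (xi j ^+ 2 - h)
    - cross_coef eps sg x i j * (xi i * xi j)).

Definition growth_rate a sg : R := 2 * N%:R ^+ 3 * a + 2 * N%:R ^+ 2 * sg ^+ 2.

(** The singular terms have total coefficient [sg ^+ 2 - 2 * a].  The bound is
    uniform in [eps], hence negligible with respect to [- ln eps]. *)
Lemma generator_le eps a sg x : 0 < eps -> 0 <= a -> sg ^+ 2 <= 2 * a ->
  safe eps x ->
  \sum_i \sum_(j | j != i)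
    (- (trdrift a eps x i - trdrift a eps x j) * trinv eps (x i - x j)
     + sg ^+ 2 * trinv eps (x i - x j) ^+ 2
     + 2 * x i * trdrift a eps x i + 2 * x j * trdrift a eps x j + 2 * sg ^+ 2)
  <= growth_rate a sg.
Proof.
move=> e0 a0 sga sx; have Dx := safe_domainD e0 sx.
set b := trdrift a eps x.
have fE i j : j != i -> trinv eps (x i - x j) = (x i - x j)^-1.
  by move=> ji; rewrite trinvE//; exact: safe_gap.
have bE i : b i = a * \sum_(j | j != i) (x i - x j)^-1 by rewrite /b trdriftE.
pose S := \sum_i \sum_(j | j != i) (x i - x j)^-1 ^+ 2.
have S0 : 0 <= S by apply: sumr_ge0 => i _; apply: sumr_ge0 => j _; exact: sqr_ge0.
have E1 : \sum_i \sum_(j | j != i) (b i - b j) * (x i - x j)^-1 = 2 * a * S.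
  rewrite (sum_antisym (F := fun i j => (x i - x j)^-1)); last first.
    by move=> i j; rewrite -opprB invrN.
  rewrite /S -(sum_sq_repulsion Dx) -mulrA; congr (_ * _).
  by rewrite mulr_sumr; apply: eq_bigr => i _; rewrite bE expr2 mulrA.
have E2 : 2 * \sum_i x i * b i <= a * N%:R ^+ 2.
  have := ler_wpM2l a0 (sum_position_repulsion Dx).
  apply: le_trans; rewrite mulrCA; apply: ler_wpM2l => //.
  by rewrite mulr_sumr; apply: ler_sum => i _; rewrite bE mulrCA.
have card_neq (i : 'I_N) (c : R) : \sum_(j | j != i) c = c * (N.-1)%:R.
  rewrite (eq_bigl (mem (predC1 i)))//.
  by rewrite sumr_const cardC1 card_ord mulr_natr.
have E3 : \sum_i \sum_(j | j != i) (2 * x i * b i) = N.-1%:R * (2 * \sum_i x i * b i).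
  rewrite !mulr_sumr; apply: eq_bigr => i _; rewrite card_neq; ring.
have E4 : \sum_i \sum_(j | j != i) (2 * x j * b j) = N.-1%:R * (2 * \sum_i x i * b i).
  rewrite -E3 (exchange_big_dep xpredT)//=; apply: eq_bigr => j _.
  by apply: eq_bigl => i; rewrite eq_sym.
have E5 : \sum_(i < N) \sum_(j < N | j != i) (2 * sg ^+ 2) <= N%:R * (N%:R * (2 * sg ^+ 2)).
  have s0 : 0 <= 2 * sg ^+ 2 by rewrite mulr_ge0 ?sqr_ge0.
  apply: ler_sum_cst => [|i _]; first by rewrite mulr_ge0.
  exact: ler_sum_cst.
have E6 : \sum_i \sum_(j | j != i) (sg ^+ 2 * (x i - x j)^-1 ^+ 2) = sg ^+ 2 * S.
  by rewrite mulr_sumr; apply: eq_bigr => i _; rewrite mulr_sumr.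
have N1 : (N.-1)%:R <= N%:R :> R by rewrite ler_nat leq_pred.
rewrite (eq_bigr (fun i =>
   - (\sum_(j | j != i) (b i - b j) * (x i - x j)^-1)
   + \sum_(j | j != i) (sg ^+ 2 * (x i - x j)^-1 ^+ 2)
   + \sum_(j | j != i) (2 * x i * b i) + \sum_(j | j != i) (2 * x j * b j)
   + \sum_(j | j != i) (2 * sg ^+ 2))); last first.
  move=> i _; rewrite -sumrN -!big_split; apply: eq_bigr => j ji /=.
  by rewrite fE// mulNr.
rewrite !big_split /= sumrN E1 E3 E4 E6.
have : sg ^+ 2 * S <= 2 * a * S by rewrite ler_wpM2r.
have B : N.-1%:R * (2 * \sum_i x i * b i) <= N%:R * (a * N%:R ^+ 2).
  apply: (@le_trans _ _ (N.-1%:R * (a * N%:R ^+ 2))); first by rewrite ler_wpM2l.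
  by rewrite ler_wpM2r// mulr_ge0// exprn_ge0.
rewrite /growth_rate; move: E5; lra.
Qed.

Lemma lyapunov_step eps a sg : 0 < eps -> 0 <= a -> sg ^+ 2 <= 2 * a ->
  exists2 K, 0 <= K & forall k h x xi, 0 < k -> k <= 1 -> h = k ^+ 2 ->
  safe eps x ->
  lyapunov eps (fun i => x i + h * trdrift a eps x i + sg * xi i) <=
  lyapunov eps x + h * growth_rate a sg + noise_terms eps a sg h x xi
  + K * (k ^+ 3 * (1 + \sum_i (xi i / k) ^+ 4)).
Proof.
move=> e0 a0 sga.
pose C := a * (N%:R * eps^-1).
have C0 : 0 <= C by rewrite !mulr_ge0// invr_ge0 ltW.
have [K K0 HK] := pairpot_step sg e0 C0.
exists (N%:R * (N%:R * (K * 2))); first by rewrite !mulr_ge0.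
move=> k h x xi k0 k1 hE sx.
have h0 : 0 <= h by rewrite hE sqr_ge0.
pose b := trdrift a eps x.
pose Q := 1 + \sum_i (xi i / k) ^+ 4.
have p4 (u : R) : 0 <= u ^+ 4 by rewrite (_ : 4 = 2 * 2)%N// exprM sqr_ge0.
have Q1 i j : j != i -> 1 + (xi i / k) ^+ 4 + (xi j / k) ^+ 4 <= 2 * Q.
  move=> ji; rewrite /Q (bigD1 i)//= (bigD1 j)//=.
  have : 0 <= \sum_(i0 | (i0 != i) && (i0 != j)) (xi i0 / k) ^+ 4 by exact: sumr_ge0.
  have := p4 (xi i / k); have := p4 (xi j / k); lra.
have k30 : 0 <= k ^+ 3 by rewrite exprn_ge0// ltW.
have S i j : j != i ->
    pairpot eps (x i + h * b i + sg * xi i) (x j + h * b j + sg * xi j) <=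
    pairpot eps (x i) (x j)
    + h * (- (b i - b j) * trinv eps (x i - x j)
     + sg ^+ 2 * trinv eps (x i - x j) ^+ 2
     + 2 * x i * b i + 2 * x j * b j + 2 * sg ^+ 2)
    + (lin_coef eps a sg h x i j * xi i + lin_coef eps a sg h x j i * xi j
    + sq_coef eps sg x i j * (xi i ^+ 2 - h)
    + sq_coef eps sg x i j * (xi j ^+ 2 - h)
    - cross_coef eps sg x i j * (xi i * xi j))
    + K * (2 * (k ^+ 3 * Q)).
  move=> ji.
  have := HK k (x i) (x j) (b i) (b j) (xi i) (xi j) _ _ k0 k1
    (safe_gap sx ji) (trdrift_bound x i a0 e0) (trdrift_bound x j a0 e0)
    erefl hE.
  move=> /le_trans; apply.
  have -> : lin_coef eps a sg h x j i =
    trinv eps (x i - x j) * sg - trinv eps (x i - x j) ^+ 2 * h * (b i - b j) * sg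
    + 2 * (x j + h * b j) * sg.
    by rewrite /lin_coef -(opprB (x i) (x j)) trinvN -/b; ring.
  rewrite lerD//.
  rewrite ler_wpM2l// [leRHS]mulrCA ler_wpM2l//; exact: Q1.
have := generator_le e0 a0 sga sx.
move=> /(ler_wpM2l h0); rewrite -/b => G.
have -> : N%:R * (N%:R * (K * 2)) * (k ^+ 3 * Q) = N%:R * (N%:R * (K * (2 * (k ^+ 3 * Q)))).
  by ring.
have B0 : 0 <= K * (2 * (k ^+ 3 * Q)).
  have Q0 : 0 <= Q by rewrite /Q addr_ge0//; exact: sumr_ge0.
  apply: mulr_ge0 => //; apply: mulr_ge0 => //; exact: mulr_ge0.
have E : \sum_(i < N) \sum_(j < N | j != i) K * (2 * (k ^+ 3 * Q)) <=
   N%:R * (N%:R * (K * (2 * (k ^+ 3 * Q)))).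
  apply: ler_sum_cst => [|i _]; first by rewrite mulr_ge0.
  exact: ler_sum_cst.
apply: le_trans (_ : _ <= lyapunov eps x + h * (\sum_i \sum_(j | j != i)
    (- (b i - b j) * trinv eps (x i - x j)
     + sg ^+ 2 * trinv eps (x i - x j) ^+ 2
     + 2 * x i * b i + 2 * x j * b j + 2 * sg ^+ 2))
   + noise_terms eps a sg h x xi
   + \sum_(i < N) \sum_(j < N | j != i) K * (2 * (k ^+ 3 * Q))) _; last first.
  by rewrite lerD// lerD2r lerD2l.
rewrite /lyapunov /noise_terms mulr_sumr -!big_split; apply: ler_sum => i _ /=.
rewrite mulr_sumr -!big_split; apply: ler_sum => j ji /=.
exact: S.
Qed.

End LyapunovStep.

(** * Moments of Gaussian variables *)

Lemma measurable_linear_scale (R : realType) (d : measure_display)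
    (T : measurableType d) (t : R) (f : T -> R) :
  measurable_fun setT f -> measurable_fun setT (fun x => t * f x).
Proof. by move=> mf; apply: measurable_funM. Qed.

Section NormalIntegral.
Context {R : realType}.
Notation mu := (@lebesgue_measure R).

(** The density that defines [normal_prob] agrees almost everywhere with the
    Radon-Nikodym derivative, for which the change of variables is known. *)
Lemma ge0_integral_normal_prob (m s : R) (f : R -> \bar R) :
  measurable_fun setT f -> (forall x, 0 <= f x)%E ->
  (\int[normal_prob m s]_x f x = \int[mu]_x (f x * (normal_pdf m s x)%:E))%E.
Proof.
move=> mf f0; have dom := @normal_prob_dominates R m s.
rewrite -(Radon_Nikodym_SigmaFinite.change_of_variables dom)//.
apply: ae_eq_integral => //.
- apply: emeasurable_funM => //; apply: (measurable_int mu).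
  exact: Radon_Nikodym_SigmaFinite.f_integrable.
- apply: emeasurable_funM => //; apply/measurable_EFinP.
  exact: measurable_normal_pdf.
- apply: ae_eqe_mul2l; apply: integral_ae_eq => //.
  + exact: Radon_Nikodym_SigmaFinite.f_integrable.
  + by apply/measurable_EFinP; exact: measurable_normal_pdf.
  + by move=> A _ mA; rewrite -Radon_Nikodym_SigmaFinite.f_integral.
Qed.

(** Completing the square produces the density of a shifted normal law.  All the
    moments below are drawn from this formula. *)
Lemma normal_mgf (s t : R) : s != 0 ->
  (\int[normal_prob 0 s]_x (expR (t * x))%:E = (expR (t ^+ 2 * s ^+ 2 / 2))%:E)%E.
Proof.
move=> s0; rewrite ge0_integral_normal_prob; last 2 first.
- apply/measurable_EFinP; apply: measurableT_comp => //.
- by move=> x; rewrite lee_fin expR_ge0.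
transitivity (\int[mu]_x ((expR (t ^+ 2 * s ^+ 2 / 2))%:E
    * (normal_pdf (t * s ^+ 2) s x)%:E))%E.
  apply: eq_integral => x _; rewrite -!EFinM; congr EFin.
  rewrite !normal_pdfE// /normal_fun mulrCA [RHS]mulrCA; congr (_ * _).
  rewrite -!expRD; congr expR; field.
  by rewrite s0.
rewrite ge0_integralZl ?integral_normal_pdf ?mule1//.
by apply/measurable_EFinP; exact: measurable_normal_pdf.
by move=> x _; rewrite lee_fin normal_pdf_ge0.
Qed.

End NormalIntegral.

Section ExponentialBounds.
Context {R : realType}.

Lemma expR_sub1_le (u : R) : expR u - 1 <= u * expR u.
Proof.
have := expR_ge1Dx (- u); rewrite expRN => h.
have e0 := expR_gt0 u.
by have := ler_wpM2r (ltW e0) h; rewrite mulVf ?gt_eqF//; lra.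
Qed.

(** The difference of the two sides vanishes at [0] and its derivative
    [e^u + e^(-u) - 2] is nonnegative. *)
Lemma sinh_ge (z : R) : 0 <= z -> 2 * z <= expR z - expR (- z).
Proof.
rewrite le_eqVlt => /predU1P[<-|z0]; first by rewrite oppr0 mulr0 subrr.
pose F (u : R) := expR u - expR (- u) - u *+ 2.
pose dF (u : R) := expR u + expR (- u) - 2.
have der (u : R) : is_derive u 1 F (dF u).
  rewrite /F /dF; apply: is_derive_eq.
  rewrite /GRing.scale/=; ring.
have cont : {within `[0, z], continuous F}.
  by apply: derivable_within_continuous => t _; case: (der t).
have [c cz E] := @MVT R F dF 0 z z0 (fun t _ => der t) cont.
have F0 : F 0 = 0 by rewrite /F oppr0 expR0 mul0rn subr0 subrr.
have : 0 <= dF c.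
  rewrite /dF expRN.
  have e0 := expR_gt0 c.
  have -> : expR c + (expR c)^-1 - 2 = (expR c - 1) ^+ 2 / expR c.
    by field; rewrite gt_eqF.
  by rewrite divr_ge0 ?sqr_ge0// ltW.
rewrite F0 !subr0 in E => dc.
have : 0 <= F z by rewrite E mulr_ge0// ltW.
rewrite /F; lra.
Qed.

Lemma cosh_ge (y : R) : y ^+ 2 <= expR y + expR (- y) - 2.
Proof.
wlog y0 : y / 0 <= y.
  move=> W; have [/W//|/ltW yn] := leP 0 y.
  have /W : 0 <= - y by lra.
  by rewrite opprK sqrrN (addrC (expR (- y))).
have z0 : 0 <= y / 2 by rewrite divr_ge0.
have := sinh_ge z0.
have -> : expR y + expR (- y) - 2 = (expR (y / 2) - expR (- (y / 2))) ^+ 2.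
  have pq : expR (y / 2) * expR (- (y / 2)) = 1 by rewrite -expRD subrr expR0.
  have -> : expR y = expR (y / 2) ^+ 2.
    by rewrite -expRM_natl; congr expR; field.
  have -> : expR (- y) = expR (- (y / 2)) ^+ 2.
    by rewrite -expRM_natl; congr expR; field.
  lra.
have -> : 2 * (y / 2) = y by field.
move=> h; rewrite lerXn2r ?nnegrE//.
exact: le_trans h.
Qed.

Lemma quartic_le_cosh (y : R) : y ^+ 4 <= 24 * (expR y + expR (- y)).
Proof.
wlog y0 : y / 0 <= y.
  move=> W; have [/W//|/ltW yn] := leP 0 y.
  have /W : 0 <= - y by lra.
  rewrite opprK (addrC (expR (- y))) (_ : (- y) ^+ 4 = y ^+ 4)//; ring.
have := expR_ge1Dxn 3 y0; rewrite (_ : 4`! = 24)%N// => h.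
have := expR_gt0 (- y).
lra.
Qed.

End ExponentialBounds.

Section NormalMoments.
Context {R : realType} {d : measure_display} {T : measurableType d}.
Variables (P : probability T R) (xi : T -> R) (s : R).
Hypothesis mxi : measurable_fun setT xi.
Hypothesis s0 : 0 < s.
Hypothesis xi_law : forall A : set (measurableTypeR R), measurable A ->
  P (xi @^-1` A) = normal_prob 0 s A.

Lemma normal_rv_mgf (t : R) :
  (\int[P]_w (expR (t * xi w))%:E = (expR (t ^+ 2 * s ^+ 2 / 2))%:E)%E.
Proof.
rewrite -normal_mgf ?gt_eqF//.
have mf : measurable_fun [set: measurableTypeR R] (fun x : R => (expR (t * x))%:E).
  apply/measurable_EFinP; apply: measurableT_comp => //.
transitivity (\int[pushforward P (xi : T -> measurableTypeR R)]_x (expR (t * x))%:E)%E.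
  by rewrite ge0_integral_pushforward// => x _; rewrite lee_fin expR_ge0.
by apply: eq_measure_integral => A mA _; exact: xi_law.
Qed.

Lemma integrable_exp (t : R) : P.-integrable setT (fun w => (expR (t * xi w))%:E).
Proof.
apply/integrableP; split.
  apply/measurable_EFinP; apply: measurableT_comp => //.
  exact: measurable_linear_scale.
under eq_integral do rewrite /= ger0_norm ?expR_ge0//.
by rewrite normal_rv_mgf ltry.
Qed.

Lemma Rintegral_exp (t : R) :
  \int[P]_w expR (t * xi w) = expR (t ^+ 2 * s ^+ 2 / 2).
Proof. by rewrite /Rintegral normal_rv_mgf. Qed.

Lemma integrable_cst (c : R) : P.-integrable setT (fun _ => c%:E).
Proof. exact: (finite_measure_integrable_cst P c measurableT). Qed.

Lemma Rintegral_cst1 (c : R) : \int[P]_w c = c.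
Proof.
rewrite Rintegral_cst// -[RHS]mulr1; congr (_ * _).
have /(congr1 fine) := @probability_setT _ _ _ P; exact.
Qed.

Lemma integrable_cosh (t : R) :
  P.-integrable setT (fun w => (expR (t * xi w) + expR (- (t * xi w)))%:E).
Proof.
under eq_fun do rewrite EFinD -mulNr.
by apply: integrableD => //; exact: integrable_exp.
Qed.

Lemma Rintegral_cosh (t : R) :
  \int[P]_w (expR (t * xi w) + expR (- (t * xi w)))
  = 2 * expR (t ^+ 2 * s ^+ 2 / 2).
Proof.
under eq_Rintegral do rewrite -mulNr.
rewrite RintegralD//; [|exact: integrable_exp|exact: integrable_exp].
rewrite !Rintegral_exp sqrrN; ring.
Qed.

Lemma normal_integrable4 : P.-integrable setT (fun w => (xi w ^+ 4)%:E).
Proof.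
have := integrableZl measurableT (24 * s ^+ 4) (integrable_cosh s^-1).
apply: le_integrable => //.
  by apply/measurable_EFinP; exact: measurable_funX.
move=> w _; rewrite -EFinM lee_fin.
have p4 (u : R) : 0 <= u ^+ 4 by rewrite (_ : 4 = 2 * 2)%N// exprM sqr_ge0.
rewrite !ger0_norm//; last first.
  by rewrite mulr_ge0 ?addr_ge0 ?expR_ge0// mulr_ge0.
have := ler_wpM2l (p4 s) (quartic_le_cosh (s^-1 * xi w)).
by rewrite -exprMn mulrA divff ?gt_eqF// mul1r; lra.
Qed.

Lemma normal_moment4 : \int[P]_w (xi w ^+ 4) <= 48 * expR 2^-1 * s ^+ 4.
Proof.
have p4 (u : R) : 0 <= u ^+ 4 by rewrite (_ : 4 = 2 * 2)%N// exprM sqr_ge0.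
apply: (@le_trans _ _ (\int[P]_w (24 * s ^+ 4 * (expR (s^-1 * xi w) + expR (- (s^-1 * xi w)))))).
  apply: le_Rintegral => //.
  - exact: normal_integrable4.
  - exact: (integrableZl measurableT (24 * s ^+ 4) (integrable_cosh s^-1)).
  - move=> w _; have := ler_wpM2l (p4 s) (quartic_le_cosh (s^-1 * xi w)).
    by rewrite -exprMn mulrA divff ?gt_eqF// mul1r; lra.
rewrite RintegralZl//; last exact: integrable_cosh.
rewrite Rintegral_cosh -exprMn mulVf ?gt_eqF// expr1n mul1r; lra.
Qed.

Lemma normal_integrable2 : P.-integrable setT (fun w => (xi w ^+ 2)%:E).
Proof.
have := integrableD measurableT (integrable_cst 1) normal_integrable4.
apply: le_integrable => //.
  by apply/measurable_EFinP; exact: measurable_funX.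
move=> w _; rewrite -EFinD lee_fin.
have p4 (u : R) : 0 <= u ^+ 4 by rewrite (_ : 4 = 2 * 2)%N// exprM sqr_ge0.
rewrite !ger0_norm ?sqr_ge0//; last by rewrite addr_ge0.
have := sqr_ge0 (xi w ^+ 2 - 2^-1); lra.
Qed.

Lemma normal_integrable1 : P.-integrable setT (fun w => (xi w)%:E).
Proof.
have := integrableD measurableT (integrable_cst 1) normal_integrable2.
apply: le_integrable => //; first exact/measurable_EFinP.
move=> w _; rewrite -EFinD lee_fin.
rewrite [leRHS]ger0_norm; last by rewrite addr_ge0// sqr_ge0.
have := sqr_ge0 (`|xi w| - 2^-1).
by rewrite sqrrB real_normK ?num_real//; lra.
Qed.

(** From [(t x) ^ 2 <= e^(t x) + e^(- t x) - 2], letting [t] tend to [0]. *)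
Lemma normal_moment2 : \int[P]_w (xi w ^+ 2) <= s ^+ 2.
Proof.
set v := \int[P]_w _.
have s20 : 0 < s ^+ 2 by rewrite exprn_gt0.
have H (t : R) : 0 < t -> t ^+ 2 * v <= 2 * (expR (t ^+ 2 * s ^+ 2 / 2) - 1).
  move=> t0; rewrite /v -RintegralZl//; last exact: normal_integrable2.
  apply: (@le_trans _ _ (\int[P]_w ((expR (t * xi w) + expR (- (t * xi w))) - 2))).
    apply: le_Rintegral => //.
    - exact: (integrableZl measurableT (t ^+ 2) normal_integrable2).
    - exact: (integrableB measurableT (integrable_cosh t) (integrable_cst 2)).
    - by move=> w _; rewrite -exprMn; exact: cosh_ge.
  rewrite RintegralB//; [|exact: integrable_cosh|exact: integrable_cst].
  by rewrite Rintegral_cosh Rintegral_cst1; lra.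
have H2 (u : R) : 0 < u -> v * expR (- u) <= s ^+ 2.
  move=> u0; pose t := Num.sqrt (2 * u / s ^+ 2).
  have tpos : 0 < 2 * u / s ^+ 2 by rewrite divr_gt0// mulr_gt0.
  have t0 : 0 < t by rewrite sqrtr_gt0.
  have := H t t0; rewrite /t sqr_sqrtr ?(ltW tpos)//.
  have -> : 2 * u / s ^+ 2 * s ^+ 2 / 2 = u by field; rewrite gt_eqF.
  have := expR_sub1_le u => e1 e2.
  have : 2 * u / s ^+ 2 * v <= 2 * (u * expR u) by lra.
  have -> : 2 * u / s ^+ 2 * v = (2 * u) * (v / s ^+ 2) by ring.
  rewrite mulrA ler_pM2l ?mulr_gt0// ler_pdivrMr//.
  by rewrite expRN ler_pdivrMr ?expR_gt0// mulrC.
apply/ler_addgt0Pr => e e0.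
have [v0|v0] := leP v 0; first by lra.
have u0 : 0 < e / v by rewrite divr_gt0.
have := H2 _ u0.
have := expR_ge1Dx (- (e / v)).
move=> /(ler_wpM2l (ltW v0)).
have -> : v * (1 + - (e / v)) = v - e by field; rewrite gt_eqF.
lra.
Qed.

(** From [t x <= e^(t x) - 1], letting [t] tend to [0] from both sides. *)
Lemma normal_moment1 : \int[P]_w (xi w) = 0.
Proof.
set v := \int[P]_w _.
have s20 : 0 < s ^+ 2 by rewrite exprn_gt0.
have H (t : R) : t * v <= expR (t ^+ 2 * s ^+ 2 / 2) - 1.
  rewrite /v -RintegralZl//; last exact: normal_integrable1.
  apply: (@le_trans _ _ (\int[P]_w (expR (t * xi w) - 1))).
    apply: le_Rintegral => //.
    - exact: (integrableZl measurableT t normal_integrable1).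
    - exact: (integrableB measurableT (integrable_exp t) (integrable_cst 1)).
    - by move=> w _; have := expR_ge1Dx (t * xi w); lra.
  rewrite RintegralB//; [|exact: integrable_exp|exact: integrable_cst].
  by rewrite Rintegral_exp Rintegral_cst1.
have s1 : 0 < 1 + s ^+ 2 by rewrite addr_gt0.
have H2 (t : R) : 0 < t -> t * `|v| <= t ^+ 2 * (s ^+ 2 / 2 * expR (t ^+ 2 * s ^+ 2 / 2)).
  move=> t0.
  have := H t; have := H (- t); rewrite sqrrN.
  have := expR_sub1_le (t ^+ 2 * s ^+ 2 / 2).
  have -> : t * `|v| = `|t * v| by rewrite normrM (gtr0_norm t0).
  set E := expR _ => h1 h2 h3.
  rewrite ler_norml; apply/andP; split; lra.
apply/eqP; rewrite -normr_le0; apply/ler_addgt0Pr => e e0; rewrite add0r.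
pose c := s ^+ 2 / 2 * expR (s ^+ 2 / 2).
have c0 : 0 < c by rewrite mulr_gt0 ?divr_gt0 ?expR_gt0.
pose t := Num.min 1 (e / c).
have t0 : 0 < t by rewrite lt_min ltr01 divr_gt0.
have t1 : t <= 1 by rewrite ge_min lexx.
have tc : t * c <= e by rewrite -ler_pdivlMr// ge_min lexx orbT.
have := H2 t t0.
rewrite [t ^+ 2 * (_ * _)](_ : _ =
  t * (t * (s ^+ 2 / 2 * expR (t ^+ 2 * s ^+ 2 / 2)))); last by ring.
rewrite ler_pM2l// => /le_trans; apply.
apply: le_trans tc; rewrite ler_wpM2l ?(ltW t0)// /c ler_wpM2l ?divr_ge0 ?(ltW s20)//.
rewrite ler_expR -mulrA ler_piMl ?divr_ge0 ?(ltW s20)//.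
by rewrite exprn_ile1// ltW.
Qed.

End NormalMoments.

(** * Means of products of independent variables *)

Section IndependentProduct.
Context {R : realType} {d : measure_display} {T : measurableType d}.
Variables (P : probability T R) (U V : {mfun T >-> R}).
Hypothesis UV : forall A C : set R, measurable A -> measurable C ->
  P ((U @^-1` A) `&` (V @^-1` C)) = (P (U @^-1` A) * P (V @^-1` C))%E.
Hypothesis iU : P.-integrable setT (EFin \o U).
Hypothesis iV : P.-integrable setT (EFin \o V).

Let pairUV (w : T) : R * R := (U w, V w).

Let measurable_pairUV : measurable_fun setT pairUV.
Proof. exact: measurable_fun_pair. Qed.

HB.instance Definition _ :=
  isMeasurableFun.Build _ _ _ _ pairUV measurable_pairUV.

Let mu := distribution P U.
Let nu := distribution P V.
Let pi := distribution P pairUV.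
Let prodf (z : R * R) : \bar R := (z.1 * z.2)%:E.

Let piE (X : set (R * R)) : measurable X -> (mu \x nu)%E X = pi X.
Proof. by move=> mX; apply: product_measure_unique => // A C mA mC; exact: UV. Qed.

Let m_prodf : measurable_fun setT prodf.
Proof.
apply/measurable_EFinP; apply: measurable_funM.
  exact: measurable_fst.
exact: measurable_snd.
Qed.

Let int_mu (f : R -> \bar R) : measurable_fun setT f ->
  P.-integrable setT (f \o U) ->
  (\int[mu]_x f x = \int[P]_w f (U w))%E.
Proof. by move=> mf fi; rewrite /mu integral_distribution. Qed.

Let int_nu (f : R -> \bar R) : measurable_fun setT f ->
  P.-integrable setT (f \o V) ->
  (\int[nu]_x f x = \int[P]_w f (V w))%E.
Proof. by move=> mf fi; rewrite /nu integral_distribution. Qed.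

Let fin_int (f : T -> R) : P.-integrable setT (EFin \o f) ->
  (\int[P]_w (f w)%:E = (\int[P]_w f w)%R%:E)%E.
Proof. by move=> fi; rewrite /Rintegral fineK//; exact: integrable_fin_num. Qed.

Let integrable_prodf : (mu \x nu)%E.-integrable setT prodf.
Proof.
apply/integrable12ltyP => //.
have E x : (\int[nu]_y `|prodf (x, y)| = `|x|%:E * \int[nu]_y `|y|%:E)%E.
  rewrite -ge0_integralZl//.
  - by apply: eq_integral => y _; rewrite /prodf /= -EFinM normrM.
  - by apply/measurable_EFinP; exact: normr_measurable.
under eq_integral do rewrite E.
have iaU : P.-integrable setT ((EFin \o Num.norm) \o U) := integrable_abse iU.
have iaV : P.-integrable setT ((EFin \o Num.norm) \o V) := integrable_abse iV.
have mn : measurable_fun [set: R] (EFin \o (Num.norm : R -> R)).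
  by apply/measurable_EFinP; exact: normr_measurable.
rewrite (int_nu mn)// (fin_int (f := fun w => `|V w|))//.
rewrite ge0_integralZr//; last first.
  by rewrite lee_fin Rintegral_ge0.
rewrite (int_mu mn)// (fin_int (f := fun w => `|U w|))//.
by rewrite -EFinM ltry.
Qed.

Lemma independent_integrable : P.-integrable setT (fun w => (U w * V w)%:E).
Proof.
have : pi.-integrable setT prodf.
  apply/integrableP; split => //.
  rewrite (eq_measure_integral (mu \x nu)%E); last by move=> A mA _; exact/esym/piE.
  by case/integrableP: integrable_prodf.
move=> /integrableP[_]; rewrite /pi ge0_integral_distribution//; last first.
  exact: measurableT_comp.
move=> fin; apply/integrableP; split => //.
by apply/measurable_EFinP; exact: measurable_funM.
Qed.

(** By the product rule the law of the pair [(U, V)] is the product of the two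
    laws, and Fubini's theorem applies. *)
Lemma independent_Rintegral :
  \int[P]_w (U w * V w) = (\int[P]_w U w) * (\int[P]_w V w).
Proof.
rewrite /Rintegral.
transitivity (fine (\int[pi]_z prodf z)).
  rewrite /pi integral_distribution//.
  exact: independent_integrable.
rewrite (eq_measure_integral (mu \x nu)%E); last by move=> A mA _; exact/esym/piE.
rewrite -(integral12_prod_meas1 integrable_prodf).
have mE : measurable_fun [set: R] (EFin : R -> \bar R).
  by apply/measurable_EFinP; exact: measurable_id.
have iV' : nu.-integrable setT (fun y : R => y%:E).
  by apply: integrable_pushforward => //; exact: mE.
rewrite (eq_integral (fun x : R => x%:E * (\int[P]_w V w)%:E)%E); last first.
  move=> x _; rewrite /fubini_F.
  under eq_integral do rewrite /prodf /= EFinM.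
  by rewrite integralZl// (int_nu (f := EFin))// fin_int.
rewrite integralZr//; last by apply: integrable_pushforward => //; exact: mE.
by rewrite (int_mu (f := EFin))// fin_int// -EFinM.
Qed.

End IndependentProduct.

(** * Independence of Brownian increments from the past *)

Section PiLambda.
Context {R : realType} {d : measure_display} {T : measurableType d}.
Variable P : probability T R.

(** [A |-> P (A `&` C)] and [P C] times [P] are finite measures that agree on a
    pi-system. *)
Lemma independent_pi_lambda (G : set (set T)) (C : set T) :
  G `<=` measurable -> G setT -> setI_closed G -> measurable C ->
  (forall A, G A -> P (A `&` C) = (P A * P C)%E) ->
  forall A, <<s G >> A -> P (A `&` C) = (P A * P C)%E.
Proof.
move=> Gm GT GI mC GC A sA.
have PC0 : 0 <= fine (P C) by rewrite fine_ge0.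
have PCE : (fine (P C))%:E = P C by rewrite fineK// fin_num_measure.
pose m2 := mscale (NngNum PC0) P.
have m2E X : m2 X = (P X * P C)%E.
  by rewrite -[in RHS]PCE muleC.
rewrite -m2E.
apply: (@g_sigma_algebra_measure_unique _ _ _ G Gm (fun=> setT) (fun=> GT) _
  (mrestr P mC) m2 GI) => //.
- by rewrite bigcup_const.
- by move=> X GX; rewrite [RHS]m2E; exact: GC.
- move=> _; apply: (@le_lt_trans _ _ 1%E); last exact: ltry.
  by apply: probability_le1; rewrite setTI.
Qed.

End PiLambda.

Section SigmaOf.
Context {R : realType} {d : measure_display} {T : measurableType d}.
Implicit Types (I : Type) (F : set (set T)).

Definition F_measurable F (f : T -> R) :=
  forall A : set R, measurable A -> F (f @^-1` A).

Lemma F_measurableP (G : set (set T)) (f : T -> R) :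
  F_measurable <<s G >> f <->
  measurable_fun setT (f : g_sigma_algebraType G -> R).
Proof.
split=> [H _ A mA|H A mA]; first by rewrite setTI; exact: H.
by have := H measurableT A mA; rewrite setTI.
Qed.

Lemma F_measurableB (G : set (set T)) (f g : T -> R) :
  F_measurable <<s G >> f -> F_measurable <<s G >> g ->
  F_measurable <<s G >> (fun w => f w - g w).
Proof.
by move=> /F_measurableP mf /F_measurableP mg; apply/F_measurableP; exact: measurable_funB.
Qed.

Lemma sigma_of_measurable I (J : set I) (X : I -> T -> R) i :
  J i -> F_measurable (sigma_of J X) (X i).
Proof.
move=> Ji A mA; apply: sub_gen_smallest; exists i => //.
by exists A => //; rewrite setTI.
Qed.

Lemma sigma_of_sub I (J : set I) (X : I -> T -> R) (F : set (set T)) :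
  sigma_algebra setT F -> (forall i, J i -> F_measurable F (X i)) ->
  sigma_of J X `<=` F.
Proof.
move=> sF H; apply: smallest_sub => // A [i Ji [C mC <-]].
by rewrite setTI; exact: H.
Qed.

Lemma sigma_of_setT I (J : set I) (X : I -> T -> R) : sigma_of J X setT.
Proof. exact: (@measurableT _ (g_sigma_algebraType _)). Qed.

Lemma sigma_of_setI I (J : set I) (X : I -> T -> R) : setI_closed (sigma_of J X).
Proof. by move=> A C; exact: (@measurableI _ (g_sigma_algebraType _)). Qed.

End SigmaOf.

Section BrownianIncrements.
Context {R : realType} {d : measure_display} {T : measurableType d}.
Variables (P : probability T R) (N : nat) (B : 'I_N -> R -> T -> R).
Hypothesis hB : independent_brownian_motions P B.

Definition increment (s t : R) (j : 'I_N) (w : T) : R := B j t w - B j s w.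

Let mB j t : 0 <= t -> measurable_fun setT (B j t).
Proof. by move=> t0; case: hB => /(_ j)[H _ _ _ _] _; exact: H. Qed.

Lemma measurable_increment s t j : 0 <= s -> s <= t ->
  measurable_fun setT (increment s t j).
Proof. by move=> s0 st; apply: measurable_funB; apply: mB => //; exact: le_trans st. Qed.

(** The joint past at time [s] is enlarged by the whole history of the motions
    other than the [j]-th.  Products of a past variable with an increment of
    another motion are then part of the past as well, as needed for
    [mean_cross_noise]. *)
Definition past_index (j : 'I_N) (s : R) (k : 'I_N) : set R :=
  if k == j then `[0, s]%classic else `[0, +oo[%classic.

Definition past_rectangles (j : 'I_N) (s : R) : set (set T) :=
  [set A | exists A_ : 'I_N -> set T,
    (forall k, sigma_of (past_index j s k) (B k) (A_ k)) /\
    A = \bigcap_(k in [set: 'I_N]) A_ k].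

Definition enlarged_past j s : set (set T) := <<s past_rectangles j s >>.

Lemma past_index_ge0 j s k r : past_index j s k r -> 0 <= r.
Proof.
rewrite /past_index; case: ifP => _ /=.
  by rewrite in_itv/= => /andP[].
by rewrite in_itv/= andbT.
Qed.

Lemma sigma_of_measurable_set j s k A :
  sigma_of (past_index j s k) (B k) A -> measurable A.
Proof.
move: A; apply: sigma_of_sub; first exact: sigma_algebra_measurable.
move=> r /past_index_ge0 r0 A mA.
by have := mB k r0 measurableT mA; rewrite setTI.
Qed.

Lemma enlarged_past_measurable j s (k : 'I_N) r : past_index j s k r ->
  F_measurable (enlarged_past j s) (B k r).
Proof.
move=> kr A mA; apply: sub_gen_smallest.
exists (fun l => if l == k then B k r @^-1` A else setT); split.
  move=> l; case: eqP => [->|_]; last exact: sigma_of_setT.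
  exact: (sigma_of_measurable kr).
apply/seteqP; split => [w Aw l _|w /(_ k I)]; last by rewrite eqxx.
by case: ifP.
Qed.

Lemma enlarged_past_sub j s : enlarged_past j s `<=` measurable.
Proof.
apply: smallest_sub; first exact: sigma_algebra_measurable.
move=> _ [A_ [HA ->]]; apply: fin_bigcap_measurable => //.
by move=> k _; exact: sigma_of_measurable_set (HA k).
Qed.

(** On a rectangle, the event on the increment is merged with the [j]-th factor;
    mutual independence splits the intersection into its factors, and the
    independence of the increments of a single motion splits the [j]-th one.
    Rectangles form a pi-system. *)
Lemma enlarged_past_increment j s t (f : T -> R) (A C : set R) :
  0 <= s -> s < t -> F_measurable (enlarged_past j s) f ->
  measurable A -> measurable C ->
  P ((f @^-1` A) `&` (increment s t j @^-1` C))
  = (P (f @^-1` A) * P (increment s t j @^-1` C))%E.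
Proof.
move=> s0 st fm mA mC.
have t0 : 0 <= t by rewrite (le_trans s0)// ltW.
have incC : sigma_of `[0, +oo[ (B j) (increment s t j @^-1` C).
  have m r : 0 <= r -> F_measurable (sigma_of `[0, +oo[ (B j)) (B j r).
    by move=> r0; apply: sigma_of_measurable; rewrite /= in_itv/= r0.
  exact: (F_measurableB (m t t0) (m s s0)).
have mincC : measurable (increment s t j @^-1` C).
  by have := measurable_increment j s0 (ltW st) measurableT mC; rewrite setTI.
have sub_idx k : sigma_of (past_index j s k) (B k) `<=` sigma_of `[0, +oo[ (B k).
  apply: sigma_of_sub; first exact: smallest_sigma_algebra.
  move=> r /past_index_ge0 r0; apply: sigma_of_measurable.
  by rewrite /= in_itv/= r0.
apply: (independent_pi_lambda (G := past_rectangles j s)) => //.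
- by move=> X GX; apply: (@enlarged_past_sub j s); exact: sub_gen_smallest.
- exists (fun=> setT); split; first by move=> k; exact: sigma_of_setT.
  by apply/seteqP; split.
- move=> _ _ [A1 [H1 ->]] [A2 [H2 ->]]; exists (fun k => A1 k `&` A2 k).
  split; first by move=> k; apply: sigma_of_setI; [exact: H1|exact: H2].
  by rewrite bigcapI.
- move=> _ [A_ [HA ->]].
  have [hB1 hB2] := hB.
  have [_ _ hind _ _] := hB1 j.
  pose A' k := if k == j then A_ k `&` (increment s t j @^-1` C) else A_ k.
  have -> : (\bigcap_(k in [set: 'I_N]) A_ k) `&` (increment s t j @^-1` C)
      = \bigcap_(k in [set: 'I_N]) A' k.
    apply/seteqP; split => [w [Aw Cw] k _|w H].
      by rewrite /A'; case: ifP => // _; [split|]; [exact: Aw| |exact: Aw].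
    split=> [k _|]; last by have := H j I; rewrite /A' eqxx => -[].
    by have := H k I; rewrite /A'; case: ifP => // _ [].
  rewrite hB2; last first.
    move=> k; rewrite /A'; case: eqP => [->|_]; last exact: sub_idx.
    by apply: sigma_of_setI => //; exact: sub_idx.
  rewrite hB2; last by move=> k; exact: sub_idx.
  rewrite (bigD1 j)//= [in RHS](bigD1 j)//= /A' eqxx.
  rewrite (hind s t s0 st); last 2 first.
  - by have := HA j; rewrite /past_index eqxx.
  - exact: (sigma_of_measurable (J := [set: unit]) (X := fun _ => increment s t j) (i := tt)).
  rewrite (eq_bigr (fun k => P (A_ k))); last by move=> k /negbTE ->.
  by rewrite -!muleA; congr (_ * _)%E; rewrite muleC.
- exact: fm.
Qed.

Lemma increment_law s t j (A : set (measurableTypeR R)) : 0 <= s -> s < t ->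
  measurable A ->
  P (increment s t j @^-1` A) = normal_prob 0 (Num.sqrt (t - s)) A.
Proof. by move=> s0 st mA; case: hB => /(_ j)[_ _ _ H _] _; exact: H. Qed.

End BrownianIncrements.

(** * Measurability of the Euler scheme *)

Section Measurability.
Context {R : realType} {d : measure_display} {T : measurableType d} {N : nat}.
Implicit Types (x : T -> 'I_N -> R).

Lemma measurable_forall_ord (p : 'I_N -> T -> bool) :
  (forall i, measurable_fun setT (p i)) ->
  measurable_fun setT (fun w => [forall i, p i w]).
Proof.
move=> mp; apply: (measurable_fun_bool true); rewrite setTI.
rewrite (_ : _ @^-1` _ = \bigcap_(i in [set: 'I_N]) (p i @^-1` [set true])).
  by apply: fin_bigcap_measurable => // i _; rewrite -[X in measurable X]setTI; exact: mp.
apply/seteqP; split => w /=.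
  by move=> /forallP H i _ /=; exact: H.
by move=> H; apply/forallP => i; exact: H.
Qed.

Section Coordinates.
Variable x : T -> 'I_N -> R.
Hypothesis mx : forall i, measurable_fun setT (fun w => x w i).
Variables (a eps sg h : R).
Hypothesis eps0 : 0 < eps.

Lemma measurable_trinv_gap i j :
  measurable_fun setT (fun w => trinv eps (x w i - x w j)).
Proof.
apply: measurableT_comp; first exact: measurable_trinv.
exact: measurable_funB.
Qed.

Lemma measurable_trdrift i : measurable_fun setT (fun w => trdrift a eps (x w) i).
Proof.
apply: measurable_funM => //.
under eq_fun do rewrite big_mkcond.
apply: measurable_sum => j; case: (j != i) => //=; exact: measurable_trinv_gap.
Qed.

Lemma measurable_safe : measurable_fun setT (fun w => safe eps (x w)).
Proof.
apply: measurable_and.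
  apply: measurable_forall_ord => i; apply: measurable_fun_ler => //.
  exact: measurableT_comp.
apply: measurable_forall_ord => i; apply: measurable_forall_ord => j.
case: (j != i) => /=; last exact: measurable_cst.
apply: measurable_fun_ler => //; apply: measurableT_comp => //.
exact: measurable_funB.
Qed.

Lemma measurable_lin_coef i j :
  measurable_fun setT (fun w => lin_coef eps a sg h (x w) i j).
Proof.
have mt := measurable_trinv_gap i j; have md := measurable_trdrift.
rewrite /lin_coef; apply: measurable_funD; [apply: measurable_funD|].
- by apply: measurable_funM => //; exact: measurableT_comp.
- apply: measurable_funM => //; apply: measurable_funM.
    by apply: measurable_funM => //; exact: measurable_funX.
  exact: measurable_funB.
- apply: measurable_funM => //; apply: measurable_funM => //.
  by apply: measurable_funD => //; exact: measurable_funM.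
Qed.

Lemma measurable_sq_coef i j :
  measurable_fun setT (fun w => sq_coef eps sg (x w) i j).
Proof.
have mt := measurable_trinv_gap i j.
apply: measurable_funD => //; apply: measurable_funM => //.
by apply: measurable_funM => //; exact: measurable_funX.
Qed.

Lemma measurable_cross_coef i j :
  measurable_fun setT (fun w => cross_coef eps sg (x w) i j).
Proof.
have mt := measurable_trinv_gap i j.
by apply: measurable_funM => //; exact: measurable_funX.
Qed.

Lemma measurable_lyapunov : measurable_fun setT (fun w => lyapunov eps (x w)).
Proof.
apply: measurable_sum => i; under eq_fun do rewrite big_mkcond.
apply: measurable_sum => j; case: (j != i) => //=; rewrite /pairpot /logpot.
apply: measurable_funD; last exact: measurable_funX.
apply: measurable_funD; last exact: measurable_funX.
apply: measurable_funD => //; apply: measurableT_comp => //.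
apply: measurableT_comp; first exact: measurable_ln.
apply: measurable_maxr => //.
by apply: measurableT_comp => //; exact: measurable_funB.
Qed.

End Coordinates.

Lemma measurable_euler_node a eps (w : T -> R -> 'I_N -> R) (x0 : 'I_N -> R)
    (h : R) k : 0 < eps ->
  (forall l i, (l <= k)%N -> measurable_fun setT (fun om => w om (l%:R * h) i)) ->
  forall i, measurable_fun setT
    (fun om => euler_node (trdrift a eps) (w om) x0 h k i).
Proof.
move=> e0; elim: k => [|k IH] mw i; first exact: measurable_cst.
have {}IH : forall i, measurable_fun setT
    (fun om => euler_node (trdrift a eps) (w om) x0 h k i).
  by apply: IH => l j lk; apply: mw; exact: leqW.
rewrite /=; apply: measurable_funD.
  apply: measurable_funD => //; apply: measurable_funM => //.
  exact: measurable_trdrift.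
by apply: measurable_funB; apply: mw.
Qed.

End Measurability.

(** * Means of the noise terms *)

Section NonpositiveMean.
Context {R : realType} {d : measure_display} {T : measurableType d}.
Variable P : probability T R.

Definition nonpos_mean (f : T -> R) :=
  P.-integrable setT (EFin \o f) /\ \int[P]_w f w <= 0.

Lemma nonpos_mean0 : nonpos_mean (fun=> 0).
Proof.
split; last by rewrite Rintegral_cst// mul0r.
exact: (integrable_cst P 0).
Qed.

Lemma nonpos_meanD f g : nonpos_mean f -> nonpos_mean g ->
  nonpos_mean (fun w => f w + g w).
Proof.
move=> [fi f0] [gi g0]; split.
  exact: (integrableD measurableT fi gi).
by rewrite RintegralD//; lra.
Qed.

Lemma nonpos_meanZ (c : R) (f : T -> R) : 0 <= c -> nonpos_mean f ->
  nonpos_mean (fun om => c * f om).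
Proof.
move=> c0 [fi f0]; split; first exact: (integrableZl measurableT c fi).
by rewrite RintegralZl// mulr_ge0_le0.
Qed.

Lemma nonpos_mean_sum (I : eqType) (r : seq I) (Q : pred I) (f : I -> T -> R) :
  (forall i, Q i -> nonpos_mean (f i)) ->
  nonpos_mean (fun w => \sum_(i <- r | Q i) f i w).
Proof.
move=> H; elim: r => [|i r IH].
  by under eq_fun do rewrite big_nil; exact: nonpos_mean0.
under eq_fun do rewrite big_cons.
case Qi : (Q i) => //.
by apply: nonpos_meanD => //; exact: H.
Qed.

Lemma bounded_integrable (Z : T -> R) (M : R) : measurable_fun setT Z ->
  (forall w, `|Z w| <= M) -> P.-integrable setT (EFin \o Z).
Proof.
move=> mZ ZM; apply: measurable_bounded_integrable => //.
  by apply: (@le_lt_trans _ _ 1%E); [exact: probability_le1|exact: ltry].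
exists M; split; first exact: num_real.
by move=> x Mx w _ /=; rewrite (le_trans (ZM w))// ltW.
Qed.

End NonpositiveMean.

Section NoiseMeans.
Context {R : realType} {d : measure_display} {T : measurableType d}.
Variables (P : probability T R) (N : nat) (B : 'I_N -> R -> T -> R).
Hypothesis hB : independent_brownian_motions P B.
Variables (s t : R).
Hypotheses (s0 : 0 <= s) (st : s < t).

Notation xi := (increment B s t).

Definition bounded_past j (Z : T -> R) :=
  F_measurable (enlarged_past B j s) Z /\ exists M : R, forall w, `|Z w| <= M.

Lemma F_measurable_measurable j (Z : T -> R) :
  F_measurable (enlarged_past B j s) Z -> measurable_fun setT Z.
Proof.
move=> HZ _ A mA; rewrite setTI; exact: (enlarged_past_sub hB (HZ A mA)).
Qed.

Let mxi j : measurable_fun setT (xi j).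
Proof. exact: (measurable_increment hB j s0 (ltW st)). Qed.

Let sd0 : 0 < Num.sqrt (t - s).
Proof. by rewrite sqrtr_gt0 subr_gt0. Qed.

Let law j (A : set (measurableTypeR R)) : measurable A ->
  P (xi j @^-1` A) = normal_prob 0 (Num.sqrt (t - s)) A.
Proof. exact: increment_law. Qed.

Let sdE : Num.sqrt (t - s) ^+ 2 = t - s.
Proof. by rewrite sqr_sqrtr// subr_ge0 ltW. Qed.

Let ixi j : P.-integrable setT (EFin \o xi j).
Proof. exact: (normal_integrable1 (mxi j) sd0 (@law j)). Qed.

Let ixi2 j : P.-integrable setT (EFin \o (fun w => xi j w ^+ 2)).
Proof. exact: (normal_integrable2 (mxi j) sd0 (@law j)). Qed.

Lemma increment_integrable4 j : P.-integrable setT (EFin \o (fun w => xi j w ^+ 4)).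
Proof. exact: (normal_integrable4 (mxi j) sd0 (@law j)). Qed.

Lemma increment_moment4 j :
  \int[P]_w (xi j w ^+ 4) <= 48 * expR 2^-1 * (t - s) ^+ 2.
Proof.
have := normal_moment4 (mxi j) sd0 (@law j).
by rewrite (_ : Num.sqrt (t - s) ^+ 4 = (t - s) ^+ 2)// -[in RHS]sdE -exprM.
Qed.

Lemma past_times_function j (Z : T -> R) (phi : R -> R) :
  F_measurable (enlarged_past B j s) Z -> P.-integrable setT (EFin \o Z) ->
  measurable_fun setT phi -> P.-integrable setT (EFin \o (fun w => phi (xi j w))) ->
  P.-integrable setT (EFin \o (fun w => Z w * phi (xi j w))) /\
  \int[P]_w (Z w * phi (xi j w)) = (\int[P]_w Z w) * \int[P]_w phi (xi j w).
Proof.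
move=> HZ iZ mphi iphi.
have mZ := F_measurable_measurable HZ.
have mp : measurable_fun setT (phi \o xi j) by exact: measurableT_comp.
pose U : {mfun T >-> R} := HB.pack Z (isMeasurableFun.Build _ _ _ _ Z mZ).
pose W : {mfun T >-> R} :=
  HB.pack (phi \o xi j) (isMeasurableFun.Build _ _ _ _ (phi \o xi j) mp).
have ind (A C : set R) : measurable A -> measurable C ->
    P ((U @^-1` A) `&` (W @^-1` C)) = (P (U @^-1` A) * P (W @^-1` C))%E.
  move=> mA mC; apply: (enlarged_past_increment hB (A := A) (C := phi @^-1` C)) => //.
  by rewrite -[X in measurable X]setTI; exact: mphi.
split; first exact: (@independent_integrable _ _ _ P U W ind iZ iphi).
exact: (@independent_Rintegral _ _ _ P U W ind iZ iphi).
Qed.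

Lemma bounded_past_integrable j Z : bounded_past j Z -> P.-integrable setT (EFin \o Z).
Proof.
move=> [HZ [M ZM]]; exact: (bounded_integrable P (F_measurable_measurable HZ) ZM).
Qed.

Lemma mean_lin_noise j Z : bounded_past j Z -> nonpos_mean P (fun w => Z w * xi j w).
Proof.
move=> bZ; have iZ := bounded_past_integrable bZ.
have [H1 H2] := past_times_function (phi := id) (proj1 bZ) iZ (@measurable_id _ _ _) (ixi j).
split => //; rewrite H2.
by rewrite (normal_moment1 (mxi j) sd0 (@law j)) mulr0.
Qed.

Lemma mean_sq_noise j Z : bounded_past j Z -> (forall w, 0 <= Z w) ->
  nonpos_mean P (fun w => Z w * (xi j w ^+ 2 - (t - s))).
Proof.
move=> bZ Z0; have iZ := bounded_past_integrable bZ.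
have mphi : measurable_fun setT (fun r : R => r ^+ 2) by exact: measurable_funX.
have [H1 H2] := past_times_function (phi := fun r => r ^+ 2) (proj1 bZ) iZ mphi (ixi2 j).
have iZt : P.-integrable setT (EFin \o (fun w => (t - s) * Z w)).
  exact: (integrableZl measurableT (t - s) iZ).
have E w : Z w * (xi j w ^+ 2 - (t - s)) = Z w * xi j w ^+ 2 - (t - s) * Z w.
  by ring.
split.
  have := integrableB measurableT H1 iZt; congr (integrable _ _ _).
  by apply/funext => w /=; rewrite -EFinB E.
under eq_Rintegral do rewrite E.
rewrite RintegralB// H2 RintegralZl// mulrC -mulrBl.
rewrite mulr_le0_ge0//; last exact: Rintegral_ge0.
have := normal_moment2 (mxi j) sd0 (@law j); rewrite sdE; lra.
Qed.

(** [Z * xi i] belongs to the past enlarged for [j], and [xi j] is centred. *)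
Lemma mean_cross_noise i j Z : i != j -> bounded_past i Z -> bounded_past j Z ->
  nonpos_mean P (fun w => Z w * (xi i w * xi j w)).
Proof.
move=> ij biZ bjZ; have iZ := bounded_past_integrable biZ.
have [H1 _] := past_times_function (phi := id) (proj1 biZ) iZ (@measurable_id _ _ _) (ixi i).
have t0 : 0 <= t by rewrite (le_trans s0)// ltW.
have past r : 0 <= r -> F_measurable (enlarged_past B j s) (B i r).
  move=> r0; apply: enlarged_past_measurable.
  by rewrite /past_index (negbTE ij) /= in_itv/= r0.
have HZi : F_measurable (enlarged_past B j s) (fun w => Z w * xi i w).
  apply/F_measurableP; apply: measurable_funM; first by apply/F_measurableP; exact: (proj1 bjZ).
  by apply: measurable_funB; apply/F_measurableP; exact: past.
have [H3 H4] := past_times_function (phi := id) HZi H1 (@measurable_id _ _ _) (ixi j).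
split.
  by under eq_fun do rewrite mulrA.
under eq_Rintegral do rewrite mulrA.
by rewrite H4 (normal_moment1 (mxi j) sd0 (@law j)) mulr0.
Qed.

End NoiseMeans.

(** * Mean energy of the Euler scheme *)

Section EulerChain.
Context {R : realType} {d : measure_display} {T : measurableType d} {N : nat}.
Variables (B : 'I_N -> R -> T -> R) (x0 : 'I_N -> R) (a sg eps : R).

Definition driving_noise (om : T) (t : R) (i : 'I_N) : R := sg * (B i t om - B i 0 om).

Definition chain n l om : 'I_N -> R :=
  euler_node (trdrift a eps) (driving_noise om) x0 (euler_step n) l.

Fixpoint alive n l om : bool :=
  if l is l'.+1 then alive n l' om && safe eps (chain n l om) else safe eps x0.

(** Stopped at the exit from the safe region, with the value [- ln eps] that the
    Lyapunov function reaches there: dead chains then weigh exactly what Markov's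
    inequality requires. *)
Definition energy n l om : R :=
  if alive n l om then lyapunov eps (chain n l om) else - ln eps.

(** Stopping turns off the coefficients of the noise, which are bounded because
    they are only evaluated in the safe region. *)
Definition gated n l (f : ('I_N -> R) -> R) om : R :=
  if alive n l om then f (chain n l om) else 0.

Lemma alive_safe n l om : alive n l om -> safe eps (chain n l om).
Proof. by case: l => [|l] //= /andP[]. Qed.

Lemma aliveW n l l' om : (l <= l')%N -> alive n l' om -> alive n l om.
Proof.
elim: l' => [|l' IH]; first by rewrite leqn0 => /eqP ->.
by rewrite leq_eqVlt => /predU1P[->//|ll'] /= /andP[/IH + _]; apply.
Qed.

Lemma chainS n l om : chain n l.+1 om = fun i => chain n l om i
  + euler_step n * trdrift a eps (chain n l om) i
  + sg * increment B (l%:R * euler_step n) (l.+1%:R * euler_step n) i om.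
Proof.
by apply/funext => i; rewrite /chain /= /driving_noise /increment; ring.
Qed.

End EulerChain.

Section ChainMeasurability.
Context {R : realType} {d : measure_display} {T : measurableType d} {N : nat}.
Variables (B : 'I_N -> R -> T -> R) (x0 : 'I_N -> R) (a sg eps : R).
Hypothesis eps0 : 0 < eps.

Lemma measurable_chain n l :
  (forall u i, 0 <= u -> u <= l%:R * euler_step n -> measurable_fun setT (B i u)) ->
  forall i, measurable_fun setT (fun om => chain B x0 a sg eps n l om i).
Proof.
move=> mB; apply: measurable_euler_node => // l' i l'l.
have h0 : 0 <= euler_step n :> R by rewrite ltW// euler_step_gt0.
apply: measurable_funM => //; apply: measurable_funB; apply: mB => //.
- by rewrite mulr_ge0.
- by rewrite ler_wpM2r// ler_nat.
- by rewrite mulr_ge0.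
Qed.

Lemma measurable_alive n l :
  (forall u i, 0 <= u -> u <= l%:R * euler_step n -> measurable_fun setT (B i u)) ->
  measurable_fun setT (alive B x0 a sg eps n l).
Proof.
elim: l => [|l IH] mB /=; first exact: measurable_cst.
apply: measurable_and.
  apply: IH => u i u0 ul; apply: mB => //; apply: le_trans ul _.
  by rewrite ler_wpM2r// ?ler_nat// ltW// euler_step_gt0.
by apply: measurable_safe => // i; exact: measurable_chain.
Qed.

Lemma measurable_gated n l f :
  (forall u i, 0 <= u -> u <= l%:R * euler_step n -> measurable_fun setT (B i u)) ->
  (forall x : T -> 'I_N -> R, (forall i, measurable_fun setT (fun w => x w i)) ->
    measurable_fun setT (fun w => f (x w))) ->
  measurable_fun setT (gated B x0 a sg eps n l f).
Proof.
move=> mB mf; apply: measurable_fun_ifT => //; first exact: measurable_alive.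
by apply: mf; exact: measurable_chain.
Qed.

End ChainMeasurability.

Section EnergyEstimate.
Context {R : realType} {d : measure_display} {T : measurableType d}.
Variables (P : probability T R) (N : nat) (B : 'I_N -> R -> T -> R).
Hypothesis hB : independent_brownian_motions P B.
Variables (x0 : 'I_N -> R) (a sg eps : R).
Hypotheses (N2 : (2 <= N)%N) (a0 : 0 <= a) (sga : sg ^+ 2 <= 2 * a).
Hypotheses (eps0 : 0 < eps) (eps1 : eps <= 1).

Notation chain := (chain B x0 a sg eps).
Notation alive := (alive B x0 a sg eps).
Notation energy := (energy B x0 a sg eps).
Notation gated := (gated B x0 a sg eps).

Let mB u i : 0 <= u -> measurable_fun setT (B i u).
Proof. by move=> u0; case: hB => /(_ i)[H _ _ _ _] _; exact: H. Qed.

Lemma lyapunov_safe_bound (x : 'I_N -> R) : safe eps x ->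
  lyapunov eps x <= N%:R * (N%:R * (- ln eps + 1 + 2 * eps^-1 ^+ 2)).
Proof.
move=> sx.
have ln0 : 0 <= - ln eps by rewrite oppr_ge0 ln_le0.
have c0 : 0 <= - ln eps + 1 + 2 * eps^-1 ^+ 2.
  by rewrite !addr_ge0// mulr_ge0// sqr_ge0.
apply: ler_sum_cst => [|i _]; first by rewrite mulr_ge0.
apply: ler_sum_cst => // j _.
have sq k : x k ^+ 2 <= eps^-1 ^+ 2.
  rewrite -[leLHS]real_normK ?num_real// lerXn2r ?nnegrE ?invr_ge0 ?(ltW eps0)//.
  exact: safe_bound.
have : ln eps <= ln (Num.max `|x i - x j| eps).
  by rewrite ler_ln ?posrE ?lt_max ?eps0 ?orbT// le_max lexx orbT.
rewrite /pairpot /logpot; have := sq i; have := sq j; lra.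
Qed.

Lemma energy_ge0 n l om : 0 <= energy n l om.
Proof.
rewrite /energy; case: ifP => _; first exact: lyapunov_ge0.
by rewrite oppr_ge0 ln_le0.
Qed.

Lemma energy_integrable n l : P.-integrable setT (EFin \o energy n l).
Proof.
have ln0 : 0 <= - ln eps by rewrite oppr_ge0 ln_le0.
set c := N%:R * (N%:R * (- ln eps + 1 + 2 * eps^-1 ^+ 2)).
apply: (bounded_integrable P (M := Num.max c (- ln eps))).
  have mBl u i : 0 <= u -> u <= l%:R * euler_step n -> measurable_fun setT (B i u).
    by move=> u0 _; exact: mB.
  apply: measurable_fun_ifT => //; first exact: measurable_alive.
  by apply: measurable_lyapunov => // i; exact: measurable_chain.
move=> om; rewrite ger0_norm ?energy_ge0// /energy le_max.
case: ifP => [/alive_safe sx|_]; last by rewrite lexx orbT.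
by rewrite lyapunov_safe_bound.
Qed.

Lemma gated_bounded_past n l (f : ('I_N -> R) -> R) (j : 'I_N) :
  (forall (d' : measure_display) (T' : measurableType d') (x : T' -> 'I_N -> R),
    (forall i, measurable_fun setT (fun w => x w i)) ->
    measurable_fun setT (fun w => f (x w))) ->
  (exists M : R, forall x : 'I_N -> R, safe eps x -> `|f x| <= M) ->
  bounded_past B (l%:R * euler_step n) j (gated n l f).
Proof.
move=> mf [M fM]; split.
  apply/F_measurableP; apply: measurable_gated => //; last exact: mf.
  move=> u i u0 ul; apply/F_measurableP; apply: enlarged_past_measurable.
  by rewrite /past_index; case: ifP => _ /=; rewrite in_itv/= u0.
exists `|M| => om; rewrite /gated; case: ifP => [/alive_safe/fM|_]; last by rewrite normr0.
by move=> /le_trans; apply; exact: ler_norm.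
Qed.

Lemma lin_coef_bounded (h : R) (i j : 'I_N) :
  exists M : R, forall x : 'I_N -> R, safe eps x -> `|lin_coef eps a sg h x i j| <= M.
Proof.
pose C := a * (N%:R * eps^-1).
exists (eps^-1 * `|sg| + eps^-1 ^+ 2 * `|h| * (C + C) * `|sg|
  + 2 * (eps^-1 + `|h| * C) * `|sg|) => x sx.
have f1 : `|trinv eps (x i - x j)| <= eps^-1 by exact: trinv_bound.
have b k : `|trdrift a eps x k| <= C by exact: trdrift_bound.
have xb := safe_bound i sx.
rewrite /lin_coef.
apply: le_trans (ler_normD _ _) _; apply: lerD.
  apply: le_trans (ler_normD _ _) _; apply: lerD.
    by rewrite normrM normrN ler_wpM2r.
  have f2 : `|trinv eps (x i - x j) ^+ 2 * h| <= eps^-1 ^+ 2 * `|h|.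
    rewrite normrM ler_wpM2r// normrX.
    by rewrite lerXn2r ?nnegrE ?invr_ge0 ?(ltW eps0).
  rewrite [leLHS]normrM [X in X * _]normrM; apply: ler_wpM2r => //.
  apply: ler_pM => //.
  by apply: le_trans (ler_normB _ _) _; apply: lerD.
rewrite !normrM; apply: ler_wpM2r => //.
rewrite ger0_norm//; apply: ler_wpM2l => //.
by apply: le_trans (ler_normD _ _) _; apply: lerD => //; rewrite normrM ler_wpM2l.
Qed.

Lemma sq_coef_bounded (i j : 'I_N) :
  exists M : R, forall x : 'I_N -> R, safe eps x -> `|sq_coef eps sg x i j| <= M.
Proof.
exists (eps^-1 ^+ 2 * sg ^+ 2 / 2 + sg ^+ 2) => x sx.
have f1 : `|trinv eps (x i - x j)| <= eps^-1 by exact: trinv_bound.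
have f2 : trinv eps (x i - x j) ^+ 2 <= eps^-1 ^+ 2.
  by rewrite -[leLHS]real_normK ?num_real// lerXn2r ?nnegrE ?invr_ge0 ?(ltW eps0).
have s0 := sqr_ge0 sg; have t0 := sqr_ge0 (trinv eps (x i - x j)).
rewrite /sq_coef ger0_norm; last by have := mulr_ge0 t0 s0; lra.
have := ler_wpM2r s0 f2; lra.
Qed.

Lemma cross_coef_bounded (i j : 'I_N) :
  exists M : R, forall x : 'I_N -> R, safe eps x -> `|cross_coef eps sg x i j| <= M.
Proof.
exists (eps^-1 ^+ 2 * sg ^+ 2) => x sx.
have f1 : `|trinv eps (x i - x j)| <= eps^-1 by exact: trinv_bound.
have s0 := sqr_ge0 sg; have t0 := sqr_ge0 (trinv eps (x i - x j)).
rewrite /cross_coef ger0_norm; last exact: mulr_ge0.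
apply: ler_wpM2r => //.
by rewrite -[leLHS]real_normK ?num_real// lerXn2r ?nnegrE ?invr_ge0 ?(ltW eps0).
Qed.

Lemma gated_noise_mean n l :
  nonpos_mean P (fun om => gated n l (fun x => noise_terms eps a sg (euler_step n) x
    (fun i => increment B (l%:R * euler_step n) (l.+1%:R * euler_step n) i om)) om).
Proof.
have h0 : 0 < euler_step n :> R by exact: euler_step_gt0.
have s0 : 0 <= l%:R * euler_step n :> R by rewrite mulr_ge0// ltW.
have st : l%:R * euler_step n < l.+1%:R * euler_step n :> R by rewrite ltr_pM2r// ltr_nat.
have hE : l.+1%:R * euler_step n - l%:R * euler_step n = euler_step n :> R by rewrite -natr1; ring.
set s := l%:R * euler_step n in s0 st hE *; set t := l.+1%:R * euler_step n in st hE *.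
have mlin i j k : bounded_past B s k (gated n l (fun x => lin_coef eps a sg (euler_step n) x i j)).
  apply: gated_bounded_past; last exact: lin_coef_bounded.
  by move=> d' T' x mx; exact: measurable_lin_coef.
have msq i j k : bounded_past B s k (gated n l (fun x => sq_coef eps sg x i j)).
  apply: gated_bounded_past; last exact: sq_coef_bounded.
  by move=> d' T' x mx; exact: measurable_sq_coef.
have mcr i j k : bounded_past B s k (gated n l (fun x => - cross_coef eps sg x i j)).
  apply: gated_bounded_past.
    move=> d' T' x mx; apply: measurableT_comp => //; exact: measurable_cross_coef.
  by have [M HM] := cross_coef_bounded i j; exists M => x sx; rewrite normrN; exact: HM.
have sq0 i j om : 0 <= gated n l (fun x => sq_coef eps sg x i j) om.
  rewrite /gated; case: ifP => // _; rewrite /sq_coef; set f := trinv _ _.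
  have := mulr_ge0 (sqr_ge0 f) (sqr_ge0 sg); have := sqr_ge0 sg; lra.
pose summand i j om :=
  gated n l (fun x => lin_coef eps a sg (euler_step n) x i j) om * increment B s t i om
  + gated n l (fun x => lin_coef eps a sg (euler_step n) x j i) om * increment B s t j om
  + gated n l (fun x => sq_coef eps sg x i j) om * (increment B s t i om ^+ 2 - (t - s))
  + gated n l (fun x => sq_coef eps sg x i j) om * (increment B s t j om ^+ 2 - (t - s))
  + gated n l (fun x => - cross_coef eps sg x i j) om
    * (increment B s t i om * increment B s t j om).
rewrite (_ : (fun om => _) = (fun om => \sum_i \sum_(j | j != i) summand i j om)); last first.
  apply/funext => om; rewrite /gated /noise_terms /summand /gated hE.
  case: ifP => _.
    by apply: eq_bigr => i _; apply: eq_bigr => j _; rewrite mulNr.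
  by rewrite big1// => i _; rewrite big1// => j _; rewrite !mul0r !addr0.
apply: nonpos_mean_sum => i _; apply: nonpos_mean_sum => j ji.
repeat apply: nonpos_meanD.
- exact: (mean_lin_noise hB).
- exact: (mean_lin_noise hB).
- exact: (mean_sq_noise hB).
- exact: (mean_sq_noise hB).
- by apply: (mean_cross_noise hB) => //; rewrite eq_sym.
Qed.

Lemma growth_rate_ge0 : 0 <= growth_rate (N := N) a sg.
Proof.
have N0 : 0 <= N%:R :> R by [].
rewrite /growth_rate; have s0 := sqr_ge0 sg.
have := mulr_ge0 (exprn_ge0 3 N0) a0; have := mulr_ge0 (exprn_ge0 2 N0) s0; lra.
Qed.

(** One increment divided by the square root of the step is a standard normal
    variable, whose fourth moment does not depend on the step. *)
Lemma quartic_noise_mean n l i :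
  nonpos_mean P (fun om =>
    (increment B (l%:R * euler_step n) (l.+1%:R * euler_step n) i om * n.+1%:R) ^+ 4
    - 48 * expR 2^-1).
Proof.
have h0 : 0 < euler_step n :> R by exact: euler_step_gt0.
have s0 : 0 <= l%:R * euler_step n :> R by rewrite mulr_ge0// ltW.
have st : l%:R * euler_step n < l.+1%:R * euler_step n :> R by rewrite ltr_pM2r// ltr_nat.
have hE : l.+1%:R * euler_step n - l%:R * euler_step n = euler_step n :> R by rewrite -natr1; ring.
have i4 := increment_integrable4 hB s0 st i.
have i4' := integrableZl measurableT (n.+1%:R ^+ 4) i4.
have ic := integrable_cst P (48 * expR 2^-1 : R).
have E om : (increment B (l%:R * euler_step n) (l.+1%:R * euler_step n) i om * n.+1%:R) ^+ 4
    - 48 * expR 2^-1 =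
    n.+1%:R ^+ 4 * increment B (l%:R * euler_step n) (l.+1%:R * euler_step n) i om ^+ 4
    - 48 * expR 2^-1 by rewrite exprMn mulrC.
split.
  have := integrableB measurableT i4' ic; congr (integrable _ _ _).
  by apply/funext => om /=; rewrite -EFinM -EFinB -E.
under eq_Rintegral do rewrite E.
rewrite RintegralB// RintegralZl// Rintegral_cst1.
have := increment_moment4 hB s0 st i; rewrite hE => H.
rewrite subr_le0.
have n4 : 0 <= n.+1%:R ^+ 4 :> R by rewrite exprn_ge0.
apply: le_trans (ler_wpM2l n4 H) _.
rewrite /euler_step mulrCA [_ ^+ 4 * _](_ : _ = 1) ?mulr1//.
by rewrite -exprVn -exprM -exprMn divff ?expr1n// pnatr_eq0.
Qed.

Lemma energy_step : exists2 K, 0 <= K & forall n l,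
  \int[P]_om energy n l.+1 om <= (\int[P]_om energy n l om)
    + (euler_step n * growth_rate (N := N) a sg + K * n.+1%:R ^- 3).
Proof.
have [K K0 HK] := lyapunov_step (N := N) eps0 a0 sga.
exists (K * (1 + N%:R * (48 * expR 2^-1))).
  by rewrite mulr_ge0// addr_ge0// mulr_ge0// mulr_ge0// expR_ge0.
move=> n l.
set G := growth_rate a sg; set c := 48 * expR 2^-1.
have k0 : 0 < n.+1%:R^-1 :> R by rewrite invr_gt0.
have k1 : n.+1%:R^-1 <= 1 :> R by rewrite invf_le1 ?ler1n.
have hE : euler_step n = n.+1%:R^-1 ^+ 2 :> R by rewrite /euler_step exprVn.
have h0 : 0 <= euler_step n :> R by rewrite ltW// euler_step_gt0.
have k3 : 0 <= n.+1%:R ^- 3 :> R by rewrite invr_ge0 exprn_ge0.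
pose xi i om := increment B (l%:R * euler_step n) (l.+1%:R * euler_step n) i om.
pose noise om := gated n l (fun x => noise_terms eps a sg (euler_step n) x (fun i => xi i om)) om.
pose rest om := K * n.+1%:R ^- 3 * \sum_i ((xi i om * n.+1%:R) ^+ 4 - c).
have Dmean : nonpos_mean P (fun om => noise om + rest om).
  apply: nonpos_meanD; first exact: gated_noise_mean.
  apply: nonpos_meanZ; first exact: mulr_ge0.
  by apply: nonpos_mean_sum => i _; exact: quartic_noise_mean.
pose C0 := euler_step n * G + K * (1 + N%:R * c) * n.+1%:R ^- 3.
have restE om : rest om + K * (1 + N%:R * c) * n.+1%:R ^- 3
    = K * (n.+1%:R^-1 ^+ 3 * (1 + \sum_i (xi i om / n.+1%:R^-1) ^+ 4)).
  rewrite /rest sumrB sumr_const card_ord -mulr_natl invrK exprVn; ring.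
have main om : energy n l.+1 om <= energy n l om + C0 + (noise om + rest om).
  pose tail := K * (n.+1%:R^-1 ^+ 3 * (1 + \sum_i (xi i om / n.+1%:R^-1) ^+ 4)).
  have -> : energy n l om + C0 + (noise om + rest om) =
    energy n l om + euler_step n * G + noise om + tail.
    by rewrite /tail -restE /C0; ring.
  have tail0 : 0 <= tail.
    apply: mulr_ge0 => //; apply: mulr_ge0; first by rewrite exprn_ge0// ltW.
    rewrite addr_ge0//; apply: sumr_ge0 => i _.
    by rewrite (_ : 4 = 2 * 2)%N// exprM sqr_ge0.
  rewrite /noise /gated {1 2}/energy.
  have [al|al] := boolP (alive n l om); last first.
    rewrite /= (negbTE al) /= addr0.
    have := mulr_ge0 h0 growth_rate_ge0; rewrite -/G; move: tail0; lra.
  have := HK _ _ _ (fun i => xi i om) k0 k1 hE (alive_safe al).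
  rewrite -chainS => step_le.
  apply: le_trans step_le.
  rewrite /= al /=; case: ifPn => // us.
  exact: lyapunov_unsafe.
have iC := integrable_cst P C0.
have iE := energy_integrable n l.
have iEC : P.-integrable setT (EFin \o (fun om => energy n l om + C0)).
  exact: (integrableD measurableT iE iC).
have iD := proj1 Dmean.
have := @le_Rintegral _ _ _ P setT _ _ measurableT (energy_integrable n l.+1)
  (integrableD measurableT iEC iD) (fun om _ => main om).
move/le_trans; apply.
rewrite RintegralD// RintegralD// Rintegral_cst1 -/C0.
by rewrite gerDl; exact: (proj2 Dmean).
Qed.

Lemma energy_bound : safe eps x0 -> exists2 K, 0 <= K & forall n l,
  \int[P]_om energy n l om <= lyapunov eps x0
    + l%:R * (euler_step n * growth_rate (N := N) a sg + K * n.+1%:R ^- 3).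
Proof.
move=> sx0; have [K K0 HK] := energy_step.
exists K => // n; elim=> [|l IH].
  rewrite mul0r addr0 -[leRHS](Rintegral_cst1 P) le_eqVlt; apply/orP; left.
  by apply/eqP; apply: eq_Rintegral => om _; rewrite /energy /= sx0.
apply: le_trans (HK n l) _.
by rewrite -(natr1 l) mulrDl mul1r [leRHS]addrA lerD2r.
Qed.

Lemma dead_measurable n l : measurable [set om | ~~ alive n l om].
Proof.
have mBl u i : 0 <= u -> u <= l%:R * euler_step n -> measurable_fun setT (B i u).
  by move=> u0 _; exact: mB.
have mal : measurable_fun setT (alive n l) by exact: measurable_alive.
rewrite (_ : mkset _ = alive n l @^-1` [set false]).
  by rewrite -[X in measurable X]setTI; exact: mal.
by apply/seteqP; split => om /=; [move/negbTE|move=> ->].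
Qed.

(** Markov's inequality.  There are [m * n.+1 ^ 2] steps up to time [m], so that
    the remainders of order [n.+1%:R ^- 3] add up to order [m / n.+1]. *)
Lemma dead_probability : safe eps x0 -> exists2 K, 0 <= K & forall n m,
  - ln eps * fine (P [set om | ~~ alive n (m * n.+1 ^ 2) om])
  <= lyapunov eps x0 + m%:R * growth_rate (N := N) a sg + K * m%:R * n.+1%:R^-1.
Proof.
move=> sx0; have [K K0 HK] := energy_bound sx0.
exists K => // n m.
have ln0 : 0 <= - ln eps by rewrite oppr_ge0 ln_le0.
set l := (m * n.+1 ^ 2)%N.
have lE : l%:R = m%:R * n.+1%:R ^+ 2 :> R by rewrite /l natrM natrX.
have := HK n l; rewrite lE.
have -> : m%:R * n.+1%:R ^+ 2 * (euler_step n * growth_rate (N := N) a sg + K * n.+1%:R ^- 3)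
    = m%:R * growth_rate (N := N) a sg + K * m%:R * n.+1%:R^-1 :> R.
  by rewrite /euler_step; field; rewrite ?pnatr_eq0.
rewrite addrA; apply: le_trans.
have md := dead_measurable n l.
have -> : fine (P [set om | ~~ alive n l om])
    = \int[P]_om \1_[set om | ~~ alive n l om] om.
  by rewrite /Rintegral integral_indic// setIT.
have ii : P.-integrable setT (EFin \o (\1_[set om | ~~ alive n l om] : T -> R)).
  apply: (bounded_integrable P (M := 1)); first exact: measurable_indic.
  by move=> om; rewrite indicE; case: (_ \in _); rewrite ?normr1 ?normr0.
rewrite -RintegralZl//; apply: le_Rintegral => //.
- exact: (integrableZl measurableT (- ln eps) ii).
- exact: energy_integrable.
- move=> om _; rewrite indicE; have [|al] := boolP (om \in _).
    by rewrite inE /= => /negbTE al; rewrite mulr1 /energy al.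
  by rewrite mulr0 energy_ge0.
Qed.

End EnergyEstimate.

(** * Almost sure survival *)

Section Survival.
Context {R : realType} {d : measure_display} {T : measurableType d}.
Variables (P : probability T R) (N : nat) (B : 'I_N -> R -> T -> R).
Hypothesis hB : independent_brownian_motions P B.
Variables (x0 : 'I_N -> R) (a sg : R).
Hypotheses (N2 : (2 <= N)%N) (a0 : 0 <= a) (sga : sg ^+ 2 <= 2 * a).
Hypothesis Dx0 : domainD x0.

Definition level (q : nat) : R := q.+1%:R^-1.

Lemma level_gt0 q : 0 < level q.
Proof. by rewrite invr_gt0. Qed.

Lemma level_le1 q : level q <= 1.
Proof. by rewrite invf_le1 ?ler1n. Qed.

Lemma level_nonincreasing q q' : (q <= q')%N -> level q' <= level q.
Proof. by move=> qq; rewrite lef_pV2 ?posrE// ler_nat. Qed.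

Lemma level_small (e : R) : 0 < e -> exists q, level q <= e.
Proof.
move=> e0; exists (Num.truncn e^-1).
rewrite -[leRHS]invrK lef_pV2 ?posrE ?invr_gt0//.
exact/ltW/truncnS_gt.
Qed.

Definition log_energy : R := \sum_i \sum_(j | j != i)
  (- ln `|x0 i - x0 j| + 1 + x0 i ^+ 2 + x0 j ^+ 2).

(** The initial energy does not depend on the truncation. *)
Lemma lyapunov_initial eps : safe eps x0 -> lyapunov eps x0 = log_energy.
Proof.
move=> sx; apply: eq_bigr => i _; apply: eq_bigr => j ji.
by rewrite /pairpot /logpot max_l//; exact: safe_gap.
Qed.

Definition dead m q n : set T :=
  [set om | ~~ alive B x0 a sg (level q) n (m * n.+1 ^ 2) om].

Lemma measurable_dead m q n : measurable (dead m q n).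
Proof. exact: (dead_measurable hB x0 a sg (level_gt0 q) n (m * n.+1 ^ 2)). Qed.

Definition eventually_dead m q : set T :=
  \bigcup_n0 \bigcap_(n in [set n | (n0 <= n)%N]) dead m q n.

Lemma measurable_eventually_dead m q : measurable (eventually_dead m q).
Proof.
apply: bigcupT_measurable => n0; apply: bigcap_measurable.
  by exists n0 => /=.
by move=> n _; exact: measurable_dead.
Qed.

(** The remainder disappears with the step; the numerator that is left does not
    depend on the truncation. *)
Lemma eventually_dead_le m q : safe (level q) x0 -> (0 < q)%N ->
  (P (eventually_dead m q) <=
   ((log_energy + m%:R * growth_rate (N := N) a sg) / ln q.+1%:R)%:E)%E.
Proof.
move=> sx q0.
have [K K0 HK] := dead_probability hB N2 a0 sga (level_gt0 q) (level_le1 q) sx.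
set c := log_energy + _.
have lnq : 0 < ln q.+1%:R :> R by rewrite ln_gt0// ltr1n ltnS.
have lnE : - ln (level q) = ln q.+1%:R by rewrite /level lnV ?opprK// posrE.
pose F n0 := \bigcap_(n in [set n | (n0 <= n)%N]) dead m q n.
have mF n0 : measurable (F n0).
  apply: bigcap_measurable; first by exists n0 => /=.
  by move=> n _; exact: measurable_dead.
have Fle n0 : (P (F n0) <= (c / ln q.+1%:R)%:E)%E.
  rewrite -[leLHS]fineK ?fin_num_measure// lee_fin ler_pdivlMr// mulrC.
  apply/ler_addgt0Pr => e e0.
  have [n1 Hn1] : exists n1 : nat, K * m%:R / n1.+1%:R <= e.
    by apply: exists_fine_step => //; rewrite mulr_ge0.
  have H := HK (maxn n0 n1) m.
  have : fine (P (F n0)) <= fine (P (dead m q (maxn n0 n1))).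
    rewrite fine_le ?fin_num_measure//; first exact: measurable_dead.
    apply: le_measure; rewrite ?inE//; first exact: measurable_dead.
    by move=> om; apply; rewrite /= leq_maxl.
  move=> /(ler_wpM2l (ltW lnq)) /le_trans; apply.
  rewrite -lnE; apply: le_trans H _.
  rewrite (lyapunov_initial sx) lerD2l; apply: le_trans Hn1.
  rewrite ler_wpM2l ?mulr_ge0// lef_pV2 ?posrE// ler_nat ltnS leq_maxr//.
have ndF : nondecreasing_seq F.
  move=> n1 n2 n12; apply/subsetPset => om H n /= n2n; apply: H.
  exact: leq_trans n2n.
have cvF := nondecreasing_cvg_mu mF (measurable_eventually_dead m q) ndF (mu := P).
rewrite -(cvg_lim _ cvF)//; apply: lime_le; first by apply/cvg_ex; eexists; exact: cvF.
by near=> n; exact: Fle.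
Unshelve. all: by end_near.
Qed.

(** The bound of [eventually_dead_le] tends to [0] as [q] grows, so almost surely
    some truncation is survived for infinitely many steps.  Infinitely many are
    enough for safety to pass to the limit of the scheme. *)
Lemma survival m : {ae P, forall om, exists q, safe (level q) x0 /\
  forall n0, exists2 n, (n0 <= n)%N & alive B x0 a sg (level q) n (m * n.+1 ^ 2) om}.
Proof.
have [e e0 se] := domainD_safe Dx0.
have [q0 Hq0] := level_small e0.
have sq q : (q0 <= q)%N -> safe (level q) x0.
  move=> qq; apply: safeW se; first exact: level_gt0.
  exact: le_trans (level_nonincreasing qq) Hq0.
pose A := \bigcap_(q in [set q | (q0.+1 <= q)%N]) eventually_dead m q.
have mA : measurable A.
  apply: bigcap_measurable; first by exists q0.+1 => /=.
  by move=> q _; exact: measurable_eventually_dead.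
exists A; split => //; last first.
  move=> om /= nex q /= q0q; apply: contrapT => nd; apply: nex.
  exists q; split; first by apply: sq; exact: ltnW.
  move=> n0; apply: contrapT => nn; apply: nd; exists n0 => // n /= n0n.
  by rewrite /dead /=; apply/negP => al; apply: nn; exists n.
set c := log_energy + m%:R * growth_rate (N := N) a sg.
have PA q : (q0 < q)%N -> (P A <= (c / ln q.+1%:R)%:E)%E.
  move=> qq; apply: (@le_trans _ _ (P (eventually_dead m q))).
    apply: le_measure; rewrite ?inE//; first exact: measurable_eventually_dead.
    by move=> om; apply.
  apply: eventually_dead_le; first by apply: sq; exact: ltnW.
  exact: leq_ltn_trans qq.
have PA0 : 0 <= fine (P A) by exact: fine_ge0.
have PAE : (fine (P A))%:E = P A by rewrite fineK// fin_num_measure.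
apply/eqP; rewrite -PAE eqe eq_le PA0 andbT leNgt; apply/negP => PA1.
have [q Hq] : exists q, (q0 < q)%N /\ expR (c / fine (P A) + 1) <= q.+1%:R.
  exists (maxn q0.+1 (Num.truncn (expR (c / fine (P A) + 1)))); split.
    exact: leq_maxl.
  apply: le_trans (ltW (truncnS_gt _)) _.
  by rewrite ler_nat ltnS leq_maxr.
case: Hq => qq Hq.
have lnq : c / fine (P A) + 1 <= ln q.+1%:R.
  by rewrite -[leLHS]expRK ler_ln ?posrE ?expR_gt0.
have lnq0 : 0 < ln q.+1%:R :> R by rewrite ln_gt0// ltr1n ltnS (leq_ltn_trans _ qq).
have := PA q qq; rewrite -PAE lee_fin ler_pdivlMr//.
move=> /(le_trans (ler_wpM2l PA0 lnq)).
rewrite mulrDr mulr1 mulrCA divff ?gt_eqF// mulr1.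
by rewrite -[leRHS]addr0 lerD2l leNgt PA1.
Qed.

End Survival.

(** * Pathwise uniqueness *)

Section SystemUniqueness.
Context {R : realType} {N : nat}.
Implicit Types (x y w : R -> 'I_N -> R) (eps : R).

Lemma safe_perturb eps eps' (x y : 'I_N -> R) (e : R) : 0 < eps' ->
  eps' + 2 * e <= eps -> eps^-1 + e <= eps'^-1 ->
  safe eps x -> (forall i, `|y i - x i| <= e) -> safe eps' y.
Proof.
move=> e'0 h1 h2 sx yx; apply/andP; split.
  apply/forallP => i; apply: le_trans h2.
  have := safe_bound i sx; have := yx i; have := lerB_dist (y i) (x i); lra.
apply/forallP => i; apply/forallP => j; apply/implyP => ji.
have := safe_gap sx ji; have := yx i; have := yx j.
rewrite (_ : x i - x j = (y i - y j) - (y i - x i) + (y j - x j)); last by ring.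
have := ler_normD (y i - y j - (y i - x i)) (y j - x j).
have := ler_normB (y i - y j) (y i - x i); lra.
Qed.

Lemma solution_upto_ext (b b' : ('I_N -> R) -> 'I_N -> R) w (x0 : 'I_N -> R) (T : R) x :
  (forall s, 0 <= s -> s <= T -> b (x s) = b' (x s)) ->
  solution_upto b w x0 T x -> solution_upto b' w x0 T x.
Proof.
move=> bb [xx0 X]; split=> // dl dl0; have [h h0 H] := X dl dl0.
exists h => // s t i s0 st tT th; rewrite -bb ?(le_trans st tT)//; exact: H.
Qed.

Lemma safe_solution_upto alpha beta eps (x0 : 'I_N -> R) x (b : R -> 'I_N -> R) (T : R) :
  0 <= alpha -> 0 < eps ->
  solves_system alpha beta x0 x b ->
  (forall s, 0 <= s -> s <= T -> safe eps (x s)) ->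
  solution_upto (trdrift (alpha / N%:R ^+ 2) eps)
    (fun t i => 2 * Num.sqrt (alpha / beta) * b t i) x0 T x.
Proof.
move=> al0 e0 [cx xx0 _ ix xE] sx.
have a0 : 0 <= alpha / N%:R ^+ 2 by rewrite divr_ge0// exprn_ge0.
have L0 : 0 <= alpha / N%:R ^+ 2 * (N%:R * (6 * eps ^- 2)).
  by rewrite mulr_ge0// mulr_ge0// mulr_ge0// invr_ge0 exprn_ge0// ltW.
have lip (x1 y1 : 'I_N -> R) (e : R) : (forall i, `|x1 i - y1 i| <= e) ->
    forall i, `|trdrift (alpha / N%:R ^+ 2) eps x1 i
      - trdrift (alpha / N%:R ^+ 2) eps y1 i|
      <= alpha / N%:R ^+ 2 * (N%:R * (6 * eps ^- 2)) * e.
  exact: trdrift_lipschitz.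
apply: (integral_solution_upto L0 lip (g := fun s => drift alpha (x s))).
- by move=> i; rewrite xx0.
- move=> i; apply: continuous_subspaceW (cx i) => r /=.
  by rewrite !in_itv/= andbT => /andP[].
- by move=> s s0 sT; rewrite (trdrift_drift _ e0 (sx s s0 sT)).
- by move=> t i t0 _; exact: ix.
- by move=> t i t0 _; exact: xE.
Qed.

(** As long as [y] stays in the region safe for [eps / 2], both paths solve the
    same equation with Lipschitz drift, hence agree.  At the supremum [tau] of
    the times of this regime, [y] equals [x], which is safe with twice the
    margin, so that the regime would persist beyond [tau] if [tau < t]. *)
Lemma solves_system_unique alpha beta (x0 : 'I_N -> R) x y (b : R -> 'I_N -> R) :
  0 <= alpha ->
  solves_system alpha beta x0 x b -> solves_system alpha beta x0 y b ->
  (forall T : R, 0 <= T -> exists2 eps, 0 < eps &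
     forall s, 0 <= s -> s <= T -> safe eps (x s)) ->
  forall t i, 0 <= t -> x t i = y t i.
Proof.
move=> al0 Sx Sy safex t i t0.
have [e1 e10 sx1] := safex t t0.
pose eps := Num.min e1 1.
have e0 : 0 < eps by rewrite lt_min e10 ltr01.
have eps1 : eps <= 1 by rewrite ge_min lexx orbT.
have sx s : 0 <= s -> s <= t -> safe eps (x s).
  by move=> s0 st; apply: safeW (sx1 s s0 st) => //; rewrite ge_min lexx.
have e20 : 0 < eps / 2 by rewrite divr_gt0.
have sx2 s : 0 <= s -> s <= t -> safe (eps / 2) (x s).
  by move=> s0 st; apply: safeW (sx s s0 st) => //; lra.
have a0 : 0 <= alpha / N%:R ^+ 2 by rewrite divr_ge0// exprn_ge0.
have L0 : 0 <= alpha / N%:R ^+ 2 * (N%:R * (6 * (eps / 2) ^- 2)).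
  by rewrite mulr_ge0// mulr_ge0// mulr_ge0// invr_ge0 exprn_ge0// ltW.
have lip (x1 y1 : 'I_N -> R) (e : R) : (forall i, `|x1 i - y1 i| <= e) ->
    forall i, `|trdrift (alpha / N%:R ^+ 2) (eps / 2) x1 i
      - trdrift (alpha / N%:R ^+ 2) (eps / 2) y1 i|
      <= alpha / N%:R ^+ 2 * (N%:R * (6 * (eps / 2) ^- 2)) * e.
  exact: trdrift_lipschitz.
have agree tau : 0 <= tau -> tau <= t ->
    (forall s, 0 <= s -> s <= tau -> safe (eps / 2) (y s)) ->
    forall s j, 0 <= s -> s <= tau -> x s j = y s j.
  move=> tau0 taut sy; apply: (solution_upto_unique L0 lip tau0).
  - apply: (safe_solution_upto al0 e20 Sx) => s s0 st.
    by apply: sx2 => //; exact: le_trans taut.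
  - exact: (safe_solution_upto al0 e20 Sy).
(* the times up to which [y] keeps half of the margin of [x] *)
pose E : set R := [set tau | 0 <= tau <= t /\
  forall s, 0 <= s -> s <= tau -> safe (eps / 2) (y s)].
have x00 : x 0 = y 0 by case: Sx => _ -> _ _ _; case: Sy.
have E0 : E 0.
  split; first by rewrite lexx.
  move=> s s0 s0'; have -> : s = 0 by apply/eqP; rewrite eq_le s0 s0'.
  by rewrite -x00; exact: sx2.
have Eub : ubound E t by move=> r [/andP[]].
have Esup : has_sup E by split; [exists 0|exists t].
pose tau := sup E.
have tau0 : 0 <= tau by apply: ub_le_sup => //; exists t.
have taut : tau <= t by apply: ge_sup => //; exists 0.
have below s : 0 <= s -> s < tau -> safe (eps / 2) (y s) /\ forall j, x s j = y s j.
  move=> s0 /(sup_gt (ex_intro _ _ E0))[r [/andP[r0 rt] Er] sr].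
  split; first by apply: Er => //; exact: ltW.
  by move=> j; apply: (agree r) => //; exact: ltW.
have cont z : solves_system alpha beta x0 z b -> forall e : R, 0 < e ->
    exists2 dl : R, 0 < dl & forall s j, 0 <= s -> `|s - tau| < dl ->
    `|z s j - z tau j| <= e.
  case=> cz _ _ _ _ e ee0.
  have /choice[dl Hdl] : forall j, exists dl : R, 0 < dl /\ forall s, 0 <= s ->
      `|s - tau| < dl -> `|z s j - z tau j| <= e.
    move=> j; have /within_continuousP/(_ tau _ e ee0) := cz j.
    case; first by rewrite /= in_itv/= tau0.
    move=> dl dl0 H; exists dl; split => // s s0.
    by apply: H; rewrite /= in_itv/= s0.
  exists (\big[Num.min/1]_(j < N) dl j).
    by apply: lt_bigmin => // j _; case: (Hdl j).
  move=> s j s0 sd; case: (Hdl j) => _; apply => //.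
  by apply: lt_le_trans sd _; exact: bigmin_le_cond.
have xytau j : x tau j = y tau j.
  have [tau00|taun0] := eqVneq tau 0; first by rewrite tau00 x00.
  have taup : 0 < tau by rewrite lt_neqAle eq_sym taun0.
  apply/eqP; rewrite -subr_eq0 -normr_le0; apply/ler_addgt0Pr => e ee0; rewrite add0r.
  have ee20 : 0 < e / 2 by rewrite divr_gt0.
  have [d1 d10 H1] := cont x Sx _ ee20.
  have [d2 d20 H2] := cont y Sy _ ee20.
  pose r := Num.min (Num.min d1 d2) tau / 2.
  have r0 : 0 < r by rewrite divr_gt0// !lt_min d10 d20 taup.
  have rd1 : r < d1.
    have : Num.min (Num.min d1 d2) tau <= d1 by rewrite !ge_min lexx.
    by move: r0; rewrite /r; lra.
  have rd2 : r < d2.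
    have : Num.min (Num.min d1 d2) tau <= d2 by rewrite !ge_min lexx orbT.
    by move: r0; rewrite /r; lra.
  have rtau : r < tau.
    have : Num.min (Num.min d1 d2) tau <= tau by rewrite !ge_min lexx orbT.
    by move: r0; rewrite /r; lra.
  have s0 : 0 <= tau - r by lra.
  have [||_ xy] := below (tau - r); [by []|lra|].
  have nr : `|tau - r - tau| = r by rewrite addrAC subrr add0r normrN gtr0_norm.
  have := H1 _ j s0; rewrite nr => /(_ rd1).
  have := H2 _ j s0; rewrite nr => /(_ rd2).
  rewrite xy !ler_norml => /andP[? ?] /andP[? ?]; apply/andP; split; lra.
have Etau : E tau.
  split; first by rewrite tau0.
  move=> s s0; rewrite le_eqVlt => /predU1P[->|/(below s s0)[]//].
  have -> : y tau = x tau by apply/funext => j; rewrite xytau.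
  exact: sx2.
have [tt|tt] := leP t tau; last first.
  exfalso.
  have e40 : 0 < eps / 4 by rewrite divr_gt0.
  have [dl dl0 H] := cont y Sy _ e40.
  pose r := Num.min (dl / 2) (t - tau).
  have r0 : 0 < r by rewrite lt_min divr_gt0//= subr_gt0.
  have rdl : r < dl by rewrite gt_min; apply/orP; left; lra.
  have rt : r <= t - tau by rewrite ge_min lexx orbT.
  have : E (tau + r).
    split; first by apply/andP; split; lra.
    move=> s s0 sr; have [st|ts] := leP s tau; first exact: (proj2 Etau).
    have stau : `|s - tau| < dl by rewrite gtr0_norm; lra.
    apply: (@safe_perturb eps (eps / 2) (x tau) (y s) (eps / 4)) => //.
    - lra.
    - have i1 : 1 <= eps^-1 by rewrite invf_ge1.
      by rewrite invfM invrK; lra.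
    - exact: sx.
    - by move=> j; rewrite xytau; exact: H.
  have ubE : has_ubound E by exists t.
  by move=> /(ub_le_sup ubE); rewrite -/tau; lra.
by apply: (agree tau) => //; case: Etau.
Qed.

End SystemUniqueness.

(** * Gluing the truncated solutions *)

Section Gluing.
Context {R : realType} {d : measure_display} {T : measurableType d} {N : nat}.
Variables (B : 'I_N -> R -> T -> R) (x0 : 'I_N -> R) (alpha beta : R) (om : T).
Hypothesis alpha0 : 0 <= alpha.
Hypothesis cB : forall i, {within `[0, +oo[, continuous (fun t => B i t om)}.

Let a := alpha / N%:R ^+ 2.
Let sg := 2 * Num.sqrt (alpha / beta).
Let W := driving_noise B sg om.
Let b q := trdrift (N := N) a (level (R := R) q).
Let C q := a * (N%:R * (level (R := R) q)^-1).
Let L q := a * (N%:R * (6 * (level (R := R) q) ^- 2)).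

Definition truncated_solution q : R -> 'I_N -> R :=
  euler_limit (b q) W x0.

Definition glued_solution t i : R := limn (fun q => truncated_solution q t i).

Let a0 : 0 <= a. Proof. by rewrite divr_ge0// exprn_ge0. Qed.

Let C0 q : 0 <= C q.
Proof. by rewrite mulr_ge0// mulr_ge0// invr_ge0 ltW// level_gt0. Qed.

Let L0 q : 0 <= L q.
Proof. by rewrite mulr_ge0// mulr_ge0// mulr_ge0// invr_ge0 exprn_ge0// ltW// level_gt0. Qed.

Let b_lip q (x y : 'I_N -> R) (e : R) : (forall i, `|x i - y i| <= e) ->
  forall i, `|b q x i - b q y i| <= L q * e.
Proof. by apply: trdrift_lipschitz => //; exact: level_gt0. Qed.

Let b_bnd q (x : 'I_N -> R) i : `|b q x i| <= C q.
Proof. by apply: trdrift_bound => //; exact: level_gt0. Qed.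

Let W_unif (m : R) : uniformly_continuous_path W m.
Proof.
apply: continuous_path_uniform => i.
have /within_continuousP cBi := @cB i.
apply/within_continuousP => x xm e e0.
have K0 : 0 < `|sg| + 1 by rewrite ltr_wpDl.
have e1 : 0 < e / (`|sg| + 1) by rewrite divr_gt0.
have sub r : `[0, m]%classic r -> `[0, +oo[%classic r.
  by rewrite /= !in_itv/= andbT => /andP[].
have [dl dl0 H] := cBi x (sub x xm) _ e1.
exists dl => // y /sub ym xy; rewrite /W /driving_noise -mulrBr normrM.
rewrite (_ : B i y om - B i 0 om - (B i x om - B i 0 om) = B i y om - B i x om); last by ring.
apply: le_trans (ler_wpM2l (normr_ge0 _) (H y ym xy)) _.
have e2 : e / (`|sg| + 1) * (`|sg| + 1) = e by rewrite divfK ?gt_eqF.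
by rewrite -[leRHS]e2 mulrDr mulr1 mulrC lerDl ltW.
Qed.

Lemma truncated_solution_upto q (m : R) : 0 <= m ->
  solution_upto (b q) W x0 m (truncated_solution q).
Proof.
by move=> m0; exact: (euler_limit_solution (L0 q) (@b_lip q) (@b_bnd q) x0 (C0 q) m0 (W_unif m)).
Qed.

Lemma truncated_solution_cvg q t i : 0 <= t ->
  euler_path (b q) W x0 (euler_step n) t i @[n --> \oo] --> truncated_solution q t i.
Proof.
move=> t0.
by apply: (euler_limit_cvg (L0 q) (@b_lip q) (@b_bnd q) (T := t)).
Qed.

(** The polygons converge uniformly to the truncated solution, and the safe region
    is closed. *)
Lemma truncated_solution_safe q (m : nat) :
  (forall n0, exists2 n, (n0 <= n)%N & alive B x0 a sg (level q) n (m * n.+1 ^ 2) om) ->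
  forall t, 0 <= t -> t <= m%:R -> safe (level q) (truncated_solution q t).
Proof.
move=> Hal t t0 tm.
have m0 : 0 <= m%:R :> R by [].
have Xs := truncated_solution_upto q m0.
have Xu := solution_upto_uniform (C0 q) (@b_bnd q) Xs (W_unif m%:R).
have close e : 0 < e -> exists2 y, safe (level q) y &
    forall i, `|y i - truncated_solution q t i| <= e.
  move=> e0; have e20 : 0 < e / 2 by rewrite divr_gt0.
  have [h1 h10 H1] := Xu _ e20.
  have [h2 h20 H2] := euler_path_cvg (L0 q) (@b_lip q) (@b_bnd q) (C0 q) m0
    (W_unif m%:R) Xs e20.
  have h0 : 0 < Num.min h1 h2 by rewrite lt_min h10.
  have [n0 _ Hn0] := euler_step_small h0.
  have [n n0n al] := Hal n0.
  have := Hn0 n n0n; rewrite le_min => /andP[nh1 nh2].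
  have hn := @euler_step_gt0 R n.
  set l := Num.truncn (t / euler_step n).
  have /andP[lt tl] : l%:R * euler_step n <= t < l.+1%:R * euler_step n.
    by rewrite -ler_pdivlMr// -ltr_pdivrMr// truncn_itv// divr_ge0// ltW.
  have lm : (l <= m * n.+1 ^ 2)%N.
    rewrite -(ler_nat R) natrM natrX -ler_pdivrMr ?exprn_gt0//.
    by apply: le_trans tm; rewrite /euler_step in lt.
  have sl : safe (level q) (chain B x0 a sg (level q) n l om).
    exact: alive_safe (aliveW lm al).
  exists (chain B x0 a sg (level q) n l om) => // i.
  have l0 : 0 <= l%:R * euler_step n :> R by rewrite mulr_ge0// ltW.
  have := H2 _ hn nh2 (l%:R * euler_step n) i l0 (le_trans lt tm).
  rewrite euler_path_node// -/(chain B x0 a sg (level q) n l om).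
  have := H1 (l%:R * euler_step n) t i l0 lt tm.
  have -> : t - l%:R * euler_step n <= h1.
    by move: tl nh1; rewrite -(natr1 l) mulrDl mul1r; lra.
  move=> /(_ isT).
  rewrite !ler_norml => /andP[? ?] /andP[? ?]; apply/andP; split; lra.
apply/andP; split.
  apply/forallP => i; apply/ler_addgt0Pr => e e0.
  have [y sy yx] := close e e0.
  have := safe_bound i sy; have := yx i.
  have := lerB_dist (truncated_solution q t i) (y i); rewrite distrC; lra.
apply/forallP => i; apply/forallP => j; apply/implyP => ji.
apply/ler_addgt0Pr => e e0.
have e20 : 0 < e / 2 by rewrite divr_gt0.
have [y sy yx] := close _ e20.
have := safe_gap sy ji; have := yx i; have := yx j.
set X := truncated_solution q t.
rewrite (_ : y i - y j = (X i - X j) + (y i - X i) - (y j - X j)); last by ring.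
have := ler_normB (X i - X j + (y i - X i)) (y j - X j).
have := ler_normD (X i - X j) (y i - X i); lra.
Qed.

(** Along a path that is safe for [level q], the two truncated drifts coincide. *)
Lemma truncated_solution_stable q q' (m : R) : (q <= q')%N -> 0 <= m ->
  (forall t, 0 <= t -> t <= m -> safe (level q) (truncated_solution q t)) ->
  forall t i, 0 <= t -> t <= m -> truncated_solution q' t i = truncated_solution q t i.
Proof.
move=> qq m0 sX.
apply: (solution_upto_unique (L0 q') (@b_lip q') m0 (truncated_solution_upto q' m0)).
apply: solution_upto_ext (truncated_solution_upto q m0) => s s0 sm.
have l0 := @level_gt0 R.
rewrite /b /a !trdrift_drift//; last exact: sX.
by apply: safeW (sX s s0 sm) => //; exact: level_nonincreasing.
Qed.

Hypothesis B0 : forall i, B i 0 om = 0.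
Hypothesis survives : forall m : nat, exists q,
  forall n0, exists2 n, (n0 <= n)%N & alive B x0 a sg (level q) n (m * n.+1 ^ 2) om.

Lemma glued_solution_eq (m : nat) : exists2 q,
  (forall t, 0 <= t -> t <= m%:R -> safe (level q) (glued_solution t)) &
  (forall t, 0 <= t -> t <= m%:R -> glued_solution t = truncated_solution q t) .
Proof.
have [q Hq] := survives m.
have sX := truncated_solution_safe Hq.
have E t : 0 <= t -> t <= m%:R -> glued_solution t = truncated_solution q t.
  move=> t0 tm; apply/funext => i; rewrite /glued_solution.
  apply/cvg_lim => //; apply: cvg_near_cst.
  by exists q => // q' /= qq'; apply: (truncated_solution_stable qq' _ sX).
by exists q => // t t0 tm; rewrite E//; exact: sX.
Qed.

Lemma glued_solution_cvg t i : 0 <= t ->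
  truncated_solution q t i @[q --> \oo] --> glued_solution t i.
Proof.
move=> t0; pose m := (Num.truncn t).+1.
have tm : t <= m%:R by exact/ltW/truncnS_gt.
have [q Hq] := survives m.
have sX := truncated_solution_safe Hq.
apply/cvg_ex; exists (truncated_solution q t i).
apply: cvg_near_cst.
by exists q => // q' /= qq'; apply: (truncated_solution_stable qq' _ sX).
Qed.

Lemma glued_solution_safe (m : R) : 0 <= m -> exists2 eps, 0 < eps &
  forall s, 0 <= s -> s <= m -> safe eps (glued_solution s).
Proof.
move=> m0; have [q Hq _] := glued_solution_eq (Num.truncn m).+1.
exists (level q); first exact: level_gt0.
move=> s s0 sm; apply: Hq => //; apply: le_trans sm _.
exact/ltW/truncnS_gt.
Qed.

Lemma glued_solution_solves :
  solves_system alpha beta x0 glued_solution (fun t i => B i t om).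
Proof.
have W0 j : W 0 j = 0 by rewrite /W /driving_noise subrr mulr0.
have bound (t : R) : t <= (Num.truncn t).+1%:R by exact/ltW/truncnS_gt.
split.
- move=> i; apply/within_continuousP => x; rewrite /= in_itv/= andbT => x_0 e e0.
  pose m := (Num.truncn (x + 1)).+1.
  have [q _ E] := glued_solution_eq m.
  have m0 : 0 <= m%:R :> R by [].
  have Xs := truncated_solution_upto q m0.
  have Xu := solution_upto_uniform (C0 q) (@b_bnd q) Xs (W_unif m%:R).
  have xm : x + 1 <= m%:R by exact: bound.
  have /within_continuousP/(_ x)/(_ _ _ e0)[|dl dl0 H] := @uniform_path_continuous _ _ _ _ Xu i.
    by rewrite /= in_itv/= x_0/=; lra.
  exists (Num.min dl 1); first by rewrite lt_min dl0 ltr01.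
  move=> y; rewrite /= in_itv/= andbT => y0; rewrite lt_min => /andP[ydl y1].
  have ym : y <= m%:R by move: y1; rewrite ltr_norml => /andP[]; lra.
  rewrite !E//; last lra.
  by apply: H => //; rewrite /= in_itv/= y0.
- have [q _ E] := glued_solution_eq 0.
  rewrite E//; apply/funext => i.
  by have [] := @truncated_solution_upto q 0 (lexx _).
- apply: aeW => s s0; have [eps e0 H] := glued_solution_safe s0.
  exact: safe_domainD e0 (H s s0 (lexx _)).
- move=> t i t0; have [q sX E] := glued_solution_eq (Num.truncn t).+1.
  have t1 := bound t.
  have [gi _] := solution_upto_integral (L0 q) (C0 q) (@b_lip q) (@b_bnd q)
    W0 (W_unif t) (truncated_solution_upto q t0) i t0 (lexx t).
  apply: eq_integrable gi => // s; rewrite inE /= in_itv/= => /andP[s0 st].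
  have sm := le_trans st t1.
  by rewrite /b /a -(E s s0 sm) (trdrift_drift alpha (@level_gt0 R q) (sX s s0 sm)).
- move=> t i t0; have [q sX E] := glued_solution_eq (Num.truncn t).+1.
  have t1 := bound t.
  have [_ gE] := solution_upto_integral (L0 q) (C0 q) (@b_lip q) (@b_bnd q)
    W0 (W_unif t) (truncated_solution_upto q t0) i t0 (lexx t).
  rewrite (E t t0 t1) gE /W /driving_noise B0 subr0; congr (_ + _ + _).
  apply: eq_Rintegral => s; rewrite inE /= in_itv/= => /andP[s0 st].
  have sm := le_trans st t1.
  by rewrite /b /a -(E s s0 sm) (trdrift_drift alpha (@level_gt0 R q) (sX s s0 sm)).
Qed.

Lemma glued_solution_boundary_time : boundary_time glued_solution = +oo%E.
Proof.
apply/eqyP => r r0.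
have [e1 e10 sX] := glued_solution_safe (ltW r0).
pose eps := e1 / 2.
have eps0 : 0 < eps by rewrite divr_gt0.
apply: (@le_trans _ _ (exit_time glued_solution eps)); last first.
  by apply: ereal_sup_ubound; exists eps.
apply: le_ereal_inf_tmp => _ [t [t0 Ht] <-]; rewrite lee_fin leNgt; apply/negP => tr.
have st := sX t t0 (ltW tr).
case: Ht; rewrite leNgt => /negP; apply.
- rewrite /max_abs; apply: (@le_lt_trans _ _ e1^-1); last first.
    by rewrite ltf_pV2 ?posrE// /eps; lra.
  apply: bigmax_le; first by rewrite invr_ge0 ltW.
  by move=> i _; exact: safe_bound.
- rewrite /min_gap; apply: lt_bigmin; first exact: ltry.
  move=> [i j] /= ij; rewrite lte_fin; apply: (@lt_le_trans _ _ e1).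
    by rewrite /eps; lra.
  by apply: (safe_gap st); rewrite eq_sym.
Qed.

End Gluing.

(** * Adaptedness, and the theorem *)

Section Adaptedness.
Context {R : realType} {N : nat}.

(** The polygon at time [t] looks at the noise at [t] and at earlier grid times. *)
Lemma measurable_euler_path {d : measure_display} {T : measurableType d}
    (B : 'I_N -> R -> T -> R) (x0 : 'I_N -> R) (a sg eps : R) n (t : R) i :
  0 < eps -> 0 <= t ->
  (forall u j, 0 <= u -> u <= t -> measurable_fun setT (B j u)) ->
  measurable_fun setT (fun om =>
    euler_path (trdrift a eps) (driving_noise B sg om) x0 (euler_step n) t i).
Proof.
move=> e0 t0 mB; have h0 := @euler_step_gt0 R n.
set k := Num.truncn (t / euler_step n).
have kt : k%:R * euler_step n <= t.
  by rewrite -ler_pdivlMr//; have /andP[] := truncn_itv (divr_ge0 t0 (ltW h0)).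
have mc j : measurable_fun setT (fun om => chain B x0 a sg eps n k om j).
  apply: measurable_chain => // u l u0 uk; apply: mB => //; exact: le_trans uk kt.
have k0 : 0 <= k%:R * euler_step n :> R by rewrite mulr_ge0// ltW.
have mn u : 0 <= u -> u <= t -> measurable_fun setT (fun om => driving_noise B sg om u i).
  move=> u0 ut; apply: measurable_funM => //; apply: measurable_funB; exact: mB.
rewrite /euler_path; apply: measurable_funD; last by apply: measurable_funB; exact: mn.
apply: measurable_funD; first exact: mc.
by apply: measurable_funM => //; apply: measurable_trdrift.
Qed.

Context {d : measure_display} {T : measurableType d}.
Variables (P : probability T R) (B : 'I_N -> R -> T -> R).
Variables (x0 : 'I_N -> R) (alpha beta : R) (Null : set T).
Hypotheses (mNull : measurable Null) (PNull : P Null = 0%E).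

(** On the exceptional event the limits need not exist.  A constant value there
    preserves adaptedness, because null events belong to the augmented
    filtration. *)
Definition solution_process (t : R) (om : T) (i : 'I_N) : R :=
  if om \in Null then x0 i else glued_solution B x0 alpha beta om t i.

Lemma solution_process_adapted : 
  (forall t om i, 0 <= t -> ~ Null om ->
    (forall q, euler_path (trdrift (alpha / N%:R ^+ 2) (level q))
        (driving_noise B (2 * Num.sqrt (alpha / beta)) om) x0 (euler_step n) t i
      @[n --> \oo] --> truncated_solution B x0 alpha beta om q t i) /\
    truncated_solution B x0 alpha beta om q t i @[q --> \oo]
      --> glued_solution B x0 alpha beta om t i) ->
  adapted (augmented_filtration P B) solution_process.
Proof.
move=> cv t i t0.
set G := (sigma_of [set p : 'I_N * R | 0 <= p.2 <= t] (fun p => B p.1 p.2)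
      `|` [set A | measurable A /\ P A = 0%E]).
suff /F_measurableP : measurable_fun setT
    ((fun om => solution_process t om i) : g_sigma_algebraType G -> R).
  by move=> H A mA; exact: H.
have mN : measurable_fun setT ((fun om => om \in Null) : g_sigma_algebraType G -> bool).
  apply: (measurable_fun_bool true); rewrite setTI.
  rewrite (_ : _ @^-1` _ = Null); first by apply: sub_gen_smallest; right.
  by apply/seteqP; split => om /=; [move=> /set_mem | move=> /mem_set].
have mB u j : 0 <= u -> u <= t ->
    measurable_fun setT (B j u : g_sigma_algebraType G -> R).
  move=> u0 ut; apply/F_measurableP => A mA; apply: sub_gen_smallest; left.
  apply: (sigma_of_measurable (J := [set p : 'I_N * R | 0 <= p.2 <= t])
    (X := fun p => B p.1 p.2) (i := (j, u))) => //=.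
  by rewrite u0.
pose sg := 2 * Num.sqrt (alpha / beta).
pose Xn q n (om : g_sigma_algebraType G) : R := if om \in Null then x0 i else
  euler_path (trdrift (alpha / N%:R ^+ 2) (level q)) (driving_noise B sg om) x0 (euler_step n) t i.
pose Xq q (om : g_sigma_algebraType G) : R := if om \in Null then x0 i else
  truncated_solution B x0 alpha beta om q t i.
have mXn q n : measurable_fun setT (Xn q n).
  apply: measurable_fun_ifT => //.
  by apply: measurable_euler_path => //; exact: level_gt0.
have mXq q : measurable_fun setT (Xq q).
  apply: (measurable_fun_cvg (mXn q)) => om _; rewrite /Xn /Xq.
  have [_|nom] := boolP (om \in Null); first exact: cvg_cst.
  have nN : ~ Null om by move=> /mem_set; apply/negP.
  by have [+ _] := cv t om i t0 nN; apply.
apply: (measurable_fun_cvg mXq) => om _; rewrite /Xq /solution_process.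
have [_|nom] := boolP (om \in Null); first exact: cvg_cst.
have nN : ~ Null om by move=> /mem_set; apply/negP.
by have [] := cv t om i t0 nN.
Qed.

End Adaptedness.

Theorem theorem6p2 (R : realType) (N : nat) (alpha beta : R)
    (hN : (2 <= N)%N) (halpha : 0 < alpha) (hbeta : 0 < beta)
    (hbetaN : 2 * N%:R ^+ 2 <= beta)
    (d : measure_display) (T : measurableType d) (P : probability T R)
    (B : 'I_N -> R -> T -> R) (hB : independent_brownian_motions P B)
    (x0 : 'I_N -> R) (hx0 : domainD x0) :
  exists X : R -> T -> 'I_N -> R,
    [/\ strong_solution P B alpha beta x0 X,
        {ae P, forall w, boundary_time (X ^~ w) = +oo%E}
      & forall Y : R -> T -> 'I_N -> R,
          strong_solution P B alpha beta x0 Y -> indistinguishable P X Y].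
Proof.
have al0 : 0 <= alpha by exact: ltW.
pose a := alpha / N%:R ^+ 2; pose sg := 2 * Num.sqrt (alpha / beta).
have N0 : 0 < N%:R :> R by rewrite ltr0n; exact: ltnW.
have NN0 : 0 < N%:R ^+ 2 :> R by rewrite exprn_gt0.
have a0 : 0 <= a by rewrite divr_ge0// ltW.
(* [hbetaN], restated for the strengths of noise and repulsion *)
have sga : sg ^+ 2 <= 2 * a.
  rewrite /sg exprMn sqr_sqrtr ?divr_ge0 ?(ltW hbeta)// /a.
  have : beta^-1 <= (2 * N%:R ^+ 2)^-1 by rewrite lef_pV2 ?posrE ?mulr_gt0.
  move=> /(ler_wpM2l al0); rewrite (invfM 2).
  move: (beta^-1) (N%:R ^- 2) => u v; lra.
pose good om := [/\ forall i, {within `[0, +oo[, continuous (fun t => B i t om)},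
  forall i, B i 0 om = 0 &
  forall m : nat, exists q, forall n0, exists2 n, (n0 <= n)%N &
    alive B x0 a sg (level q) n (m * n.+1 ^ 2) om].
have good_ae : {ae P, forall om, good om}.
  have h1 : {ae P, forall om, forall i, {within `[0, +oo[, continuous (fun t => B i t om)}}.
    by apply: filter_forall => i; case: hB => /(_ i)[].
  have h2 : {ae P, forall om, forall i, B i 0 om = 0}.
    by apply: filter_forall => i; case: hB => /(_ i)[].
  have h3 : {ae P, forall om, forall m : nat, exists q, forall n0,
      exists2 n, (n0 <= n)%N & alive B x0 a sg (level q) n (m * n.+1 ^ 2) om}.
    apply/ae_foralln => m; apply: filterS (survival hB hN a0 sga hx0 m) => om [q [_ Hq]].
    by exists q.
  by apply: filterS3 h1 h2 h3 => om c1 c2 c3; split.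
have [Null [mNull PNull subNull]] := good_ae.
have goodN om : ~ Null om -> good om.
  by move=> nN; apply: contrapT => ng; apply: nN; exact: subNull.
pose X := solution_process B x0 alpha beta Null.
have XE om : ~ Null om -> X ^~ om = glued_solution B x0 alpha beta om.
  move=> nN; apply/funext => t; apply/funext => i; rewrite /X /solution_process.
  by rewrite memNset.
have aeNull (Q : T -> Prop) : (forall om, ~ Null om -> Q om) -> {ae P, forall om, Q om}.
  move=> H; exists Null; split => // om /= nQ; apply: contrapT => nN; apply: nQ.
  exact: H.
have solX om : ~ Null om -> solves_system alpha beta x0 (X^~ om) (fun t i => B i t om).
  move=> nN; have [c1 c2 c3] := goodN om nN; rewrite XE//.
  exact: glued_solution_solves.
exists X; split.
- split; last exact: aeNull.
  apply: solution_process_adapted => // t om i t0 nN.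
  have [c1 c2 c3] := goodN om nN; split=> [q|]; first exact: truncated_solution_cvg.
  exact: glued_solution_cvg.
- apply: aeNull => om nN; have [c1 c2 c3] := goodN om nN; rewrite XE//.
  exact: glued_solution_boundary_time.
- move=> Y [_ solY]; have aeN := aeNull (fun om => ~ Null om) (fun om nN => nN).
  apply: filterS2 solY aeN => om Sy nN t t0; apply/funext => i.
  apply: (solves_system_unique al0 (solX om nN) Sy) => // r r0.
  have [c1 c2 c3] := goodN om nN.
  have [eps e0 H] := glued_solution_safe al0 c1 c3 r0.
  exists eps => // s s0 sr.
  by rewrite (congr1 (fun f => f s) (XE om nN)); exact: H.
Qed.
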